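(* Let $\Theta$ be a free holomorphic function in the unit ball of $H^2_{\bf ball}(B(\mathcal E,\mathcal Y))$, and let $F$ be a free holomorphic function in $H_{\bf ball}(B(\mathcal E))$ such that $F(0)=I$. Then $$\Theta(rR_1,\dots,rR_n)^*\Theta(rR_1,\dots,rR_n)\le\mathrm{Re}\,F(rR_1,\dots,rR_n)\qquad\text{for } r\in[0,1)$$ if and only if there exists $G$ in the unit ball of ${\bf H}_0^\infty(B(\mathcal D_\Gamma))$ such that $$F(X)=W(X)+(D_\Gamma\otimes I)[I+G(X)][I-G(X)]^{-1}(D_\Gamma\otimes I),\qquad X\in[B(\mathcal H)^n]_1,$$ where $\Gamma$ is the symbol of $\Theta$ and $$W(X_1,\dots,X_n)=(\Gamma^*\otimes I_{\mathcal H})\Big(I+\sum_{i=1}^nI_{\mathcal Y}\otimes S_i^*\otimes X_i\Big)\Big(I-\sum_{i=1}^nI_{\mathcal Y}\otimes S_i^*\otimes X_i\Big)^{-1}(\Gamma\otimes I_{\mathcal H}),$$ with $I=I_{\mathcal Y\otimes F^2(H_n)\otimes\mathcal H}$ in the last formula. Moreover, $F$ and $G$ uniquely determine each other.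
   Context: Let $n\ge 1$; $\mathcal E,\mathcal Y$ are Hilbert spaces ($\mathcal E$ separable) and $\mathcal H$ is an infinite dimensional Hilbert space. $\mathbb F_n^+$ is the free unital semigroup on $g_1,\dots,g_n$ with identity $g_0$, $|\alpha|$ is word length, and $\tilde\alpha=g_{i_k}\cdots g_{i_1}$ is the reverse of $\alpha=g_{i_1}\cdots g_{i_k}$. For operators $X_1,\dots,X_n$, $X_\alpha=X_{i_1}\cdots X_{i_k}$, $X_{g_0}=I$. $H_n$ is an $n$-dimensional complex Hilbert space with orthonormal basis $e_1,\dots,e_n$, $F^2(H_n)=\mathbb C1\oplus\bigoplus_{k\ge1}H_n^{\otimes k}$, with orthonormal basis $e_\alpha=e_{i_1}\otimes\cdots\otimes e_{i_k}$, $e_{g_0}=1$; $S_i\varphi=e_i\otimes\varphi$ and $R_i\varphi=\varphi\otimes e_i$ are the left and right creation operators. $[B(\mathcal H)^n]_1=\{(X_1,\dots,X_n)\in B(\mathcal H)^n:\|\sum_iX_iX_i^*\|^{1/2}<1\}$. $H_{\bf ball}(B(\mathcal E,\mathcal Y))$ is the set of free holomorphic functions on $[B(\mathcal H)^n]_1$ with coefficients in $B(\mathcal E,\mathcal Y)$, i.e. maps $\Theta(X)=\sum_{k=0}^\infty\sum_{|\alpha|=k}A_{(\alpha)}\otimes X_\alpha$ with $A_{(\alpha)}\in B(\mathcal E,\mathcal Y)$ and $\limsup_k\|\sum_{|\alpha|=k}A_{(\alpha)}^*A_{(\alpha)}\|^{1/2k}\le1$ (evaluated also at $(rR_1,\dots,rR_n)$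 by the same series); $H_{\bf ball}(B(\mathcal E))=H_{\bf ball}(B(\mathcal E,\mathcal E))$. $\Theta$ is in $H^2_{\bf ball}(B(\mathcal E,\mathcal Y))$ if $\|\Theta\|_2:=\|\sum_\alpha A_{(\alpha)}^*A_{(\alpha)}\|^{1/2}<\infty$; the unit ball is $\{\|\Theta\|_2\le1\}$. The symbol of such $\Theta$ is $\Gamma:\mathcal E\to\mathcal Y\otimes F^2(H_n)$, $\Gamma x=\sum_\alpha A_{(\alpha)}x\otimes e_{\tilde\alpha}$ (a contraction when $\|\Theta\|_2\le1$). For a contraction $T:\mathcal H_1\to\mathcal H_2$, $D_T=(I-T^*T)^{1/2}$ and $\mathcal D_T=\overline{D_T\mathcal H_1}$. ${\bf H}_0^\infty(B(\mathcal D_\Gamma))$ is the set of $G\in H_{\bf ball}(B(\mathcal D_\Gamma))$ with $\|G\|_\infty:=\sup_{X\in[B(\mathcal H)^n]_1}\|G(X)\|<\infty$ and $G(0)=0$; its unit ball is $\{\|G\|_\infty\le1\}$. *)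

(* Defs.v *)
From HB Require Import structures.
From mathcomp Require Import all_boot all_order all_algebra complex.
From mathcomp Require Import all_classical all_reals all_analysis.

Set Implicit Arguments.
Unset Strict Implicit.
Unset Printing Implicit Defensive.

Import Order.TTheory GRing.Theory Num.Theory.
Import numFieldNormedType.Exports.

Local Open Scope classical_set_scope.
Local Open Scope ring_scope.
Local Open Scope complex_scope.

(* The inner product is linear in the first argument.  Separability and       *)
(* dimension are not restricted.                                              *)
HB.mixin Record isHilbert (R : realType) V & CompleteNormedModule R[i] V := {
  hdot : V -> V -> R[i];
  hdotP : forall (a : R[i]) (x y z : V),
    hdot (a *: x + y) z = a * hdot x z + hdot y z;
  hdotC : forall x y : V, hdot y x = Num.conj (hdot x y);
  hdot_norm : forall x : V, hdot x x = `|x| ^+ 2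
}.

#[short(type="hilbertType")]
HB.structure Definition Hilbert (R : realType) :=
  {V of CompleteNormedModule R[i] V & isHilbert R V}.

(* Norms of vectors live in R[i] in the library; this is the same number in R *)
Definition hnorm (R : realType) (V : hilbertType R) (x : V) : R :=
  complex.Re `|x|.

Definition separable (T : topologicalType) :=
  exists2 D : set T, countable D & dense D.

Definition infinite_dimensional (R : realType) (V : hilbertType R) :=
  forall s : seq V, exists x : V,
    forall c : 'I_(size s) -> R[i], x <> \sum_(i < size s) c i *: s`_i.

Section BoundedOperators.
Context {R : realType}.

Section Type_.
Variables E F : hilbertType R.

Definition bop_pred : {pred E -> F} :=
  fun f => `[< linear f /\ continuous f >].

Record bop := Bop { bop_fun :> E -> F; bop_funP : bop_fun \in bop_pred }.

HB.instance Definition _ := [isSub for bop_fun].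
HB.instance Definition _ := [Choice of bop by <:].

Lemma bop_linear (T : bop) : linear T.
Proof. by have /asboolP[] := bop_funP T. Qed.

Lemma bop_continuous (T : bop) : continuous T.
Proof. by have /asboolP[] := bop_funP T. Qed.

HB.instance Definition _ (T : bop) :=
  GRing.isLinear.Build R[i] E F *:%R T (bop_linear T).

Fact bop_submod_closed : submod_closed bop_pred.
Proof.
split.
  apply/asboolP; split; first by move=> a x y; change (0 = a *: 0 + 0 :> F); rewrite scaler0 addr0.
  by move=> x; exact: cvg_cst.
move=> a f g /asboolP[lf cf] /asboolP[lg cg]; apply/asboolP; split.
  move=> b x y.
  change (a *: f (b *: x + y) + g (b *: x + y) =
          b *: (a *: f x + g x) + (a *: f y + g y)).
  by rewrite lf lg !scalerDr !scalerA [b * a]mulrC addrACA.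
move=> x; apply: (@cvgD _ _ _ _ _ (fun x => a *: f x) g); last exact: cg.
by apply: cvgZl_tmp; exact: cf.
Qed.

HB.instance Definition _ :=
  GRing.isSubmodClosed.Build R[i] (E -> F) bop_pred bop_submod_closed.
HB.instance Definition _ := [SubChoice_isSubLmodule of bop by <:].

Definition opnorm (T : bop) : R :=
  sup [set hnorm (T x) | x in [set x | hnorm x <= 1]].

(* limit in operator norm *)
Definition op_lim (u : nat -> bop) : bop :=
  xget 0 [set T : bop | opnorm (u N - T) @[N --> \oo] --> (0 : R)].

End Type_.

Fact bid_subproof (E : hilbertType R) : (fun x : E => x) \in @bop_pred E E.
Proof. by apply/asboolP; split => // x; exact: cvg_id. Qed.

Definition bid (E : hilbertType R) : bop E E := Bop (bid_subproof E).

Fact bcomp_subproof (E F K : hilbertType R) (S : bop F K) (T : bop E F) :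
  (fun x => S (T x)) \in @bop_pred E K.
Proof.
apply/asboolP; split; first by move=> a x y; rewrite !linearP.
move=> x; apply: (@continuous_comp _ _ _ T S); exact: bop_continuous.
Qed.

Definition bcomp (E F K : hilbertType R) (S : bop F K) (T : bop E F) :
  bop E K := Bop (bcomp_subproof S T).

Definition hadj (E F : hilbertType R) (T : bop E F) : bop F E :=
  xget 0 [set S : bop F E | forall x y, hdot (T x) y = hdot x (S y)].

Definition opinv (E : hilbertType R) (T : bop E E) : bop E E :=
  xget 0 [set S : bop E E | bcomp S T = bid E /\ bcomp T S = bid E].

(* In R[i], 0 <= z means that z is real and nonnegative. *)
Definition op_le (E : hilbertType R) (S T : bop E E) :=
  forall x, 0 <= hdot ((T - S) x) x.

Definition opRe (E : hilbertType R) (T : bop E E) : bop E E :=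
  2^-1 *: (T + hadj T).

Definition opsqrt (E : hilbertType R) (T : bop E E) : bop E E :=
  xget 0 [set Q : bop E E | op_le 0 Q /\ bcomp Q Q = T].

End BoundedOperators.

Arguments bid {R} E.
Notation "S '\bo' T" := (bcomp S T) (at level 40, left associativity).

Section ClosedSubspace.
Context {R : realType} {V : hilbertType R}.

Record closed_subspace := ClosedSubspace {
  cs_pred : {pred V};
  cs_submod : submod_closed cs_pred;
  cs_closed : closed [set x | x \in cs_pred] }.

Variable S : closed_subspace.

Record cs_type := CsType { cs_val : V; cs_valP : cs_val \in cs_pred S }.

HB.instance Definition _ := [isSub for cs_val].
HB.instance Definition _ := [Choice of cs_type by <:].
HB.instance Definition _ :=
  GRing.isSubmodClosed.Build R[i] V (cs_pred S) (cs_submod S).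
HB.instance Definition _ := [SubChoice_isSubLmodule of cs_type by <:].

Let norm (x : cs_type) : R[i] := `|val x|.

Let ler_normD x y : norm (x + y) <= norm x + norm y.
Proof. by rewrite /norm raddfD ler_normD. Qed.

Let normrZ a x : norm (a *: x) = `|a| * norm x.
Proof. by rewrite /norm linearZ normrZ. Qed.

Let normr0_eq0 x : norm x = 0 -> x = 0.
Proof. by move/eqP; rewrite normr_eq0 => /eqP x0; apply: val_inj; rewrite x0 raddf0. Qed.

HB.instance Definition _ := Lmodule_isNormed.Build R[i] cs_type
  ler_normD normrZ normr0_eq0.

Let cs_complete (F : set_system cs_type) : ProperFilter F -> cauchy F -> cvg F.
Proof.
move=> FF /cauchy_ballP Fc.
have GF : ProperFilter (cs_val @ F) by exact: fmap_proper_filter.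
have VF : cauchy (cs_val @ F).
  apply/cauchy_ballP => e e0; have [[A B]/= [FA FB] AB] := Fc e e0.
  exists (cs_val @` A, cs_val @` B) => /=.
    by split; [apply: filterS FA|apply: filterS FB] => x /= ?; exists x.
  move=> [u v] [[a Aa au] [b Bb bv]]; have := AB (a, b) (conj Aa Bb).
  by rewrite -au -bv -!ball_normE /= /ball_ /=.
pose l := lim (cs_val @ F).
have Fl : cs_val @ F --> l by exact: cauchy_cvg VF.
have Sl : l \in cs_pred S.
  apply: (@closed_cvg _ _ F FF cs_val _ (@cs_closed S) _ l Fl).
  by apply: nearW => x; exact: cs_valP.
apply/cvg_ex; exists (CsType Sl); apply/cvgrPdist_lt => e e0.
by move/cvgrPdist_lt : Fl => /(_ e e0).
Qed.

HB.instance Definition _ := Uniform_isComplete.Build cs_type cs_complete.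

Let dot (x y : cs_type) : R[i] := hdot (val x) (val y).

Let dotP a x y z : dot (a *: x + y) z = a * dot x z + dot y z.
Proof. by rewrite /dot linearP hdotP. Qed.

Let dotC x y : dot y x = Num.conj (dot x y).
Proof. exact: hdotC. Qed.

Let dot_norm x : dot x x = `|x| ^+ 2.
Proof. exact: hdot_norm. Qed.

HB.instance Definition _ := isHilbert.Build R cs_type dotP dotC dot_norm.

End ClosedSubspace.

Section DefectSpace.
Context {R : realType}.

Section ClosureOfRange.
Variables (E F : hilbertType R) (T : bop E F).

Let clr : {pred F} := fun y => `[< closure (range T) y >].

Let clr_submod : submod_closed clr.
Proof.
split; first by apply/asboolP; apply: subset_closure; exists 0 => //; rewrite linear0.
move=> a x y /asboolP clx /asboolP cly; apply/asboolP.
pose f (z : F * F) := a *: z.1 + z.2.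
have fc : continuous f.
  move=> z; apply: (@cvgD _ _ _ _ _ (fun z : F * F => a *: z.1) snd).
    by apply: cvgZl_tmp; exact: cvg_fst.
  exact: cvg_snd.
move=> B /(fc (x, y))[[U V]/= [Ux Vy] UVB].
have [_ [[u _ <-] Uu]] := clx _ Ux; have [_ [[v _ <-] Vv]] := cly _ Vy.
exists (f (T u, T v)); split; last exact: UVB.
by exists (a *: u + v) => //; rewrite linearP.
Qed.

Let clr_closed : closed [set y | y \in clr].
Proof.
rewrite (_ : mkset _ = closure (range T)); first exact: closed_closure.
by apply/seteqP; split=> y /asboolP.
Qed.

Definition closure_range : closed_subspace := ClosedSubspace clr_submod clr_closed.

Fact corestrict_mem x : T x \in cs_pred closure_range.
Proof. by apply/asboolP; apply: subset_closure; exists x. Qed.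

Fact corestrict_subproof :
  (fun x => CsType (corestrict_mem x)) \in @bop_pred R E (cs_type closure_range).
Proof.
apply/asboolP; split; first by move=> a x y; apply: val_inj; rewrite /= linearP.
move=> x; apply/cvgrPdist_lt => e e0.
by have /cvgrPdist_lt/(_ e e0) := @bop_continuous _ _ _ T x.
Qed.

(* T viewed as an operator into the closure of its range *)
Definition corestrict : bop E (cs_type closure_range) := Bop corestrict_subproof.

End ClosureOfRange.

Section Restriction.
Variables (E F : hilbertType R) (S : closed_subspace (V := E)) (T : bop E F).

Fact restrict_subproof : (fun x => T (val x)) \in @bop_pred R (cs_type S) F.
Proof.
apply/asboolP; split; first by move=> a x y; rewrite !linearP.
move=> x; apply: (@continuous_comp _ _ _ (@cs_val _ _ S) T); last exact: bop_continuous.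
apply/(@cvgrPdist_lt _ _ _ (nbhs x)) => e e0.
by have /(@cvgrPdist_lt _ _ _ (nbhs x))/(_ e e0) := @cvg_id _ (nbhs x).
Qed.

Definition restrict : bop (cs_type S) F := Bop restrict_subproof.

End Restriction.

Variables (E F : hilbertType R) (T : bop E F).

Definition defect : bop E E := opsqrt (bid E - hadj T \bo T).

Definition defect_space : hilbertType R := cs_type (closure_range defect).

(* D_T enters the parametrization as an operator from E to the defect space   *)
(* and, restricted to that space, as an operator back to E                    *)
Definition defect_to : bop E defect_space := corestrict defect.

Definition defect_from : bop defect_space E :=
  restrict (closure_range defect) defect.

End DefectSpace.

(* A Hilbert space tensor product of K and L is determined up to a unique     *)
(* unitary by these two properties; bilinearity of tpure follows from the     *)
(* first one.                                                                 *)
Record hilbert_tensor (R : realType) (K L : hilbertType R) := HilbertTensor {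
  tensor_space :> hilbertType R;
  tpure : K -> L -> tensor_space;
  tpure_dot : forall x y x' y',
    hdot (tpure x y) (tpure x' y') = hdot x x' * hdot y y';
  tpure_dense :
    dense [set z | exists s : seq (K * L), z = \sum_(p <- s) tpure p.1 p.2] }.

Definition tensor_product (R : realType) :=
  forall K L : hilbertType R, hilbert_tensor K L.

(* The full Fock space F^2(H_n), given with its orthonormal basis (e_alpha);  *)
(* the word g_{i_1} ... g_{i_k} is the sequence [:: i_1; ...; i_k], and       *)
(* fock_e is the tensor e_{i_1} (x) ... (x) e_{i_k}.                          *)
Record fock_space (R : realType) (n : nat) := FockSpace {
  fock_carrier :> hilbertType R;
  fock_e : seq 'I_n -> fock_carrier;
  fock_e_orthonormal : forall a b, hdot (fock_e a) (fock_e b) = (a == b)%:R;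
  fock_e_total : dense [set z | exists (s : seq (seq 'I_n)) (c : seq 'I_n -> R[i]),
    z = \sum_(a <- s) c a *: fock_e a] }.

Section Fock.
Context {R : realType} {n : nat}.
Variable F2 : fock_space R n.

Definition left_creation (i : 'I_n) : bop F2 F2 :=
  xget 0 [set S : bop F2 F2 | forall a, S (fock_e F2 a) = fock_e F2 (i :: a)].

Definition right_creation (i : 'I_n) : bop F2 F2 :=
  xget 0 [set S : bop F2 F2 | forall a, S (fock_e F2 a) = fock_e F2 (rcons a i)].

Definition scaled_right_creation (r : R) (i : 'I_n) : bop F2 F2 :=
  r%:C *: right_creation i.

End Fock.

Section Words.
Context {R : realType} {n : nat} {L : hilbertType R}.

Definition opword (X : 'I_n -> bop L L) (a : seq 'I_n) : bop L L :=
  foldr (fun i T => X i \bo T) (bid L) a.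

Definition row_ball (X : 'I_n -> bop L L) :=
  Num.sqrt (opnorm (\sum_i X i \bo hadj (X i))) < 1.

End Words.

(* A free holomorphic function is given by its coefficients.  The k = 0 term  *)
(* (where 1 / 2k is 0) does not affect the limsup.                            *)
Record free_holo (R : realType) (n : nat) (E Y : hilbertType R) := FreeHolo {
  fh_coef :> seq 'I_n -> bop E Y;
  fh_radius : (limn_esup (fun k => ((opnorm (\sum_(a : k.-tuple 'I_n)
      hadj (fh_coef a) \bo fh_coef a)) `^ ((2 * k)%:R^-1))%:E) <= 1)%E }.

Section HardySpaces.
Context {R : realType} {n : nat} (tens : tensor_product R).

Definition tensop (K K' L L' : hilbertType R) (A : bop K K') (B : bop L L') :
    bop (tens K L) (tens K' L') :=
  xget 0 [set C : bop (tens K L) (tens K' L') |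
    forall x y, C (tpure (tens K L) x y) = tpure (tens K' L') (A x) (B y)].

Definition fh_eval (E Y L : hilbertType R) (Th : free_holo n E Y)
    (X : 'I_n -> bop L L) : bop (tens E L) (tens Y L) :=
  op_lim (fun N => \sum_(k < N) \sum_(a : k.-tuple 'I_n)
    tensop (Th a) (opword X a)).

(* S is the sum of the series of A_alpha^* A_alpha over all words, in the     *)
(* strong operator topology                                                   *)
Definition H2_sum (E Y : hilbertType R) (Th : free_holo n E Y) (S : bop E E) :=
  forall x, (\sum_(k < N) \sum_(a : k.-tuple 'I_n)
    (hadj (Th a) \bo Th a) x) @[N --> \oo] --> S x.

Definition H2_unit_ball (E Y : hilbertType R) (Th : free_holo n E Y) :=
  exists2 S, H2_sum Th S & Num.sqrt (opnorm S) <= 1.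

Definition Hinf_norm (H E Y : hilbertType R) (G : free_holo n E Y) : \bar R :=
  ereal_sup [set (opnorm (fh_eval G X))%:E | X in [set X : 'I_n -> bop H H | row_ball X]].

Definition H0inf (H E Y : hilbertType R) (G : free_holo n E Y) :=
  (Hinf_norm H G < +oo)%E /\ fh_eval G (fun=> 0 : bop H H) = 0.

Definition H0inf_unit_ball (H E Y : hilbertType R) (G : free_holo n E Y) :=
  H0inf H G /\ (Hinf_norm H G <= 1)%E.

Definition symbol (F2 : fock_space R n) (E Y : hilbertType R)
    (Th : free_holo n E Y) : bop E (tens Y F2) :=
  xget 0 [set T : bop E (tens Y F2) | forall x,
    (\sum_(k < N) \sum_(a : k.-tuple 'I_n)
      tpure (tens Y F2) (Th a x) (fock_e F2 (rev a))) @[N --> \oo] --> T x].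

Definition transfer (F2 : fock_space R n) (Y H : hilbertType R)
    (X : 'I_n -> bop H H) : bop (tens (tens Y F2) H) (tens (tens Y F2) H) :=
  \sum_i tensop (tensop (bid Y) (hadj (left_creation F2 i))) (X i).

Definition symbol_kernel (F2 : fock_space R n) (E Y H : hilbertType R)
    (Gam : bop E (tens Y F2)) (X : 'I_n -> bop H H) : bop (tens E H) (tens E H) :=
  tensop (hadj Gam) (bid H) \bo (bid _ + transfer F2 Y X)
    \bo opinv (bid _ - transfer F2 Y X) \bo tensop Gam (bid H).

Definition represents (F2 : fock_space R n) (E Y H : hilbertType R)
    (Gam : bop E (tens Y F2)) (F : free_holo n E E)
    (G : free_holo n (defect_space Gam) (defect_space Gam)) :=
  forall X : 'I_n -> bop H H, row_ball X ->
    fh_eval F X = symbol_kernel Gam X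
      + tensop (defect_from Gam) (bid H) \bo (bid _ + fh_eval G X)
          \bo opinv (bid _ - fh_eval G X) \bo tensop (defect_to Gam) (bid H).

End HardySpaces.

(* Main.v *)
(* The inequality says that K = Re F - Theta^* Theta, on finitely supported vectors,
   is a positive multi-Toeplitz kernel on E with K(g0, g0) = I - Gamma^* Gamma.
   Dilating it gives an operator C on E with C^* C = I - Gamma^* Gamma = D^2, hence C = U D
   with U an isometry on the defect space, and a column contraction L_1, ..., L_n
   such that F_a = 2 C^* L_a C + 2 Gamma^* (I (x) S_i^* )_a Gamma for every a <> g0.
   Summing the series, F - W = D (2 U^* (I - T)^-1 U - I) D with T = sum L_i (x) X_i,
   and U^* (I - T)^-1 U = (I - G)^-1 for the transfer function
   G = U^* T (I - Q T)^-1 U, Q = I - U U^*, which is bounded by |X|.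

   Conversely |T_S v|^2 <= |v|^2 - |E0^* v|^2 for T_S = sum (I (x) S_i^* ) (x) X_i and
   the vacuum map E0, which gives Re W(X) >= Theta(X)^* Theta(X) at every X in the row
   ball; it is used at X = r V R V^* with V an isometric embedding of the Fock space
   into H.  The same X, with r small enough for I - G(X) to be invertible,
   determines all coefficients and yields uniqueness. *)

Require Import Defs.
From HB Require Import structures.
From mathcomp Require Import all_boot all_order all_algebra complex.
From mathcomp Require Import all_classical all_reals all_analysis.
From mathcomp Require Import ring lra.
Import Order.TTheory GRing.Theory Num.Theory.
Import numFieldNormedType.Exports.
Local Open Scope classical_set_scope.
Local Open Scope ring_scope.

Set Implicit Arguments.
Unset Strict Implicit.
Unset Printing Implicit Defensive.

Local Open Scope complex_scope.

(** F(r R) need not stay bounded as r tends to 1, so the kernel K is not the form of a bounded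
    operator. Weighting words of length k by 2^-k turns it into a bounded positive operator P on E
    (x) F^2, and the square root of P replaces the completion of a quotient: the dilation space is E
    (x) F^2 itself. The factor 2 in F_a appears because Re F has F_a / 2 off the diagonal; F(0) = I
    fixes the diagonal as I and so brings in the defect operator of Gamma. The isometry U need not
    be onto, which is why G is not just the compression U^* T U but carries the resolvent of Q T.
    Adjoints, inverses, square roots, creation operators and A (x) B are all chosen by [xget] with
    default 0, so each must be shown to exist before it can be computed with. Inverses and square
    roots come from iterations; the rest relies on the Riesz representation of a functional given by
    its graph, and on extending a map from a family of vectors when Gram matrices dominate. *)

Definition redot (R : realType) (V : hilbertType R) (x y : V) : R :=
  complex.Re (hdot x y).

(** Measured by a real-valued norm, so that squeeze arguments take place in R; [hcvgP] identifies it
    with convergence in the normed module, whose radii lie in R[i]. *)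
Definition hcvg (R : realType) (V : hilbertType R) (u : nat -> V) (l : V) :=
  hnorm (u N - l) @[N --> \oo] --> (0 : R).

(** * Hilbert spaces through the real inner product *)

Section ComplexScalars.
Variable R : realType.

Lemma ReD (a b : R[i]) : complex.Re (a + b) = complex.Re a + complex.Re b.
Proof. by case: a b => [? ?] [? ?]. Qed.

Lemma ReN (a : R[i]) : complex.Re (- a) = - complex.Re a.
Proof. by case: a. Qed.

Lemma ReZ (r : R) (a : R[i]) : complex.Re (r%:C * a) = r * complex.Re a.
Proof. by case: a => ? ? /=; rewrite mul0r subr0. Qed.

Lemma Re_conj (a : R[i]) : complex.Re (Num.conj a) = complex.Re a.
Proof. by case: a. Qed.

Lemma Im_conj (a : R[i]) : complex.Im (Num.conj a) = - complex.Im a.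
Proof. by case: a. Qed.

Lemma Re_sum (I : Type) (s : seq I) (P : pred I) (F : I -> R[i]) :
  complex.Re (\sum_(i <- s | P i) F i) = \sum_(i <- s | P i) complex.Re (F i).
Proof. by apply: (big_morph _ ReD). Qed.

Lemma conjc_realE (r : R) : Num.conj (r%:C) = r%:C :> R[i].
Proof. by apply/eqP; rewrite eq_complex /= oppr0 !eqxx. Qed.

End ComplexScalars.

Section HilbertBasics.
Context {R : realType}.
Implicit Type V : hilbertType R.

Section Dot.
Context {V : hilbertType R}.
Implicit Types (x y z : V) (a : R[i]) (r : R).

Lemma hdot0l x : hdot (0 : V) x = 0.
Proof.
have := hdotP 1 (0 : V) 0 x.
by rewrite scaler0 addr0 mul1r => /(congr1 (fun t => t - hdot 0 x)); rewrite subrr addrK.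
Qed.

Lemma hdotDl x y z : hdot (x + y) z = hdot x z + hdot y z.
Proof. by rewrite -[x in LHS]scale1r hdotP mul1r. Qed.

Lemma hdotZl a x z : hdot (a *: x) z = a * hdot x z.
Proof. by rewrite -[a *: x]addr0 hdotP hdot0l addr0. Qed.

Lemma hdotNl x z : hdot (- x) z = - hdot x z.
Proof. by rewrite -scaleN1r hdotZl mulN1r. Qed.

Lemma hdotBl x y z : hdot (x - y) z = hdot x z - hdot y z.
Proof. by rewrite hdotDl hdotNl. Qed.

Lemma hdot0r x : hdot x (0 : V) = 0.
Proof. by rewrite hdotC hdot0l rmorph0. Qed.

Lemma hdotDr x y z : hdot x (y + z) = hdot x y + hdot x z.
Proof. by rewrite hdotC hdotDl rmorphD /= -!hdotC. Qed.

Lemma hdotZr a x z : hdot x (a *: z) = Num.conj a * hdot x z.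
Proof. by rewrite hdotC hdotZl rmorphM /= -hdotC. Qed.

Lemma hdotNr x z : hdot x (- z) = - hdot x z.
Proof. by rewrite hdotC hdotNl rmorphN /= -hdotC. Qed.

Lemma hdotBr x y z : hdot x (y - z) = hdot x y - hdot x z.
Proof. by rewrite hdotDr hdotNr. Qed.

Lemma hdot_suml (I : Type) (s : seq I) (P : pred I) (F : I -> V) z :
  hdot (\sum_(i <- s | P i) F i) z = \sum_(i <- s | P i) hdot (F i) z.
Proof. by apply: (big_morph (fun x => hdot x z) (fun x y => hdotDl x y z) (hdot0l z)). Qed.

Lemma hdot_sumr (I : Type) (s : seq I) (P : pred I) (F : I -> V) z :
  hdot z (\sum_(i <- s | P i) F i) = \sum_(i <- s | P i) hdot z (F i).
Proof. by apply: (big_morph (hdot z) (hdotDr z) (hdot0r z)). Qed.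

Lemma redotC x y : redot x y = redot y x.
Proof. by rewrite /redot hdotC Re_conj. Qed.

Lemma redot0l x : redot (0 : V) x = 0. Proof. by rewrite /redot hdot0l. Qed.
Lemma redot0r x : redot x (0 : V) = 0. Proof. by rewrite redotC redot0l. Qed.
Lemma redotDl x y z : redot (x + y) z = redot x z + redot y z.
Proof. by rewrite /redot hdotDl ReD. Qed.
Lemma redotDr x y z : redot x (y + z) = redot x y + redot x z.
Proof. by rewrite redotC redotDl !(redotC x). Qed.
Lemma redotNl x z : redot (- x) z = - redot x z.
Proof. by rewrite /redot hdotNl ReN. Qed.
Lemma redotNr x z : redot x (- z) = - redot x z.
Proof. by rewrite redotC redotNl redotC. Qed.
Lemma redotBl x y z : redot (x - y) z = redot x z - redot y z.
Proof. by rewrite redotDl redotNl. Qed.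
Lemma redotBr x y z : redot x (y - z) = redot x y - redot x z.
Proof. by rewrite redotDr redotNr. Qed.
Lemma redotZl r x z : redot (r%:C *: x) z = r * redot x z.
Proof. by rewrite /redot hdotZl ReZ. Qed.
Lemma redotZr r x z : redot x (r%:C *: z) = r * redot x z.
Proof. by rewrite redotC redotZl redotC. Qed.
Lemma redot_suml (I : Type) (s : seq I) (P : pred I) (F : I -> V) z :
  redot (\sum_(i <- s | P i) F i) z = \sum_(i <- s | P i) redot (F i) z.
Proof. by rewrite /redot hdot_suml Re_sum. Qed.
Lemma redot_sumr (I : Type) (s : seq I) (P : pred I) (F : I -> V) z :
  redot z (\sum_(i <- s | P i) F i) = \sum_(i <- s | P i) redot z (F i).
Proof. by rewrite redotC redot_suml; apply: eq_bigr => i _; rewrite redotC. Qed.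

Lemma normr_hnorm x : `|x| = (hnorm x)%:C.
Proof. by rewrite /hnorm RRe_real // ger0_real. Qed.

Lemma hnorm_ge0 x : 0 <= hnorm x.
Proof. by have := normr_ge0 x; rewrite normr_hnorm ler0c. Qed.

Lemma hdotxx x : hdot x x = (hnorm x ^+ 2)%:C.
Proof. by rewrite hdot_norm normr_hnorm rmorphXn. Qed.

Lemma redotxx x : redot x x = hnorm x ^+ 2.
Proof. by rewrite /redot hdotxx. Qed.

Lemma hnorm0 : hnorm (0 : V) = 0.
Proof. by rewrite /hnorm normr0. Qed.

Lemma hnorm_eq0 x : hnorm x = 0 -> x = 0.
Proof. by move=> x0; apply/eqP; rewrite -normr_eq0 normr_hnorm x0. Qed.

Lemma hnormN x : hnorm (- x) = hnorm x.
Proof. by rewrite /hnorm normrN. Qed.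

Lemma hnormBC x y : hnorm (x - y) = hnorm (y - x).
Proof. by rewrite -hnormN opprB. Qed.

Lemma hnormD x y : hnorm (x + y) <= hnorm x + hnorm y.
Proof. by rewrite -lecR rmorphD /= -!normr_hnorm ler_normD. Qed.

Lemma hnorm_triangle y x z : hnorm (x - z) <= hnorm (x - y) + hnorm (y - z).
Proof. by rewrite (le_trans _ (hnormD _ _)) // addrA subrK. Qed.

Lemma hnormZ a x : hnorm (a *: x) = complex.Re `|a| * hnorm x.
Proof. by rewrite {1}/hnorm normrZ [`|x|]normr_hnorm mulrC ReZ mulrC. Qed.

Lemma hnormZr r x : hnorm (r%:C *: x) = `|r| * hnorm x.
Proof. by rewrite hnormZ normc_def /= expr0n addr0 sqrtr_sqr. Qed.

Lemma hnorm_sum (I : Type) (s : seq I) (P : pred I) (F : I -> V) :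
  hnorm (\sum_(i <- s | P i) F i) <= \sum_(i <- s | P i) hnorm (F i).
Proof.
elim/big_ind2 : _ => //; first by rewrite hnorm0.
by move=> x a y b xa yb; rewrite (le_trans (hnormD _ _)) // lerD.
Qed.

Lemma hnormD2 x y :
  hnorm (x + y) ^+ 2 = hnorm x ^+ 2 + hnorm y ^+ 2 + 2 * redot x y.
Proof. rewrite -!redotxx redotDl !redotDr (redotC y x); ring. Qed.

Lemma hnormB2 x y :
  hnorm (x - y) ^+ 2 = hnorm x ^+ 2 + hnorm y ^+ 2 - 2 * redot x y.
Proof. by rewrite hnormD2 hnormN redotNr mulrN. Qed.

(** Expanding the square of the norm of |y| x - |x| y gives 2 |x| |y| (|x| |y| - Re <x, y>) >= 0. *)
Lemma cauchy_schwarz x y : redot x y <= hnorm x * hnorm y.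
Proof.
have [x0|x0] := eqVneq (hnorm x) 0.
  by rewrite (hnorm_eq0 x0) redot0l hnorm0 mul0r.
have [y0|y0] := eqVneq (hnorm y) 0.
  by rewrite (hnorm_eq0 y0) redot0r hnorm0 mulr0.
have xp : 0 < hnorm x by rewrite lt_def x0 hnorm_ge0.
have yp : 0 < hnorm y by rewrite lt_def y0 hnorm_ge0.
have := sqr_ge0 (hnorm ((hnorm y)%:C *: x - (hnorm x)%:C *: y)).
rewrite hnormB2 !hnormZr !ger0_norm ?hnorm_ge0 // redotZl redotZr => h.
have xyp : 0 < hnorm x * hnorm y by rewrite mulr_gt0.
rewrite -(ler_pM2l xyp).
move: h; set a := hnorm x; set b := hnorm y; set c := redot x y => h.
nra.
Qed.

Lemma cauchy_schwarzN x y : - (hnorm x * hnorm y) <= redot x y.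
Proof. by rewrite lerNl -redotNl (le_trans (cauchy_schwarz _ _)) // hnormN. Qed.

Lemma hdotI x y : (forall z, hdot z x = hdot z y) -> x = y.
Proof.
move=> h; apply/eqP; rewrite -subr_eq0; apply/eqP/hnorm_eq0/eqP.
by rewrite -sqrf_eq0 -redotxx /redot hdotBr h subrr.
Qed.

Lemma redotI x y : (forall z, redot z x = redot z y) -> x = y.
Proof.
move=> h; apply/eqP; rewrite -subr_eq0; apply/eqP/hnorm_eq0/eqP.
by rewrite -sqrf_eq0 -redotxx redotBr h subrr.
Qed.

Lemma Im_hdot x y : complex.Im (hdot x y) = redot (- 'i *: x) y.
Proof. by rewrite /redot hdotZl; case: (hdot x y) => a b /=; rewrite oppr0; ring. Qed.

End Dot.

(** Im <x, y> is the real part of <-i x, y>, so complex identities reduce to identities of [redot],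
    for which real arithmetic is available. *)
Lemma hdot_redot (V W : hilbertType R) (x y : V) (x' y' : W) :
  redot x y = redot x' y' -> redot (- 'i *: x) y = redot (- 'i *: x') y' ->
  hdot x y = hdot x' y'.
Proof.
by move=> h1 h2; apply/eqP; rewrite eq_complex !Im_hdot h2 eqxx andbT; apply/eqP.
Qed.

(** * Convergence of sequences of vectors *)

Section Convergence.
Context {V : hilbertType R}.
Implicit Types (u v : nat -> V) (l x y : V).

Lemma hcvgP u l : u N @[N --> \oo] --> l <-> hcvg u l.
Proof.
split=> [/cvgrPdist_lt h|/cvgrPdist_lt h]; apply/cvgrPdist_lt => e e0.
  have e0' : (0 : R[i]) < e%:C by rewrite ltcR.
  apply: filterS (h _ e0') => m /=.
  by rewrite normr_hnorm ltcR sub0r normrN ger0_norm ?hnorm_ge0 // hnormBC.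
have eR : e = (complex.Re e)%:C by rewrite RRe_real // ger0_real // ltW.
have e0' : 0 < complex.Re e by rewrite -ltcR -eR.
apply: filterS (h _ e0') => m /=.
by rewrite eR normr_hnorm ltcR sub0r normrN ger0_norm ?hnorm_ge0 // hnormBC.
Qed.

Lemma hcvg_squeeze u l (b : nat -> R) :
  (forall m, hnorm (u m - l) <= b m) -> b @ \oo --> (0 : R) -> hcvg u l.
Proof.
move=> ub b0; apply: (squeeze_cvgr _ (cvg_cst 0) b0).
by apply: nearW => m; rewrite ub hnorm_ge0.
Qed.

Lemma hcvg_unique u l l' : hcvg u l -> hcvg u l' -> l = l'.
Proof.
move=> ul ul'; apply/eqP; rewrite -subr_eq0; apply/eqP/hnorm_eq0.
apply/eqP; rewrite eq_le hnorm_ge0 andbT.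
have h : hnorm (u N - l) + hnorm (u N - l') @[N --> \oo] --> (0 : R).
  by rewrite -[0]addr0; apply: cvgD.
rewrite -(cvg_lim _ h) //; apply: limr_ge; first by apply/cvg_ex; eexists; exact: h.
by apply: nearW => m; rewrite (le_trans (hnorm_triangle (u m) _ _)) // (hnormBC l).
Qed.

Lemma hcvg_cst l : hcvg (fun=> l) l.
Proof. by rewrite /hcvg subrr hnorm0; exact: cvg_cst. Qed.

Lemma hcvgD u v x y : hcvg u x -> hcvg v y -> hcvg (fun m => u m + v m) (x + y).
Proof.
move=> ux vy; apply: (@hcvg_squeeze _ _ (fun m => hnorm (u m - x) + hnorm (v m - y))).
  by move=> m; rewrite opprD addrACA hnormD.
by rewrite -[0]addr0; apply: cvgD.
Qed.

Lemma hcvgZ (a : R[i]) u x : hcvg u x -> hcvg (fun m => a *: u m) (a *: x).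
Proof.
move=> ux; apply: (@hcvg_squeeze _ _ (fun m => complex.Re `|a| * hnorm (u m - x))).
  by move=> m; rewrite -scalerBr hnormZ.
by rewrite -[0](mulr0 (complex.Re `|a|)); apply: cvgM => //; exact: cvg_cst.
Qed.

Lemma hcvg_redot u x y : hcvg u x -> redot (u N) y @[N --> \oo] --> redot x y.
Proof.
move=> ux; apply/cvgrPdist_lt => e e0.
have : hnorm y * hnorm (u N - x) @[N --> \oo] --> (0 : R).
  by rewrite -[0](mulr0 (hnorm y)); apply: cvgM => //; exact: cvg_cst.
move/cvgrPdist_lt/(_ e e0); apply: filterS => m /=.
rewrite sub0r normrN ger0_norm ?mulr_ge0 ?hnorm_ge0 // => /(le_lt_trans _); apply.
rewrite -redotBl ler_norml mulrC hnormBC cauchy_schwarz andbT.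
by rewrite cauchy_schwarzN.
Qed.

Lemma hcvg_redotr u x y : hcvg u x -> redot y (u N) @[N --> \oo] --> redot y x.
Proof.
move=> ux; have := @hcvg_redot u x y ux; rewrite redotC.
by under eq_fun do rewrite redotC.
Qed.

Lemma hcvg_norm u x : hcvg u x -> hnorm (u N) @[N --> \oo] --> hnorm x.
Proof.
move=> /cvgrPdist_lt ux; apply/cvgrPdist_lt => e e0.
apply: filterS (ux e e0) => m /=; rewrite sub0r normrN ger0_norm ?hnorm_ge0 //.
apply: le_lt_trans; rewrite ler_norml; apply/andP; split.
  by have := hnormD (u m - x) x; rewrite subrK => h; lra.
by have := hnormD (x - u m) (u m); rewrite subrK hnormBC => h; lra.
Qed.

Lemma hcvg_shift u l : hcvg u l -> hcvg (fun m => u m.+1) l.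
Proof. by move=> h; rewrite /hcvg -(cvg_shiftS (fun m => hnorm (u m - l))) in h. Qed.

Lemma hcauchy_cvg u :
  (forall e : R, 0 < e -> exists N, forall i j, (N <= i)%N -> (N <= j)%N ->
     hnorm (u i - u j) < e) -> exists l, hcvg u l.
Proof.
move=> cu; have : cvgn u.
  apply/cauchy_cvgP/cauchy_ballP => e e0.
  have eR : e = (complex.Re e)%:C by rewrite RRe_real // ger0_real // ltW.
  have e0' : 0 < complex.Re e by rewrite -ltcR -eR.
  have [N hN] := cu _ e0'.
  exists ([set u m | m in [set m | (N <= m)%N]], [set u m | m in [set m | (N <= m)%N]]).
    by split => /=; exists N => // m /= Nm; exists m.
  move=> [_ _] [[i iN <-] [j jN <-]] /=.
  by rewrite -ball_normE /= eR normr_hnorm ltcR hN.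
by move=> /cvg_ex[l ul]; exists l; apply/hcvgP.
Qed.

End Convergence.

Lemma hcvg_bnd {V : hilbertType R} (u : nat -> V) l (M : R) :
  hcvg u l -> (forall m, hnorm (u m) <= M) -> hnorm l <= M.
Proof.
move=> /hcvg_norm h uM; rewrite -(cvg_lim _ h) //; apply: limr_le.
  by apply/cvg_ex; eexists; exact: h.
exact: nearW.
Qed.

Lemma cvg_div_harmonic (M : R) : M / m.+1%:R @[m --> \oo] --> (0 : R).
Proof.
rewrite -[0](mulr0 M); apply: cvgM; first exact: cvg_cst.
exact: cvg_harmonic.
Qed.

(* The minimiser of |h|^2 - 2 Re z over W represents the functional h |-> z. *)
Lemma riesz_graph (V : hilbertType R) (W : V -> R[i] -> Prop) (c : R) :
  W 0 0 -> (forall a h z h' z', W h z -> W h' z' -> W (a *: h + h') (a * z + z')) ->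
  (forall h z, W h z -> complex.Re z <= c * hnorm h) ->
  exists u, (forall h z, W h z -> z = hdot h u) /\
    forall e : R, 0 < e -> exists h z, W h z /\ hnorm (h - u) < e.
Proof.
move=> W0 WL Wc.
pose J (h : V) (z : R[i]) := hnorm h ^+ 2 - 2 * complex.Re z.
pose S := [set r | exists h z, W h z /\ r = J h z].
have Sinf : has_inf S.
  split; first by exists (J 0 0), 0, 0.
  exists (- (c ^+ 2)) => _ [h [z [Whz ->]]]; rewrite /J.
  by have := Wc _ _ Whz; have := sqr_ge0 (hnorm h - c); nra.
pose m := inf S.
have Jm h z : W h z -> m <= J h z.
  by move=> Whz; apply: ge_inf => //; [case: Sinf | exists h, z].
have ex k : exists hz : V * R[i], W hz.1 hz.2 /\ J hz.1 hz.2 < m + k.+1%:R^-1.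
  have k0 : 0 < k.+1%:R^-1 :> R by rewrite invr_gt0.
  have [_ [h [z [Whz ->]]] lt] := inf_adherent k0 Sinf.
  by exists (h, z).
have [hz hzP] := choice ex.
pose h k := (hz k).1; pose z k := (hz k).2.
have WW k : W (h k) (z k) by case: (hzP k).
have JJ k : J (h k) (z k) < m + k.+1%:R^-1 by case: (hzP k).
(* Parallelogram law: the midpoint of [h i] and [h j] again belongs to the relation, so its value of
   J is at least m, while J at [h i] and [h j] exceeds m by less than the harmonic terms. *)
have par (i j : nat) : hnorm (h i - h j) ^+ 2 <= 2 * (i.+1%:R^-1 + j.+1%:R^-1).
  have := Jm _ _ (WL (2^-1)%:C _ _ _ _ (WL 1 _ _ _ _ (WW i) (WW j)) W0).
  rewrite !addr0 scale1r mul1r /J hnormZr exprMn ReZ ReD ger0_norm ?invr_ge0 //.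
  have := JJ i; have := JJ j; rewrite /J hnormB2 hnormD2.
  set p := j.+1%:R^-1; set q := i.+1%:R^-1.
  by rewrite expr2; lra.
have cau : forall e : R, 0 < e -> exists N, forall i j, (N <= i)%N -> (N <= j)%N ->
    hnorm (h i - h j) < e.
  move=> e e0; have e4 : 0 < e ^+ 2 / 4 by rewrite divr_gt0 // exprn_gt0.
  have /cvgrPdist_lt/(_ _ e4)[N _ hN] := @cvg_div_harmonic 1.
  exists N => i j Ni Nj.
  have := hN i Ni; have := hN j Nj.
  rewrite /= !sub0r !normrN !mul1r !ger0_norm ?invr_ge0 //.
  have := par i j; set p := i.+1%:R^-1; set q := j.+1%:R^-1 => h1 h2 h3.
  by rewrite -(@ltr_pXn2r _ 2) ?nnegrE ?hnorm_ge0 ?(ltW e0) //; lra.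
have [u hu] := hcauchy_cvg cau.
exists u; split; last first.
  move=> e e0; have /cvgrPdist_lt/(_ e e0)[N _ /(_ N (leqnn N))] := hu.
  rewrite /= sub0r normrN ger0_norm ?hnorm_ge0 // => lt.
  by exists (h N), (z N).
have first_var x y : W x y -> complex.Re y = redot x u.
  move=> Wxy.
  have key k : (redot (h k) x - complex.Re y) ^+ 2 <= hnorm x ^+ 2 / k.+1%:R.
    set d := redot _ _ - _.
    (* W is only a relation and could pair 0 with a nonzero value; the bound [Wc], applied to both
       signs, excludes a nonzero real part. *)
    have [x0|x0] := eqVneq (hnorm x) 0.
      have xx0 := hnorm_eq0 x0.
      have y0 (t : R) : 0 <= t * complex.Re y * -1.
        have := Wc _ _ (WL (t%:C) _ _ _ _ Wxy W0).
        rewrite !addr0 ReZ xx0 scaler0 hnorm0 mulr0; lra.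
      have := y0 1; have := y0 (-1) => h1 h2.
      have {}y0 : complex.Re y = 0 by lra.
      by rewrite /d y0 xx0 redot0r hnorm0 subrr expr0n mul0r.
    have xp : 0 < hnorm x ^+ 2 by rewrite exprn_gt0 // lt_def x0 hnorm_ge0.
    (* Minimiser of t^2 |x|^2 + 2 t d, the variation of J along x at [h k] up to sign conventions in
       d. *)
    pose t := - d / hnorm x ^+ 2.
    have := Jm _ _ (WL (t%:C) _ _ _ _ Wxy (WW k)).
    rewrite /J (addrC (_ *: x)) hnormD2 redotZr ReD ReZ hnormZr exprMn real_normK ?num_real // => hh.
    have {hh}: - k.+1%:R^-1 <= t ^+ 2 * hnorm x ^+ 2 + 2 * t * d.
      have := JJ k; rewrite /J /d; set q := _^-1; lra.
    have -> : t ^+ 2 * hnorm x ^+ 2 + 2 * t * d = - (d ^+ 2 / hnorm x ^+ 2).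
      by rewrite /t; field; rewrite -sqrf_eq0 gt_eqF.
    by rewrite lerN2 ler_pdivrMr // mulrC.
  have h1 : (redot (h k) x - complex.Re y) ^+ 2 @[k --> \oo] --> (0 : R).
    apply: (squeeze_cvgr _ (cvg_cst 0) (@cvg_div_harmonic (hnorm x ^+ 2))).
    by apply: nearW => k; rewrite sqr_ge0 key.
  have h2 : (redot (h k) x - complex.Re y) ^+ 2 @[k --> \oo] --> (redot u x - complex.Re y) ^+ 2.
    by apply: cvgM; apply: cvgB; (apply: hcvg_redot || apply: cvg_cst).
  have h3 : (redot u x - complex.Re y) ^+ 2 = 0 by rewrite -(cvg_lim (@Rhausdorff R) h2) (cvg_lim _ h1).
  have : redot u x - complex.Re y == 0 by rewrite -sqrf_eq0 h3.
  by rewrite subr_eq0 redotC => /eqP.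
(* The relation is complex linear, so the real part at -i x supplies the imaginary part at x. *)
move=> x y Wxy; apply/eqP; rewrite eq_complex (first_var _ _ Wxy) Im_hdot eqxx /=.
have := first_var _ _ (WL (- 'i) _ _ _ _ Wxy W0).
by rewrite !addr0 => <-; apply/eqP; case: (y) => p q /=; ring.
Qed.

End HilbertBasics.

(** * Bounded operators, adjoints and square roots *)

Definition bnd (R : realType) (V W : hilbertType R) (T : bop V W) (M : R) :=
  forall x, hnorm (T x) <= M * hnorm x.

Definition opcvg (R : realType) (V W : hilbertType R) (u : nat -> bop V W) T :=
  opnorm (u N - T) @[N --> \oo] --> (0 : R).

Section Operators.
Context {R : realType}.
Implicit Types U V W : hilbertType R.

Section OneOperator.
Context {V W : hilbertType R}.
Implicit Types (S T : bop V W) (x y : V) (M : R).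

Lemma bop_ext S T : (forall x, S x = T x) -> S = T.
Proof. by move=> h; apply: val_inj; apply: funext. Qed.

Lemma bopD S T x : (S + T) x = S x + T x. Proof. by []. Qed.
Lemma bopN T x : (- T) x = - T x. Proof. by []. Qed.
Lemma bopB S T x : (S - T) x = S x - T x. Proof. by []. Qed.
Lemma bopZ (a : R[i]) T x : (a *: T) x = a *: T x. Proof. by []. Qed.
Lemma bop0 x : (0 : bop V W) x = 0. Proof. by []. Qed.

Lemma bop_sum (I : Type) (s : seq I) (P : pred I) (F : I -> bop V W) x :
  (\sum_(i <- s | P i) F i) x = \sum_(i <- s | P i) F i x.
Proof. by apply: (big_morph (fun T : bop V W => T x)). Qed.

Lemma bop0r T : T 0 = 0. Proof. exact: linear0. Qed.
Lemma bopDr T x y : T (x + y) = T x + T y. Proof. exact: linearD. Qed.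
Lemma bopNr T x : T (- x) = - T x. Proof. exact: linearN. Qed.
Lemma bopBr T x y : T (x - y) = T x - T y. Proof. exact: linearB. Qed.
Lemma bopZr (a : R[i]) T x : T (a *: x) = a *: T x. Proof. exact: linearZ. Qed.
Lemma bop_sumr (I : Type) (s : seq I) (P : pred I) (F : I -> V) T :
  T (\sum_(i <- s | P i) F i) = \sum_(i <- s | P i) T (F i).
Proof. exact: linear_sum. Qed.

Lemma bop_bounded T : exists2 M, 0 <= M & bnd T M.
Proof.
have /cvgrPdist_lt/(_ 1 ltr01) := @bop_continuous _ _ _ T 0.
rewrite linear0 => /nbhs_ballP[d /= d0 hd].
have dR : d = (complex.Re d)%:C by rewrite RRe_real // ger0_real // ltW.
have d0' : 0 < complex.Re d by rewrite -ltcR -dR.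
exists (2 / complex.Re d); first by rewrite divr_ge0 // ltW.
move=> x; have [x0|x0] := eqVneq (hnorm x) 0.
  by rewrite (hnorm_eq0 x0) linear0 !hnorm0 mulr0.
have xp : 0 < hnorm x by rewrite lt_def x0 hnorm_ge0.
(* Rescales x to norm d / 2, inside the ball on which T has values of norm below 1. *)
pose t := complex.Re d / (2 * hnorm x).
have tp : 0 < t by rewrite divr_gt0 // mulr_gt0.
have : `|0 - T (t%:C *: x)| < 1.
  apply: hd; rewrite -ball_normE /= sub0r normrN dR normr_hnorm ltcR hnormZr gtr0_norm //.
  have -> : t * hnorm x = complex.Re d / 2 by rewrite /t; field; rewrite x0.
  by lra.
rewrite sub0r normrN linearZ /= normr_hnorm ltcR hnormZr gtr0_norm // => /ltW h.
have -> : hnorm (T x) = t^-1 * (t * hnorm (T x)) by rewrite mulrA mulVf ?mul1r // gt_eqF.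
have -> : 2 / complex.Re d * hnorm x = t^-1 by rewrite /t invf_div mulrAC.
by rewrite ler_piMr // invr_ge0 ltW.
Qed.

Lemma mkbop (f : V -> W) M : linear f -> (forall x, hnorm (f x) <= M * hnorm x) ->
  exists2 T : bop V W, bnd T M & forall x, T x = f x.
Proof.
move=> lf fM; suff fP : f \in @bop_pred R V W by exists (Bop fP).
apply/asboolP; split => // x.
(* A positive constant is required, as the radius is obtained by dividing by it. *)
pose M' := Num.max M 1; have M'0 : 0 < M' by rewrite lt_max ltr01 orbT.
have fM' y : hnorm (f y) <= M' * hnorm y.
  by rewrite (le_trans (fM y)) // ler_wpM2r ?hnorm_ge0 // le_max lexx.
have fB u v : f (u - v) = f u - f v.
  by have := lf (-1) v u; rewrite !scaleN1r => h; rewrite [u - v]addrC h addrC.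
apply/cvgrPdist_lt => e e0.
have eR : e = (complex.Re e)%:C by rewrite RRe_real // ger0_real // ltW.
have e0' : 0 < complex.Re e by rewrite -ltcR -eR.
have d0 : (0 : R[i]) < (complex.Re e / M')%:C by rewrite ltcR divr_gt0.
have /cvgrPdist_lt/(_ _ d0) := @cvg_id _ (nbhs x).
apply: filterS => y /=; rewrite -fB !normr_hnorm eR !ltcR => h.
by rewrite (le_lt_trans (fM' _)) // mulrC -ltr_pdivlMr.
Qed.

Lemma opnorm_has_sup T :
  has_sup [set hnorm (T x) | x in [set x | hnorm x <= 1]].
Proof.
split; first by exists (hnorm (T 0)), 0 => //=; rewrite hnorm0 ler01.
have [M M0 TM] := bop_bounded T; exists M => _ [x /= x1 <-].
by rewrite (le_trans (TM x)) // ler_piMr.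
Qed.

Lemma opnorm_ge0 T : 0 <= opnorm T.
Proof.
apply: le_trans (sup_ubound _ _) => /=; last by exists 0 => //=; rewrite hnorm0 ler01.
  by rewrite linear0 hnorm0.
by have [] := opnorm_has_sup T.
Qed.

Lemma opnorm_bnd T : bnd T (opnorm T).
Proof.
move=> x; have [x0|x0] := eqVneq (hnorm x) 0.
  by rewrite (hnorm_eq0 x0) linear0 !hnorm0 mulr0.
have xp : 0 < hnorm x by rewrite lt_def x0 hnorm_ge0.
rewrite -ler_pdivrMr //; apply: sup_ubound; first by have [] := opnorm_has_sup T.
exists ((hnorm x)^-1%:C *: x) => /=.
  by rewrite hnormZr gtr0_norm ?invr_gt0 // mulVf.
by rewrite linearZ /= hnormZr gtr0_norm ?invr_gt0 // mulrC.
Qed.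

Lemma opnorm_le T M : 0 <= M -> bnd T M -> opnorm T <= M.
Proof.
move=> M0 TM; apply: ge_sup; first by case: (opnorm_has_sup T).
by move=> _ [x /= x1 <-]; rewrite (le_trans (TM x)) // ler_piMr.
Qed.

Lemma bnd_le T M M' : M <= M' -> bnd T M -> bnd T M'.
Proof. by move=> MM' TM x; rewrite (le_trans (TM x)) // ler_wpM2r ?hnorm_ge0. Qed.

Lemma bndD S T M M' : bnd S M -> bnd T M' -> bnd (S + T) (M + M').
Proof. by move=> SM TM x; rewrite bopD (le_trans (hnormD _ _)) // mulrDl lerD. Qed.

Lemma bndZ (r : R) T M : bnd T M -> bnd (r%:C *: T) (`|r| * M).
Proof. by move=> TM x; rewrite bopZ hnormZr -mulrA ler_wpM2l. Qed.

Lemma bnd0 : bnd (0 : bop V W) 0.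
Proof. by move=> x; rewrite bop0 hnorm0 mul0r. Qed.

Lemma bop_hcvg T (u : nat -> V) l : hcvg u l -> hcvg (fun m => T (u m)) (T l).
Proof.
move=> ul; have [M M0 TM] := bop_bounded T.
apply: (@hcvg_squeeze _ _ _ _ (fun m => M * hnorm (u m - l))).
  by move=> m; rewrite -linearB; exact: TM.
by rewrite -[0](mulr0 M); apply: cvgM => //; exact: cvg_cst.
Qed.

Lemma bop_lim (u : nat -> bop V W) M : (forall m, bnd (u m) M) ->
  (forall x, exists l, hcvg (fun m => u m x) l) ->
  exists2 T : bop V W, bnd T M & forall x, hcvg (fun m => u m x) (T x).
Proof.
move=> uM /choice[f fP].
have [||T TM Tf] := @mkbop f M; last by exists T => // x; rewrite Tf.
- move=> a x y; apply: (hcvg_unique (fP _)).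
  have := hcvgD (hcvgZ a (fP x)) (fP y).
  by congr hcvg; apply: funext => m; rewrite linearP.
- by move=> x; apply: hcvg_bnd (fP x) _ => m; exact: uM.
Qed.

Lemma opcvg_bnd (u : nat -> bop V W) T (b : nat -> R) :
  (forall m, 0 <= b m) -> (forall m, bnd (u m - T) (b m)) -> b @ \oo --> (0 : R) -> opcvg u T.
Proof.
move=> b0 ub bc; apply: (squeeze_cvgr _ (cvg_cst 0) bc).
by apply: nearW => m; rewrite opnorm_ge0 opnorm_le.
Qed.

Lemma opcvg_hcvg (u : nat -> bop V W) T x : opcvg u T -> hcvg (fun m => u m x) (T x).
Proof.
move=> uT; apply: (@hcvg_squeeze _ _ _ _ (fun m => opnorm (u m - T) * hnorm x)).
  by move=> m; rewrite -bopB opnorm_bnd.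
by rewrite -[0](mul0r (hnorm x)); apply: cvgM => //; exact: cvg_cst.
Qed.

Lemma op_limE (u : nat -> bop V W) T : opcvg u T -> op_lim u = T.
Proof.
move=> uT; rewrite /op_lim; case: xgetP => [S _ uS|/(_ T)//].
by apply: bop_ext => x; apply: (@hcvg_unique _ _ (fun m => u m x)); exact: opcvg_hcvg.
Qed.

(** Strong convergence comes from completeness; the geometric tail bound then passes to the limit
    and upgrades it to convergence in operator norm, which is what [op_lim] asks for. *)
Lemma opseries (u : nat -> bop V W) (C s : R) : 0 <= C -> 0 <= s < 1 ->
  (forall k, bnd (u k) (C * s ^+ k)) ->
  exists2 T, bnd T (C / (1 - s)) & opcvg (fun N => \sum_(k < N) u k) T.
Proof.
move=> C0 /andP[s0 s1] us.
have s1' : 0 < 1 - s by rewrite subr_gt0.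
have tail x i j : (i <= j)%N ->
    hnorm ((\sum_(k < j) u k) x - (\sum_(k < i) u k) x) <= C * s ^+ i / (1 - s) * hnorm x.
  move=> ij; rewrite -bopB -!(big_mkord xpredT) (big_cat_nat (n := i)) //= addrC addKr bop_sum.
  rewrite (le_trans (hnorm_sum _ _ _)) //.
  apply: (@le_trans _ _ ((\sum_(i <= k < j) C * s ^+ k) * hnorm x)).
    by rewrite mulr_suml ler_sum // => k _; exact: us.
  rewrite ler_wpM2r ?hnorm_ge0 // ler_pdivlMr //.
  rewrite -mulr_sumr -mulrA ler_wpM2l //.
  rewrite -{1}(subnKC ij); elim: (j - i)%N => [|d IH].
    by rewrite addn0 big_geq // mul0r exprn_ge0.
  rewrite addnS big_nat_recr ?leq_addr //= mulrDl.
  suff : \sum_(i <= k < i + d) s ^+ k * (1 - s) = s ^+ i - s ^+ (i + d).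
    rewrite -mulr_suml => ->; have := exprn_ge0 (i + d).+1 s0; rewrite exprS; lra.
  elim: d {IH} => [|d IH]; first by rewrite addn0 big_geq // subrr.
  by rewrite addnS big_nat_recr ?leq_addr //= IH exprS; ring.
have cs (c : R) : C * s ^+ N / (1 - s) * c @[N --> \oo] --> (0 : R).
  have -> : (fun N => C * s ^+ N / (1 - s) * c) = (fun N => (C / (1 - s) * c) * s ^+ N).
    by apply: funext => N; ring.
  rewrite -[0](mulr0 (C / (1 - s) * c)); apply: cvgM; first exact: cvg_cst.
  by apply: cvg_expr; rewrite ger0_norm.
have [||T TM Tc] := @bop_lim (fun N => \sum_(k < N) u k) (C / (1 - s)).
- by move=> m x; have := tail x _ _ (leq0n m); rewrite big_ord0 bop0 subr0 expr0 mulr1.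
- move=> x; apply: hcauchy_cvg => e e0.
  have /cvgrPdist_lt/(_ e e0)[N _ hN] := cs (hnorm x).
  have key i j : (N <= i)%N -> (i <= j)%N ->
      hnorm ((\sum_(k < j) u k) x - (\sum_(k < i) u k) x) < e.
    move=> Ni ij; rewrite (le_lt_trans (tail _ _ _ ij)) //.
    have := hN i Ni; rewrite /= sub0r normrN ger0_norm //.
    by rewrite mulr_ge0 ?hnorm_ge0 // divr_ge0 ?mulr_ge0 ?exprn_ge0 // ltW.
  exists N => i j Ni Nj; have [ij|/ltnW ji] := leqP i j; last exact: key.
  by rewrite hnormBC key.
exists T => //; apply: (@opcvg_bnd _ _ (fun N => C * s ^+ N / (1 - s))).
- by move=> m; rewrite divr_ge0 ?mulr_ge0 ?exprn_ge0 // ltW.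
- move=> m x; rewrite bopB hnormBC.
  apply: (@hcvg_bnd _ _ (fun j => (\sum_(k < j + m) u k) x - (\sum_(k < m) u k) x)); last first.
    by move=> j; rewrite tail // leq_addl.
  rewrite /hcvg; under eq_fun do rewrite opprB addrA subrK.
  by have h := Tc x; rewrite /hcvg -(cvg_shiftn m) in h; exact: h.
- by have := cs 1; under eq_fun do rewrite mulr1.
Qed.

End OneOperator.

Lemma bcompE U V W (S : bop V W) (T : bop U V) x : (S \bo T) x = S (T x).
Proof. by []. Qed.

Lemma bidE V (x : V) : bid V x = x. Proof. by []. Qed.

Lemma bnd_id V : bnd (bid V) 1.
Proof. by move=> x; rewrite mul1r. Qed.

Lemma bnd_comp U V W (S : bop V W) (T : bop U V) M M' : 0 <= M ->
  bnd S M -> bnd T M' -> bnd (S \bo T) (M * M').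
Proof. by move=> M0 SM TM x; rewrite (le_trans (SM _)) // -mulrA ler_wpM2l. Qed.

(** For fixed y the functional x |-> <T x, y> has a total graph bounded by M |y|, so [riesz_graph]
    represents it. From here on the default value of [hadj] is never taken. *)
Lemma hadj_exists V W (T : bop V W) :
  exists S : bop W V, forall x y, hdot (T x) y = hdot x (S y).
Proof.
have [M M0 TM] := bop_bounded T.
have ex y : exists u, forall x, hdot (T x) y = hdot x u.
  have [||h z ->|u [hu _]] := @riesz_graph _ V (fun h z => z = hdot (T h) y) (M * hnorm y).
  - by rewrite linear0 hdot0l.
  - by move=> a h z h' z' -> ->; rewrite linearP hdotP.
  - rewrite -/(redot _ _) (le_trans (cauchy_schwarz _ _)) //.
    by rewrite mulrAC ler_wpM2r ?hnorm_ge0.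
  by exists u => x; exact: hu.
have [f fP] := choice ex.
have [||S _ Sf] := @mkbop _ _ f M.
- by move=> a x y; apply: hdotI => z; rewrite -fP !hdotDr !hdotZr !fP.
- move=> y; have [y0|y0] := eqVneq (hnorm (f y)) 0; first by rewrite y0 mulr_ge0 ?hnorm_ge0.
  have fp : 0 < hnorm (f y) by rewrite lt_def y0 hnorm_ge0.
  rewrite -(ler_pM2l fp) -expr2 -redotxx /redot -fP -/(redot _ _).
  by rewrite (le_trans (cauchy_schwarz _ _)) // mulrA ler_wpM2r ?hnorm_ge0 // mulrC.
by exists S => x y; rewrite Sf.
Qed.

Section Adjoint.
Context {V W : hilbertType R}.
Implicit Types (T : bop V W) (x : V) (y : W).

Lemma hadjP T x y : hdot (T x) y = hdot x (hadj T y).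
Proof.
have [S SP] := hadj_exists T.
by rewrite /hadj; case: xgetP => [S' _ ->//|/(_ S)].
Qed.

Lemma hadjPr T x y : hdot y (T x) = hdot (hadj T y) x.
Proof. by rewrite hdotC hadjP -hdotC. Qed.

Lemma redotP T x y : redot (T x) y = redot x (hadj T y).
Proof. by rewrite /redot hadjP. Qed.

Lemma redotPr T x y : redot y (T x) = redot (hadj T y) x.
Proof. by rewrite /redot hadjPr. Qed.

Lemma hadj_eq T (S : bop W V) :
  (forall x y, hdot (T x) y = hdot x (S y)) -> hadj T = S.
Proof. by move=> h; apply: bop_ext => y; apply: hdotI => x; rewrite -hadjP h. Qed.

Lemma bnd_hadj T M : 0 <= M -> bnd T M -> bnd (hadj T) M.
Proof.
move=> M0 TM y; have [y0|y0] := eqVneq (hnorm (hadj T y)) 0; first by rewrite y0 mulr_ge0 ?hnorm_ge0.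
have fp : 0 < hnorm (hadj T y) by rewrite lt_def y0 hnorm_ge0.
rewrite -(ler_pM2l fp) -expr2 -redotxx -redotP.
by rewrite (le_trans (cauchy_schwarz _ _)) // mulrA ler_wpM2r ?hnorm_ge0 // mulrC.
Qed.

End Adjoint.

Lemma hadjK V W (T : bop V W) : hadj (hadj T) = T.
Proof. by apply: hadj_eq => x y; rewrite hadjPr. Qed.

Lemma hadj_comp U V W (S : bop V W) (T : bop U V) : hadj (S \bo T) = hadj T \bo hadj S.
Proof. by apply: hadj_eq => x y; rewrite !bcompE !hadjP. Qed.

Lemma hadj_id V : hadj (bid V) = bid V.
Proof. exact: hadj_eq. Qed.

Lemma hadjD V W (S T : bop V W) : hadj (S + T) = hadj S + hadj T.
Proof. by apply: hadj_eq => x y; rewrite !bopD hdotDl hdotDr !hadjP. Qed.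

Lemma hadjN V W (T : bop V W) : hadj (- T) = - hadj T.
Proof. by apply: hadj_eq => x y; rewrite !bopN hdotNl hdotNr hadjP. Qed.

Lemma hadjB V W (S T : bop V W) : hadj (S - T) = hadj S - hadj T.
Proof. by rewrite hadjD hadjN. Qed.

Lemma hadjZ V W (r : R) (T : bop V W) : hadj (r%:C *: T) = r%:C *: hadj T.
Proof. by apply: hadj_eq => x y; rewrite !bopZ hdotZl hdotZr conjc_realE hadjP. Qed.

Lemma hadj_sum V W (I : Type) (s : seq I) (P : pred I) (F : I -> bop V W) :
  hadj (\sum_(i <- s | P i) F i) = \sum_(i <- s | P i) hadj (F i).
Proof.
apply: (big_morph _ (@hadjD V W)); apply: hadj_eq => x y.
by rewrite !bop0 hdot0l hdot0r.
Qed.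

Lemma hadj_redot V W (T : bop V W) (S : bop W V) :
  (forall x y, redot (T x) y = redot x (S y)) -> hadj T = S.
Proof.
by move=> h; apply: hadj_eq => x y; apply: hdot_redot => //; rewrite -bopZr.
Qed.

Lemma hadj_lim V W (u : nat -> bop V W) (v : nat -> bop W V) (T : bop V W) (S : bop W V) :
  (forall x, hcvg (fun m => u m x) (T x)) -> (forall x, hcvg (fun m => v m x) (S x)) ->
  (forall m, hadj (u m) = v m) -> hadj T = S.
Proof.
move=> uT vS uv; apply: hadj_redot => x y.
have h1 := @hcvg_redot _ _ _ _ y (uT x).
have h2 := @hcvg_redotr _ _ _ _ x (vS y).
have e : (fun m => redot (u m x) y) = (fun m => redot x (v m y)).
  by apply: funext => m; rewrite -uv redotP.
by rewrite -(cvg_lim (@Rhausdorff R) h1) e (cvg_lim (@Rhausdorff R) h2).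
Qed.

(** * Positive operators and their square roots *)

Section Positive.
Context {V : hilbertType R}.
Implicit Types (P Q Z : bop V V).

(** Over complex scalars a real quadratic form is self-adjoint: the vanishing of the imaginary part
    at x + i y gives the symmetry of Re <P x, y>. *)
Lemma psdP P : op_le 0 P <-> hadj P = P /\ forall x, 0 <= redot (P x) x.
Proof.
split=> [P0|[Ps P0] x]; last first.
  rewrite bopB bop0 subr0 lecE /= P0 andbT.
  have : hdot (P x) x = Num.conj (hdot (P x) x) by rewrite {1}hdotC hadjPr Ps.
  by move=> /(congr1 (@complex.Im R)); rewrite Im_conj => h; apply/eqP; lra.
have im0 x : complex.Im (hdot (P x) x) = 0.
  by have := P0 x; rewrite bopB bop0 subr0 lecE => /andP[/eqP].
have sym x y : redot (P x) y = redot (P y) x.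
  have := im0 (x + 'i *: y).
  rewrite linearD linearZ /= !hdotDl !hdotDr !hdotZl !hdotZr !raddfD /=.
  have := im0 x; have := im0 y.
  rewrite /redot; case: (hdot (P x) x) => ? ?; case: (hdot (P x) y) => ? ? /=.
  case: (hdot (P y) x) => ? ? /=; case: (hdot (P y) y) => ? ? /=; lra.
split; last by move=> x; have := P0 x; rewrite bopB bop0 subr0 lecE => /andP[].
apply: bop_ext => y; apply: redotI => x.
by rewrite -redotP sym redotC.
Qed.

Lemma psd_adj P : op_le 0 P -> hadj P = P. Proof. by move=> /psdP[]. Qed.

Lemma psd_ge0 P x : op_le 0 P -> 0 <= redot (P x) x. Proof. by move=> /psdP[_]. Qed.

(** Positivity at x - t P x with t = 1 / M yields |P x|^2 <= M <P x, x>, once <P (P x), P x> has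
    been bounded by M |P x|^2. *)
Lemma psd_bnd P (M : R) : 0 <= M -> op_le 0 P ->
  (forall x, redot (P x) x <= M * hnorm x ^+ 2) -> bnd P M.
Proof.
move=> M0 /psdP[Ps P0] PM x.
have key (t : R) : 0 <= redot (P x) x - 2 * t * hnorm (P x) ^+ 2 + t ^+ 2 * redot (P (P x)) (P x).
  have := P0 (x - t%:C *: P x).
  rewrite linearB linearZ /= redotBl !redotBr !redotZl !redotZr (redotP P (P x) x) Ps redotxx; nra.
rewrite -(@ler_pXn2r _ 2) ?nnegrE ?mulr_ge0 ?hnorm_ge0 // exprMn.
have [M00|M00] := eqVneq M 0.
  have := key 1; have := PM x; have := PM (P x).
  rewrite M00 !mul0r expr0n mul0r; lra.
have Mp : 0 < M by rewrite lt_def M00.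
have := key M^-1; have := PM x; have := PM (P x); rewrite -(ler_pM2l Mp).
set a := redot _ _; set b := redot (P x) x; set c := hnorm _ ^+ 2; set d := hnorm x ^+ 2 => h1 h2.
move=> /(mulr_ge0 (ltW Mp)).
have -> : M * (b - 2 * M^-1 * c + M^-1 ^+ 2 * a) = M * b - 2 * c + M^-1 * a by field.
have h3 : M^-1 * a <= c by rewrite ler_pdivrMl // -(ler_pM2l Mp).
move=> h4; rewrite ler_pM2l // expr2 -mulrA.
by apply: (@le_trans _ _ (M * b)); rewrite ?ler_pM2l //; lra.
Qed.

(* (1 - Y)^2 = 1 - Z, by the iteration Y <- (Z + Y^2) / 2, dominated by its
   scalar version y <- (1 + y^2) / 2 *)
Lemma sqrt_contraction Z : bnd Z 1 -> hadj Z = Z ->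
  exists2 Y, bnd Y 1 & hadj Y = Y /\ Y + Y = Z + Y \bo Y.
Proof.
move=> Z1 Zs.
pose Yn := fix Yn k := if k is k'.+1 then (2^-1)%:C *: (Z + Yn k' \bo Yn k') else 0 : bop V V.
pose yn := fix yn k := if k is k'.+1 then 2^-1 * (1 + yn k' ^+ 2) else 0 : R.
have yS k : yn k.+1 = 2^-1 * (1 + yn k ^+ 2) by [].
have YS k : Yn k.+1 = (2^-1)%:C *: (Z + Yn k \bo Yn k) by [].
have y01 k : 0 <= yn k <= 1.
  elim: k => [|k]; first by rewrite lexx ler01.
  by rewrite yS; nra.
have Yb k : bnd (Yn k) (yn k).
  elim: k => [|k IH]; first exact: bnd0.
  rewrite YS yS; have := bndZ 2^-1 (bndD Z1 (bnd_comp _ IH IH)).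
  rewrite ger0_norm ?invr_ge0 // expr2; apply.
  by have /andP[] := y01 k.
have ymon k : yn k <= yn k.+1 by rewrite yS; have := sqr_ge0 (1 - yn k); nra.
have Yd k : bnd (Yn k.+1 - Yn k) (yn k.+1 - yn k).
  elim: k => [|k IH].
    by rewrite !subr0; exact: Yb.
  rewrite (YS k.+1) {2}(YS k) -scalerBr.
  (* A^2 - B^2 = A (A - B) + (A - B) B holds without commutation, and it is the same factorisation
     that controls the scalar increments. *)
  have -> : Z + Yn k.+1 \bo Yn k.+1 - (Z + Yn k \bo Yn k) =
      Yn k.+1 \bo (Yn k.+1 - Yn k) + (Yn k.+1 - Yn k) \bo Yn k.
    apply: bop_ext => x; rewrite !(bopB, bopD, bcompE) linearB /=.
    by rewrite [RHS]addrA subrK opprD addrACA subrr add0r.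
  have y1 : 0 <= yn k.+1 by have /andP[] := y01 k.+1.
  have yy : 0 <= yn k.+1 - yn k by rewrite subr_ge0.
  have := bndZ 2^-1 (bndD (bnd_comp y1 (Yb k.+1) IH) (bnd_comp yy IH (Yb k))).
  rewrite ger0_norm ?invr_ge0 //; apply: bnd_le; rewrite (yS k.+1).
  by have := yS k; set a := yn k.+1; set b := yn k; rewrite !expr2 => h; lra.
have Ydd i j : (i <= j)%N -> bnd (Yn j - Yn i) (yn j - yn i).
  move=> /subnKC <-; elim: (j - i)%N => [|d IH].
    by rewrite addn0 !subrr; exact: bnd0.
  rewrite addnS; have := bndD (Yd (i + d)%N) IH.
  by rewrite !addrA !subrK.
have yc : cvgn yn.
  apply: nondecreasing_is_cvgn.
    by apply/nondecreasing_seqP => k; exact: ymon.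
  by exists 1 => _ [k _ <-]; have /andP[] := y01 k.
have [||Y Y1 YY] := @bop_lim _ _ Yn 1.
- by move=> k; apply: bnd_le (Yb k); have /andP[] := y01 k.
- move=> x; apply: hcauchy_cvg => e e0.
  have e1 : 0 < e / (2 * (hnorm x + 1)) by rewrite divr_gt0 // mulr_gt0 // ltr_wpDl ?hnorm_ge0.
  have /cvgrPdist_lt/(_ _ e1)[N _ hN] := yc.
  have key i j : (N <= i)%N -> (i <= j)%N -> hnorm (Yn j x - Yn i x) < e.
    move=> Ni ij; rewrite (le_lt_trans (Ydd _ _ ij x)) //.
    have /= := hN i Ni; have /= := hN j (leq_trans Ni ij).
    set l := lim _; rewrite !ltr_norml => /andP[h1 h2] /andP[h3 h4].
    have xp : 0 < hnorm x + 1 by rewrite ltr_wpDl ?hnorm_ge0.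
    apply: (@le_lt_trans _ _ (2 * (e / (2 * (hnorm x + 1))) * hnorm x)).
      by rewrite ler_wpM2r ?hnorm_ge0 //; lra.
    rewrite (_ : 2 * _ = e / (hnorm x + 1)); last by field; rewrite gt_eqF.
    by rewrite mulrAC ltr_pdivrMr // ltr_pM2l //; lra.
  exists N => i j Ni Nj; have [ij|/ltnW ji] := leqP i j; last exact: key.
  by rewrite hnormBC key.
exists Y => //; split.
  apply: (hadj_lim YY YY); elim=> [|k IH]; first by apply: hadj_eq => x y; rewrite !bop0 hdot0l hdot0r.
  by rewrite YS hadjZ hadjD hadj_comp IH Zs.
apply: bop_ext => x; rewrite !bopD bcompE.
have h1 := hcvgD (hcvg_shift (YY x)) (hcvg_shift (YY x)).
apply: (hcvg_unique h1).
have -> : (fun m => Yn m.+1 x + Yn m.+1 x) = (fun m => Z x + Yn m (Yn m x)).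
  apply: funext => m; rewrite YS bopZ bopD bcompE -scalerDl -rmorphD /=.
  by rewrite (_ : _ + _ = 1) ?scale1r //; lra.
apply: hcvgD; first exact: hcvg_cst.
have h2 := bop_hcvg Y (YY x).
apply: (@hcvg_squeeze _ _ _ _ (fun m => hnorm (Yn m x - Y x) + hnorm (Yn m (Y x) - Y (Y x)))).
  move=> m; rewrite (le_trans (hnorm_triangle (Yn m (Y x)) _ _)) // lerD2r -linearB.
  rewrite (le_trans (Yb m _)) // ler_piMl ?hnorm_ge0 //.
  by have /andP[] := y01 m.
by rewrite -[0]addr0; apply: cvgD; exact: YY.
Qed.

(** For M > 0 bounding P, Z = I - P / M is a self-adjoint contraction and 2 Y = Z + Y^2 reads (I -
    Y)^2 = P / M. The root is sqrt M (I - Y), positive because Y is a contraction. *)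
Lemma sqrt_exists P : op_le 0 P -> exists Q, op_le 0 Q /\ Q \bo Q = P.
Proof.
move=> P0; have [M0 M00 PM0] := bop_bounded P.
pose M := M0 + 1; have Mp : 0 < M by rewrite ltr_wpDl.
have PM x : redot (P x) x <= M * hnorm x ^+ 2.
  rewrite (le_trans (cauchy_schwarz _ _)) // expr2 mulrA ler_wpM2r ?hnorm_ge0 //.
  by rewrite (le_trans (PM0 _)) // ler_wpM2r ?hnorm_ge0 // lerDl.
pose Z := bid V - (M^-1)%:C *: P.
have Zs : hadj Z = Z by rewrite hadjB hadj_id hadjZ psd_adj.
have Zx x : redot (Z x) x = hnorm x ^+ 2 - M^-1 * redot (P x) x.
  by rewrite bopB redotBl bopZ redotZl bidE redotxx.
have Z1 : bnd Z 1.
  apply: psd_bnd => //; last first.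
    by move=> x; rewrite Zx mul1r gerBl mulr_ge0 ?invr_ge0 ?(ltW Mp) ?psd_ge0.
  apply/psdP; split => // x; rewrite Zx subr_ge0 ler_pdivrMl //.
have [Y Y1 [Ys YY]] := sqrt_contraction Z1 Zs.
exists ((Num.sqrt M)%:C *: (bid V - Y)); split.
  apply/psdP; split; first by rewrite hadjZ hadjB hadj_id Ys.
  move=> x; rewrite bopZ redotZl mulr_ge0 ?sqrtr_ge0 // bopB redotBl bidE redotxx subr_ge0.
  by rewrite (le_trans (cauchy_schwarz _ _)) // expr2 ler_wpM2r ?hnorm_ge0 //; have := Y1 x; rewrite mul1r.
apply: bop_ext => x; rewrite bcompE !bopZ bopZr scalerA -rmorphM -expr2 sqr_sqrtr ?(ltW Mp) //.
have E y : (bid V - Y) y = y - Y y by [].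
have h : Y x + Y x = Z x + Y (Y x) by rewrite -bopD YY.
have -> : (bid V - Y) ((bid V - Y) x) = x - Z x.
  have -> : Z x = Y x + Y x - Y (Y x) by rewrite h addrK.
  by rewrite !E bopBr -addrA -opprD addrA.
have -> : Z x = x - (M^-1)%:C *: P x by [].
by rewrite opprB addrC subrK scalerA -rmorphM mulfV ?gt_eqF // scale1r.
Qed.

Lemma opsqrtP P : op_le 0 P -> op_le 0 (opsqrt P) /\ opsqrt P \bo opsqrt P = P.
Proof.
move=> /sqrt_exists[Q QP]; rewrite /opsqrt.
by case: xgetP => [Q' _ []//|/(_ Q)].
Qed.

End Positive.

End Operators.

(** * Inverses, extension of operators and tensor products *)

Definition oppow (R : realType) (V : hilbertType R) (A : bop V V) k : bop V V :=
  iter k (bcomp A) (bid V).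

(** Coefficients travel with their indices and an index may recur, so concatenation of lists is
    addition and f need not be independent. *)
Definition lincomb (R : realType) (V : hilbertType R) (I : Type) (f : I -> V)
  (s : seq (R[i] * I)) : V := \sum_(p <- s) p.1 *: f p.2.

(** A trivial orthogonal complement is easily checked for tensors and implies that the span is
    dense, by [total_approx]. *)
Definition total (R : realType) (V : hilbertType R) (I : Type) (f : I -> V) :=
  forall u, (forall i, hdot (f i) u = 0) -> u = 0.

(** The column with entries A_i has squared norm at most M, expressed without forming a direct sum.
    A row is measured through the adjoints of its entries. *)
Definition colbnd (R : realType) (V W : hilbertType R) (I : finType)
  (A : I -> bop V W) (M : R) :=
  forall x, \sum_i hnorm (A i x) ^+ 2 <= M * hnorm x ^+ 2.

Section Inverse.
Context {R : realType} {V : hilbertType R}.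
Implicit Types (A S T : bop V V).

Lemma opinvE T S : S \bo T = bid V -> T \bo S = bid V -> opinv T = S.
Proof.
move=> ST TS; rewrite /opinv; case: xgetP => [S' _ [S'T TS']|/(_ S)[]//].
apply: bop_ext => x; have /(congr1 (fun U : bop V V => S' (U x))) := TS.
rewrite bidE bcompE => <-.
by have /(congr1 (fun U : bop V V => U (S x))) := S'T.
Qed.

Lemma oppowS A k x : oppow A k.+1 x = A (oppow A k x). Proof. by []. Qed.

Lemma oppowSr A k x : oppow A k.+1 x = oppow A k (A x).
Proof. by elim: k x => [//|k IH] x; rewrite oppowS IH. Qed.

Lemma bnd_oppow A s k : 0 <= s -> bnd A s -> bnd (oppow A k) (s ^+ k).
Proof.
move=> s0 As; elim: k => [|k IH]; first exact: bnd_id.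
by rewrite exprS; apply: bnd_comp.
Qed.

Lemma neumann A s : 0 <= s < 1 -> bnd A s -> exists N,
  [/\ (bid V - A) \bo N = bid V, N \bo (bid V - A) = bid V &
      opcvg (fun m => \sum_(k < m) oppow A k) N].
Proof.
move=> s01 As; have /andP[s0 s1] := s01.
have [|N _ Nc] := @opseries _ _ _ (oppow A) 1 s ler01 s01.
  by move=> k; rewrite mul1r; apply: bnd_oppow.
have pow0 x : hcvg (fun m => oppow A m x) 0.
  apply: (@hcvg_squeeze _ _ _ _ (fun m => s ^+ m * hnorm x)).
    by move=> m; rewrite subr0; apply: bnd_oppow.
  rewrite -[0](mul0r (hnorm x)); apply: cvgM; last exact: cvg_cst.
  by apply: cvg_expr; rewrite ger0_norm.
have tel m x : (\sum_(k < m) oppow A k) x - A ((\sum_(k < m) oppow A k) x) = x - oppow A m x.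
  elim: m => [|m IH]; first by rewrite big_ord0 bop0 bop0r subr0 -[oppow A 0 x]/x subrr.
  by rewrite big_ord_recr bopD bopDr opprD addrACA IH addrA subrK.
have com m x : A ((\sum_(k < m) oppow A k) x) = (\sum_(k < m) oppow A k) (A x).
  by rewrite !bop_sum bop_sumr; apply: eq_bigr => k _; rewrite -oppowS oppowSr.
have lim x : hcvg (fun m => (\sum_(k < m) oppow A k) x - A ((\sum_(k < m) oppow A k) x)) x.
  rewrite (_ : (fun _ => _) = (fun m => x + (-1) *: oppow A m x)).
    have := hcvgD (hcvg_cst x) (hcvgZ (-1) (pow0 x)).
    by rewrite scaler0 addr0.
  by apply: funext => m; rewrite tel scaleN1r.
exists N; split => //; apply: bop_ext => x.
  apply: (hcvg_unique _ (lim x)); rewrite bcompE.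
  exact: (bop_hcvg (bid V - A) (opcvg_hcvg x Nc)).
apply: (hcvg_unique _ (lim x)); rewrite bcompE bopB bidE.
rewrite (_ : (fun _ => _) = (fun m => (\sum_(k < m) oppow A k) (x - A x))).
  exact: opcvg_hcvg.
by apply: funext => m; rewrite bopBr com.
Qed.

Lemma opinv_neumann A s : 0 <= s < 1 -> bnd A s ->
  [/\ (bid V - A) \bo opinv (bid V - A) = bid V,
      opinv (bid V - A) \bo (bid V - A) = bid V &
      opcvg (fun m => \sum_(k < m) oppow A k) (opinv (bid V - A))].
Proof. by move=> s01 As; have [N [h1 h2 h3]] := neumann s01 As; rewrite (opinvE h2 h1). Qed.

End Inverse.

(** * Extension of maps from families of vectors *)

Section Extension.
Context {R : realType}.
Implicit Types U V W : hilbertType R.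

Section Span.
Context {V : hilbertType R} {I : Type} (f : I -> V).

Lemma lincomb_nil : lincomb f [::] = 0. Proof. exact: big_nil. Qed.

Lemma lincomb1 i : lincomb f [:: (1, i)] = f i.
Proof. by rewrite /lincomb big_seq1 scale1r. Qed.

Lemma lincombZD a s t :
  lincomb f ([seq (a * p.1, p.2) | p <- s] ++ t) = a *: lincomb f s + lincomb f t.
Proof.
rewrite /lincomb big_cat big_map scaler_sumr; congr (_ + _).
by apply: eq_bigr => p _; rewrite scalerA.
Qed.

Lemma bop_lincomb W (A : bop V W) s : A (lincomb f s) = lincomb (fun i => A (f i)) s.
Proof. by rewrite bop_sumr; apply: eq_bigr => p _; rewrite bopZr. Qed.

(** Representing h |-> <h, v> on the span of f produces the projection u of v onto its closure. The
    difference v - u is orthogonal to every f i, hence zero. *)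
Lemma total_approx : total f -> forall v (e : R), 0 < e -> exists s, hnorm (lincomb f s - v) < e.
Proof.
move=> tf v e e0.
have [||h z [s [-> ->]]|u [hu cu]] :=
  @riesz_graph _ V (fun h z => exists s, h = lincomb f s /\ z = hdot h v) (hnorm v).
- by exists [::]; rewrite lincomb_nil hdot0l.
- move=> a h z h' z' [s [-> ->]] [t [-> ->]].
  exists ([seq (a * p.1, p.2) | p <- s] ++ t).
  by rewrite lincombZD hdotP.
- by rewrite -/(redot _ _) mulrC cauchy_schwarz.
have -> : v = u.
  apply/eqP; rewrite -subr_eq0; apply/eqP/tf => i.
  by rewrite hdotBr -(hu (f i) (hdot (f i) v)) ?subrr //; exists [:: (1, i)]; rewrite lincomb1.
by have [h [z [[s [-> _]] lt]]] := cu e e0; exists s.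
Qed.

Lemma total_bop0 W (A : bop V W) : total f -> (forall i, A (f i) = 0) -> A = 0.
Proof.
move=> tf A0; apply: bop_ext => x; apply: hdotI => y.
rewrite hadjPr (_ : hadj A y = 0) ?hdot0l ?hdot0r //.
by apply: tf => i; rewrite -hadjP A0 hdot0l.
Qed.

Lemma total_ext W (A B : bop V W) : total f -> (forall i, A (f i) = B (f i)) -> A = B.
Proof.
move=> tf AB; apply/eqP; rewrite -subr_eq0; apply/eqP/(total_bop0 tf) => i.
by rewrite bopB AB subrr.
Qed.

Lemma total_dot x y : total f -> (forall i, hdot (f i) x = hdot (f i) y) -> x = y.
Proof.
move=> tf h; apply/eqP; rewrite -subr_eq0; apply/eqP/tf => i.
by rewrite hdotBr h subrr.
Qed.

Lemma strong_total W (A : nat -> bop V W) (B : bop V W) M :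
  (forall m, bnd (A m) M) -> total f ->
  (forall i, hcvg (fun m => A m (f i)) (B (f i))) -> forall v, hcvg (fun m => A m v) (B v).
Proof.
move=> AM tf Af v; have [M' M'0 BM'] := bop_bounded B.
have Al s : hcvg (fun m => A m (lincomb f s)) (B (lincomb f s)).
  elim: s => [|p s IH].
    rewrite lincomb_nil bop0r; under eq_fun do rewrite bop0r; exact: hcvg_cst.
  rewrite /lincomb big_cons bopDr bopZr.
  under eq_fun do rewrite bopDr bopZr.
  by apply: hcvgD => //; apply: hcvgZ.
apply/cvgrPdist_lt => e e0.
pose K := `|M| + M' + 1; have K0 : 0 < K by rewrite ltr_wpDl // addr_ge0.
have d0 : 0 < e / 2 / K by rewrite !divr_gt0.
have [s hs] := total_approx tf v d0.
have e2 : 0 < e / 2 by rewrite divr_gt0.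
have /cvgrPdist_lt/(_ _ e2) := Al s.
apply: filterS => m /=; rewrite !sub0r !normrN !ger0_norm ?hnorm_ge0 // => h.
apply: (@le_lt_trans _ _ (hnorm (A m v - A m (lincomb f s)) + hnorm (A m (lincomb f s) - B (lincomb f s)) + hnorm (B (lincomb f s) - B v))).
  rewrite (le_trans (hnorm_triangle (B (lincomb f s)) _ _)) // lerD2r.
  by rewrite hnorm_triangle.
have h1 : hnorm (A m v - A m (lincomb f s)) <= `|M| * (e / 2 / K).
  rewrite -bopBr (le_trans (AM _ _)) // (le_trans (ler_wpM2r (hnorm_ge0 _) (ler_norm M))) //.
  by rewrite ler_wpM2l // hnormBC ltW.
have h2 : hnorm (B (lincomb f s) - B v) <= M' * (e / 2 / K).
  by rewrite -bopBr (le_trans (BM' _)) // ler_wpM2l // ltW.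
have h3 : (`|M| + M') * (e / 2 / K) <= e / 2.
  rewrite mulrCA ler_piMr //; first by rewrite ltW.
  by rewrite ler_pdivrMr // mul1r /K; lra.
lra.
Qed.

(* A is the adjoint of the map sending y to the vector u, in the closed span
   of f, that represents f i |-> <g i, y>. *)
Lemma extend_span W (g : I -> W) M : 0 <= M ->
  (forall s, hnorm (lincomb g s) <= M * hnorm (lincomb f s)) ->
  exists2 A : bop V W, bnd A M & forall i, A (f i) = g i.
Proof.
move=> M0 gf.
pose P y u := (forall i, hdot (g i) y = hdot (f i) u) /\
  forall e : R, 0 < e -> exists s, hnorm (lincomb f s - u) < e.
have Pn y u : P y u -> hnorm u <= M * hnorm y.
  (* Tests u against a combination s close to it: <s, u> is the pairing of the same combination of
     the g i with y, hence at most M |y| |s|. *)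
  move=> [h1 h2]; apply/ler_addgt0Pr => e e0.
  have [u0|u0] := eqVneq (hnorm u) 0; first by rewrite u0 addr_ge0 ?(ltW e0) // mulr_ge0 ?hnorm_ge0.
  have up : 0 < hnorm u by rewrite lt_def u0 hnorm_ge0.
  (* Chosen so that e / K * (|u| + M |y|) = e |u|, which makes the total error exactly e after
     division by |u|. *)
  pose K := 1 + M * hnorm y / hnorm u.
  have K0 : 0 < K by rewrite ltr_pwDl // divr_ge0 ?mulr_ge0 ?hnorm_ge0.
  have d0 : 0 < e / K by rewrite divr_gt0.
  have [s hs] := h2 _ d0.
  have e1 : redot (lincomb f s) u = redot (lincomb g s) y.
    rewrite !redot_suml; apply: eq_bigr => p _.
    by rewrite /redot !hdotZl h1.
  have e2 : hnorm u ^+ 2 <= hnorm (lincomb f s - u) * hnorm u + M * hnorm y * hnorm (lincomb f s).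
    rewrite -redotxx -[X in redot X u](subKr (lincomb f s)) redotBl addrC lerD //.
      by rewrite -redotNl opprB -[X in _ <= X * _]hnormBC hnormBC (le_trans (cauchy_schwarz _ _)) // hnormBC.
    rewrite e1 (le_trans (cauchy_schwarz _ _)) // mulrAC ler_wpM2r ?hnorm_ge0 //.
  have e3 : hnorm (lincomb f s) <= hnorm u + e / K.
    have := hnormD (lincomb f s - u) u; rewrite subrK; lra.
  have MY : 0 <= M * hnorm y by rewrite mulr_ge0 ?hnorm_ge0.
  rewrite -(ler_pM2l up) -expr2 (le_trans e2) //.
  apply: (@le_trans _ _ (e / K * hnorm u + M * hnorm y * (hnorm u + e / K))).
    by rewrite lerD ?ler_wpM2l ?ler_wpM2r ?hnorm_ge0 // ltW.
  rewrite le_eqVlt; apply/orP; left; apply/eqP.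
  have -> : e / K * hnorm u + M * hnorm y * (hnorm u + e / K) = hnorm u * (M * hnorm y) + e / K * (hnorm u + M * hnorm y) by ring.
  have -> : hnorm u + M * hnorm y = hnorm u * K by rewrite /K; field.
  by rewrite [RHS]mulrDr (_ : e / K * (hnorm u * K) = hnorm u * e) //; field; rewrite gt_eqF.
have ex y : exists u, P y u.
  have [||h z [s [-> ->]]|u [hu cu]] :=
    @riesz_graph _ V (fun h z => exists s, h = lincomb f s /\ z = hdot (lincomb g s) y) (M * hnorm y).
  - by exists [::]; rewrite /lincomb !big_nil hdot0l.
  - move=> a h z h' z' [s [-> ->]] [t [-> ->]].
    exists ([seq (a * p.1, p.2) | p <- s] ++ t).
    rewrite lincombZD; split => //.
    rewrite /lincomb big_cat big_map hdotDl; congr (_ + _).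
    rewrite !hdot_suml mulr_sumr; apply: eq_bigr => p _.
    by rewrite /= !hdotZl mulrA.
  - rewrite -/(redot _ _) (le_trans (cauchy_schwarz _ _)) // mulrAC.
    by rewrite ler_wpM2r ?hnorm_ge0.
  exists u; split => [i|e e0].
    by apply: hu; exists [:: (1, i)]; rewrite lincomb1 /lincomb big_seq1 scale1r.
  by have [h [z [[s [-> _]] lt]]] := cu e e0; exists s.
have PL a y u y' u' : P y u -> P y' u' -> P (a *: y + y') (a *: u + u').
  move=> [h1 h2] [h1' h2']; split=> [i|e e0]; first by rewrite !hdotDr !hdotZr h1 h1'.
  pose K := complex.Re `|a| + 1.
  have a0 : 0 <= complex.Re `|a| by rewrite -ler0c RRe_real // normr_real.
  have K0 : 0 < K by rewrite ltr_wpDl.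
  have d0 : 0 < e / K by rewrite divr_gt0.
  have [s hs] := h2 _ d0; have [t ht] := h2' _ d0.
  exists ([seq (a * p.1, p.2) | p <- s] ++ t).
  rewrite lincombZD opprD addrACA -scalerBr (le_lt_trans (hnormD _ _)) // hnormZ.
  apply: (@le_lt_trans _ _ (complex.Re `|a| * (e / K) + hnorm (lincomb f t - u'))).
    by rewrite lerD2r ler_wpM2l // ltW.
  apply: (@lt_le_trans _ _ (complex.Re `|a| * (e / K) + e / K)); first by rewrite ltrD2l.
  by rewrite -[X in _ + X]mul1r -mulrDl mulrCA mulfV ?mulr1 // gt_eqF.
have [B BP] := choice ex.
have uniq y u u' : P y u -> P y u' -> u = u'.
  move=> Pu Pu'; have := Pn _ _ (PL (-1) _ _ _ _ Pu Pu').
  rewrite !scaleN1r addNr hnorm0 mulr0 => h.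
  have /hnorm_eq0/eqP : hnorm (- u + u') = 0 by apply/eqP; rewrite eq_le h hnorm_ge0.
  by rewrite addrC subr_eq0 => /eqP.
have [||B' B'M B'E] := @mkbop _ _ _ B M.
- by move=> a x y; apply: (uniq (a *: x + y)) => //; apply: PL.
- by move=> y; apply: Pn.
exists (hadj B'); first exact: bnd_hadj.
move=> i; apply: hdotI => y; rewrite hadjPr hadjK B'E.
by have [h1 _] := BP y; rewrite hdotC -h1 -hdotC.
Qed.

End Span.

Lemma hnorm_lincomb V (I : Type) (f : I -> V) s :
  hnorm (lincomb f s) ^+ 2 =
  \sum_(p <- s) \sum_(q <- s) complex.Re (p.1 * (Num.conj q.1 * hdot (f p.2) (f q.2))).
Proof.
rewrite -redotxx redot_suml; apply: eq_bigr => p _.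
by rewrite redot_sumr; apply: eq_bigr => q _; rewrite /redot hdotZl hdotZr.
Qed.

(** The family h witnesses that the Gram matrix of f minus that of g is positive, so any combination
    of the g i is dominated by the same combination of the f i. Creation operators, dilations and
    tensor products of operators are all obtained in this way. *)
Lemma extend_gram U V W (I : Type) (f : I -> V) (g : I -> W) (h : I -> U) :
  (forall i j, hdot (f i) (f j) = hdot (g i) (g j) + hdot (h i) (h j)) ->
  exists2 A : bop V W, bnd A 1 & forall i, A (f i) = g i.
Proof.
move=> fgh; apply: extend_span => // s.
rewrite mul1r -(@ler_pXn2r _ 2) ?nnegrE ?hnorm_ge0 //.
suff -> : hnorm (lincomb f s) ^+ 2 = hnorm (lincomb g s) ^+ 2 + hnorm (lincomb h s) ^+ 2.
  by rewrite lerDl sqr_ge0.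
rewrite !hnorm_lincomb -big_split; apply: eq_bigr => p _; rewrite -big_split /=.
by apply: eq_bigr => q _; rewrite fgh !mulrDr ReD.
Qed.

Lemma extend_isometry V W (I : Type) (f : I -> V) (g : I -> W) :
  (forall i j, hdot (f i) (f j) = hdot (g i) (g j)) ->
  exists2 A : bop V W, bnd A 1 & forall i, A (f i) = g i.
Proof.
move=> fg; apply: (@extend_gram V _ _ _ _ _ (fun=> 0)) => i j.
by rewrite hdot0l addr0.
Qed.

(** If u were nonzero, some z in D would satisfy |u - z| < |u|, against Pythagoras. *)
Lemma closure_orth V (D : set V) u : closure D u -> (forall z, D z -> hdot z u = 0) -> u = 0.
Proof.
move=> cD Du; apply/eqP/negPn/negP => u0.
have nu : 0 < `|u| by rewrite normr_gt0.
have [z [/Du zu]] := cD _ (nbhsx_ballx u _ nu).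
rewrite -ball_normE /= !normr_hnorm ltcR => lt.
have h : hnorm (u - z) ^+ 2 = hnorm u ^+ 2 + hnorm z ^+ 2.
  by rewrite hnormB2 redotC /redot zu mulr0 subr0.
have : hnorm (u - z) ^+ 2 < hnorm u ^+ 2 by rewrite ltr_pXn2r ?nnegrE ?hnorm_ge0.
by rewrite h ltNge lerDl sqr_ge0.
Qed.

Lemma dense_orth V (D : set V) u : dense D -> (forall z, D z -> hdot z u = 0) -> u = 0.
Proof.
move=> dD; apply: closure_orth => B Bu.
have [z [Bz Dz]] := dD _ (ex_intro _ u (nbhs_singleton (nbhs_interior Bu))) (open_interior B).
by exists z; split => //; exact: interior_subset Bz.
Qed.

End Extension.

(** * Rows and columns of operators *)

Section Columns.
Context {R : realType} {I : finType}.

Lemma colbnd_sum (V W : hilbertType R) (A : I -> bop V W) x :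
  \sum_i hnorm (A i x) ^+ 2 = redot ((\sum_i hadj (A i) \bo A i) x) x.
Proof.
rewrite bop_sum redot_suml; apply: eq_bigr => i _.
by rewrite bcompE -redotPr redotxx.
Qed.

Lemma colbnd_opnorm (V W : hilbertType R) (A : I -> bop V W) :
  colbnd A (opnorm (\sum_i hadj (A i) \bo A i)).
Proof.
move=> x; rewrite colbnd_sum (le_trans (cauchy_schwarz _ _)) // expr2 mulrA.
by rewrite ler_wpM2r ?hnorm_ge0 // opnorm_bnd.
Qed.

Lemma psd_gram (V W : hilbertType R) (A : I -> bop V W) : op_le 0 (\sum_i hadj (A i) \bo A i).
Proof.
apply/psdP; split => [|x]; last by rewrite -colbnd_sum sumr_ge0 // => i _; rewrite sqr_ge0.
by rewrite hadj_sum; apply: eq_bigr => i _; rewrite hadj_comp hadjK.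
Qed.

Lemma colbnd_bnd (V W : hilbertType R) (A : I -> bop V W) M : 0 <= M -> colbnd A M ->
  bnd (\sum_i hadj (A i) \bo A i) M.
Proof. by move=> M0 AM; apply: psd_bnd (psd_gram A) _ => // x; rewrite -colbnd_sum. Qed.

(** Cauchy-Schwarz on a direct sum, obtained by summing |a^2 w_i - Y_i^* u|^2 >= 0 over i and
    absorbing the last squares with the bound on the adjoints. *)
Lemma row_sum (V W : hilbertType R) (Y : I -> bop V W) (w : I -> V) a :
  0 < a -> colbnd (fun i => hadj (Y i)) (a ^+ 2) ->
  hnorm (\sum_i Y i (w i)) ^+ 2 <= a ^+ 2 * \sum_i hnorm (w i) ^+ 2.
Proof.
move=> a0 Ya; set u := \sum_i _.
have e1 : hnorm u ^+ 2 = \sum_i redot (w i) (hadj (Y i) u).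
  by rewrite -redotxx {1}/u redot_suml; apply: eq_bigr => i _; rewrite redotP.
have e2 : 2 * a ^+ 2 * hnorm u ^+ 2 <=
    a ^+ 4 * (\sum_i hnorm (w i) ^+ 2) + \sum_i hnorm (hadj (Y i) u) ^+ 2.
  rewrite e1 mulr_sumr mulr_sumr -big_split ler_sum //= => i _.
  have := sqr_ge0 (hnorm ((a ^+ 2)%:C *: w i - hadj (Y i) u)).
  rewrite hnormB2 hnormZr redotZl exprMn ger0_norm ?sqr_ge0 // -exprM; lra.
have := Ya u => h2.
have a2 : 0 < a ^+ 2 by rewrite exprn_gt0.
rewrite -(ler_pM2l a2); set s := \sum_i hnorm (w i) ^+ 2 in e2 *.
have -> : a ^+ 2 * (a ^+ 2 * s) = a ^+ 4 * s by ring.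
lra.
Qed.

Lemma row_col_bnd (U V W : hilbertType R) (Y : I -> bop V W) (A : I -> bop U V) a b :
  0 < a -> 0 <= b -> colbnd (fun i => hadj (Y i)) (a ^+ 2) -> colbnd A (b ^+ 2) ->
  bnd (\sum_i Y i \bo A i) (a * b).
Proof.
move=> a0 b0 Ya Ab z; have ab0 : 0 <= a * b by rewrite mulr_ge0 // ltW.
rewrite -(@ler_pXn2r _ 2) ?nnegrE ?(mulr_ge0 ab0) ?hnorm_ge0 // !exprMn bop_sum.
apply: (le_trans (row_sum (fun i => A i z) a0 Ya)).
by rewrite -mulrA ler_wpM2l ?sqr_ge0.
Qed.

End Columns.

(** * Tensor products of operators *)

Section Tensor.
Context {R : realType} (tens : tensor_product R).
Implicit Types K L U V : hilbertType R.

Lemma total_tpure K L : total (fun p : K * L => tpure (tens K L) p.1 p.2).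
Proof.
move=> u hu; apply: (dense_orth (@tpure_dense _ _ _ (tens K L))) => _ [s ->].
by rewrite hdot_suml big1 // => p _; exact: hu.
Qed.

Lemma tpure_linl K L (a : R[i]) x x' y :
  tpure (tens K L) (a *: x + x') y = a *: tpure (tens K L) x y + tpure (tens K L) x' y.
Proof.
apply: (total_dot (@total_tpure K L)) => p.
by rewrite hdotDr hdotZr !tpure_dot hdotDr hdotZr; ring.
Qed.

Lemma tpure_linr K L (a : R[i]) x y y' :
  tpure (tens K L) x (a *: y + y') = a *: tpure (tens K L) x y + tpure (tens K L) x y'.
Proof.
apply: (total_dot (@total_tpure K L)) => p.
by rewrite hdotDr hdotZr !tpure_dot hdotDr hdotZr; ring.
Qed.

Lemma tpure0l K L y : tpure (tens K L) 0 y = 0.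
Proof. by have := tpure_linl (-1) (0 : K) 0 y; rewrite scaler0 addr0 scaleN1r addNr. Qed.

Lemma tpure0r K L x : tpure (tens K L) x 0 = 0.
Proof. by have := tpure_linr (-1) x (0 : L) 0; rewrite scaler0 addr0 scaleN1r addNr. Qed.

Lemma tpureDl K L x x' y : tpure (tens K L) (x + x') y = tpure (tens K L) x y + tpure (tens K L) x' y.
Proof. by have := tpure_linl 1 x x' y; rewrite !scale1r. Qed.

Lemma tpureDr K L x y y' : tpure (tens K L) x (y + y') = tpure (tens K L) x y + tpure (tens K L) x y'.
Proof. by have := tpure_linr 1 x y y'; rewrite !scale1r. Qed.

Lemma tpureZl K L (a : R[i]) x y : tpure (tens K L) (a *: x) y = a *: tpure (tens K L) x y.
Proof. by have := tpure_linl a x 0 y; rewrite addr0 tpure0l addr0. Qed.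

Lemma tpureZr K L (a : R[i]) x y : tpure (tens K L) x (a *: y) = a *: tpure (tens K L) x y.
Proof. by have := tpure_linr a x y 0; rewrite addr0 tpure0r addr0. Qed.

Lemma hnorm_tpure K L x y : hnorm (tpure (tens K L) x y) = hnorm x * hnorm y.
Proof.
apply/eqP; rewrite -(@eqrXn2 _ 2) ?mulr_ge0 ?hnorm_ge0 //.
by rewrite -redotxx /redot tpure_dot !hdotxx -rmorphM /= exprMn.
Qed.

Lemma tensor_map K L (x : K) : exists2 J : bop L (tens K L), bnd J (hnorm x) &
  forall y, J y = tpure (tens K L) x y.
Proof.
apply: mkbop => [a y y'|y]; first exact: tpure_linr.
by rewrite hnorm_tpure.
Qed.

Lemma tensor_mapl K L (y : L) : exists2 J : bop K (tens K L), bnd J (hnorm y) &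
  forall x, J x = tpure (tens K L) x y.
Proof.
apply: mkbop => [a x x'|x]; first exact: tpure_linl.
by rewrite hnorm_tpure mulrC.
Qed.

(** Totality is transported one factor at a time, through the adjoints of y |-> x (x) y and of x |->
    x (x) y. *)
Lemma total_tens K L (I J : Type) (f : I -> K) (g : J -> L) : total f -> total g ->
  total (fun p : I * J => tpure (tens K L) (f p.1) (g p.2)).
Proof.
move=> tf tg u hu; apply: (@total_tpure K L) => -[x y] /=.
have h1 i z : hdot (tpure (tens K L) (f i) z) u = 0.
  have [T _ TE] := tensor_map L (f i).
  rewrite -TE hadjP (_ : hadj T u = 0) ?hdot0r //.
  by apply: tg => j; rewrite -hadjP TE; exact: (hu (i, j)).
have [T _ TE] := tensor_mapl K y.
rewrite -TE hadjP (_ : hadj T u = 0) ?hdot0r //.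
by apply: tf => i; rewrite -hadjP TE h1.
Qed.

(** D is the square root of I - A^* A; the identity has the shape of the hypothesis of
    [extend_gram]. *)
Lemma defect_gram K K' (A : bop K K') : bnd A 1 -> exists D : bop K K,
  forall x y, hdot x y = hdot (A x) (A y) + hdot (D x) (D y).
Proof.
move=> A1; have : op_le 0 (bid K - hadj A \bo A).
  apply/psdP; split; first by rewrite hadjB hadj_id hadj_comp hadjK.
  move=> x; rewrite bopB bidE redotBl redotxx bcompE -redotPr redotxx subr_ge0.
  by rewrite ler_pXn2r ?nnegrE ?hnorm_ge0 //; have := A1 x; rewrite mul1r.
move=> /sqrt_exists[D [D0 DD]]; exists D => x y.
rewrite (hadjPr D) (psd_adj D0) -bcompE DD bopB bcompE bidE hdotBl -hadjPr.
by rewrite addrC subrK.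
Qed.

(* With D^2 = I - A^* A, the Gram matrix of the x_i (x) y_i is the sum of those
   of the A x_i (x) y_i and of the D x_i (x) y_i, so A (x) I is a contraction. *)
Lemma tensl_exists K K' L (A : bop K K') M : 0 <= M -> bnd A M ->
  exists2 C : bop (tens K L) (tens K' L), bnd C M &
    forall x y, C (tpure (tens K L) x y) = tpure (tens K' L) (A x) y.
Proof.
rewrite le_eqVlt => /orP[/eqP <- A0|M0 AM].
  exists 0; first exact: bnd0.
  move=> x y; rewrite bop0 (_ : A x = 0) ?tpure0l //; apply: hnorm_eq0.
  by apply/eqP; rewrite eq_le hnorm_ge0 andbT; have := A0 x; rewrite mul0r.
have [|D DE] := @defect_gram _ _ ((M^-1)%:C *: A).
  have := bndZ M^-1 AM; rewrite gtr0_norm ?invr_gt0 // mulVf ?gt_eqF //.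
have [|C C1 CE] := @extend_gram _ (tens K L) _ _ _ (fun p : K * L => tpure (tens K L) p.1 p.2)
    (fun p => tpure (tens K' L) (((M^-1)%:C *: A) p.1) p.2) (fun p => tpure (tens K L) (D p.1) p.2).
  by move=> p q; rewrite !tpure_dot DE mulrDl.
exists (M%:C *: C).
  by have := bndZ M C1; rewrite gtr0_norm // mulr1.
move=> x y; rewrite bopZ (CE (x, y)) -[(x, y).1]/x -[(x, y).2]/y -tpureZl bopZ scalerA -rmorphM.
by rewrite mulfV ?gt_eqF // scale1r.
Qed.

Lemma tensr_exists K L L' (B : bop L L') M : 0 <= M -> bnd B M ->
  exists2 C : bop (tens K L) (tens K L'), bnd C M &
    forall x y, C (tpure (tens K L) x y) = tpure (tens K L') x (B y).
Proof.
rewrite le_eqVlt => /orP[/eqP <- B0|M0 BM].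
  exists 0; first exact: bnd0.
  move=> x y; rewrite bop0 (_ : B y = 0) ?tpure0r //; apply: hnorm_eq0.
  by apply/eqP; rewrite eq_le hnorm_ge0 andbT; have := B0 y; rewrite mul0r.
have [|D DE] := @defect_gram _ _ ((M^-1)%:C *: B).
  have := bndZ M^-1 BM; rewrite gtr0_norm ?invr_gt0 // mulVf ?gt_eqF //.
have [|C C1 CE] := @extend_gram _ (tens K L) _ _ _ (fun p : K * L => tpure (tens K L) p.1 p.2)
    (fun p => tpure (tens K L') p.1 (((M^-1)%:C *: B) p.2)) (fun p => tpure (tens K L) p.1 (D p.2)).
  by move=> p q; rewrite !tpure_dot (DE p.2) mulrDr.
exists (M%:C *: C).
  by have := bndZ M C1; rewrite gtr0_norm // mulr1.
move=> x y; rewrite bopZ (CE (x, y)) -[(x, y).1]/x -[(x, y).2]/y -tpureZr bopZ scalerA -rmorphM.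
by rewrite mulfV ?gt_eqF // scale1r.
Qed.

Lemma tens_exists K K' L L' (A : bop K K') (B : bop L L') M M' :
  0 <= M -> bnd A M -> 0 <= M' -> bnd B M' ->
  exists2 C : bop (tens K L) (tens K' L'), bnd C (M * M') &
    forall x y, C (tpure (tens K L) x y) = tpure (tens K' L') (A x) (B y).
Proof.
move=> M0 AM M'0 BM'.
have [C CM CE] := tensl_exists L' M0 AM; have [D DM DE] := tensr_exists K M'0 BM'.
exists (C \bo D); first exact: bnd_comp.
by move=> x y; rewrite bcompE DE CE.
Qed.

Lemma tensor_ext K L V (A B : bop (tens K L) V) :
  (forall x y, A (tpure (tens K L) x y) = B (tpure (tens K L) x y)) -> A = B.
Proof. by move=> h; apply: (total_ext (@total_tpure K L)) => p. Qed.

Lemma tensopE K K' L L' (A : bop K K') (B : bop L L') x y :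
  tensop tens A B (tpure (tens K L) x y) = tpure (tens K' L') (A x) (B y).
Proof.
have [M M0 AM] := bop_bounded A; have [M' M'0 BM'] := bop_bounded B.
have [C _ CE] := tens_exists M0 AM M'0 BM'.
by rewrite /tensop; case: xgetP => [D _ ->//|/(_ C)].
Qed.

Lemma bnd_tensop K K' L L' (A : bop K K') (B : bop L L') M M' :
  0 <= M -> bnd A M -> 0 <= M' -> bnd B M' -> bnd (tensop tens A B) (M * M').
Proof.
move=> M0 AM M'0 BM'; have [C CM CE] := tens_exists M0 AM M'0 BM'.
by rewrite (_ : tensop tens A B = C) //; apply: tensor_ext => x y; rewrite tensopE CE.
Qed.

Lemma tensop_comp K K' K'' L L' L'' (A : bop K' K'') (A' : bop K K') (B : bop L' L'') (B' : bop L L') :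
  tensop tens A B \bo tensop tens A' B' = tensop tens (A \bo A') (B \bo B').
Proof. by apply: tensor_ext => x y; rewrite bcompE !tensopE. Qed.

Lemma tensop_id K L : tensop tens (bid K) (bid L) = bid (tens K L).
Proof. by apply: tensor_ext => x y; rewrite tensopE. Qed.

Lemma tensopDl K K' L L' (A A' : bop K K') (B : bop L L') :
  tensop tens (A + A') B = tensop tens A B + tensop tens A' B.
Proof. by apply: tensor_ext => x y; rewrite bopD !tensopE bopD tpureDl. Qed.

Lemma tensopDr K K' L L' (A : bop K K') (B B' : bop L L') :
  tensop tens A (B + B') = tensop tens A B + tensop tens A B'.
Proof. by apply: tensor_ext => x y; rewrite bopD !tensopE bopD tpureDr. Qed.

Lemma tensopBl K K' L L' (A A' : bop K K') (B : bop L L') :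
  tensop tens (A - A') B = tensop tens A B - tensop tens A' B.
Proof.
apply: tensor_ext => x y; rewrite bopB !tensopE bopB -[in LHS]scaleN1r tpureDl tpureZl.
by rewrite scaleN1r.
Qed.

Lemma tensopZl K K' L L' (a : R[i]) (A : bop K K') (B : bop L L') :
  tensop tens (a *: A) B = a *: tensop tens A B.
Proof. by apply: tensor_ext => x y; rewrite bopZ !tensopE bopZ tpureZl. Qed.

Lemma tensopZr K K' L L' (a : R[i]) (A : bop K K') (B : bop L L') :
  tensop tens A (a *: B) = a *: tensop tens A B.
Proof. by apply: tensor_ext => x y; rewrite bopZ !tensopE bopZ tpureZr. Qed.

Lemma tensop0l K K' L L' (B : bop L L') : tensop tens (0 : bop K K') B = 0.
Proof. by apply: tensor_ext => x y; rewrite tensopE !bop0 tpure0l. Qed.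

Lemma tensop0r K K' L L' (A : bop K K') : tensop tens A (0 : bop L L') = 0.
Proof. by apply: tensor_ext => x y; rewrite tensopE !bop0 tpure0r. Qed.

Lemma tensop_suml K K' L L' (I : Type) (s : seq I) (P : pred I) (F : I -> bop K K') (B : bop L L') :
  tensop tens (\sum_(i <- s | P i) F i) B = \sum_(i <- s | P i) tensop tens (F i) B.
Proof.
apply: (big_morph (fun A => tensop tens A B)); last exact: tensop0l.
by move=> A A'; exact: tensopDl.
Qed.

Lemma tensop_sumr K K' L L' (I : Type) (s : seq I) (P : pred I) (F : I -> bop L L') (A : bop K K') :
  tensop tens A (\sum_(i <- s | P i) F i) = \sum_(i <- s | P i) tensop tens A (F i).
Proof. by apply: (big_morph (tensop tens A)); [exact: tensopDr|exact: tensop0r]. Qed.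

Lemma hadj_tensop K K' L L' (A : bop K K') (B : bop L L') :
  hadj (tensop tens A B) = tensop tens (hadj A) (hadj B).
Proof.
apply: tensor_ext => x y; apply: (total_dot (@total_tpure K L)) => p.
by rewrite -hadjP !tensopE !tpure_dot !hadjP.
Qed.

Section Column.
Context {I : finType}.

Lemma colbnd_tensl K K' L (A : I -> bop K K') M : 0 <= M -> colbnd A M ->
  colbnd (fun i => tensop tens (A i) (bid L)) M.
Proof.
move=> M0 AM z; rewrite colbnd_sum.
have -> : \sum_i hadj (tensop tens (A i) (bid L)) \bo tensop tens (A i) (bid L) =
    tensop tens (\sum_i hadj (A i) \bo A i) (bid L).
  by rewrite tensop_suml; apply: eq_bigr => i _; rewrite hadj_tensop hadj_id tensop_comp.
rewrite (le_trans (cauchy_schwarz _ _)) // expr2 mulrA ler_wpM2r ?hnorm_ge0 //.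
by have := bnd_tensop M0 (colbnd_bnd M0 AM) ler01 (@bnd_id _ L); rewrite mulr1.
Qed.

Lemma colbnd_tensr K L L' (B : I -> bop L L') M : 0 <= M -> colbnd B M ->
  colbnd (fun i => tensop tens (bid K) (B i)) M.
Proof.
move=> M0 BM z; rewrite colbnd_sum.
have -> : \sum_i hadj (tensop tens (bid K) (B i)) \bo tensop tens (bid K) (B i) =
    tensop tens (bid K) (\sum_i hadj (B i) \bo B i).
  by rewrite tensop_sumr; apply: eq_bigr => i _; rewrite hadj_tensop hadj_id tensop_comp.
rewrite (le_trans (cauchy_schwarz _ _)) // expr2 mulrA ler_wpM2r ?hnorm_ge0 //.
by have := bnd_tensop ler01 (@bnd_id _ K) M0 (colbnd_bnd M0 BM); rewrite mul1r.
Qed.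

(** The sum factors as the row of the I (x) X_i, of norm at most a, times the column of the A_i (x)
    I, of norm at most b. *)
Lemma bnd_sum_tensop K K' L L' (A : I -> bop K K') (X : I -> bop L L') a b :
  0 < a -> 0 <= b -> colbnd (fun i => hadj (X i)) (a ^+ 2) -> colbnd A (b ^+ 2) ->
  bnd (\sum_i tensop tens (A i) (X i)) (a * b).
Proof.
move=> a0 b0 Xa Ab.
have -> : \sum_i tensop tens (A i) (X i) =
    \sum_i tensop tens (bid K') (X i) \bo tensop tens (A i) (bid L).
  by apply: eq_bigr => i _; rewrite tensop_comp.
apply: row_col_bnd => //; last by apply: colbnd_tensl; rewrite ?sqr_ge0.
move=> z; under eq_bigr do rewrite hadj_tensop hadj_id.
by apply: colbnd_tensr => //; rewrite sqr_ge0.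
Qed.

End Column.

End Tensor.

(** * Fock space and evaluation of free holomorphic functions *)

Lemma hcvg_near_cst (R : realType) (V : hilbertType R) (u : nat -> V) (l : V) N :
  (forall m, (N <= m)%N -> u m = l) -> hcvg u l.
Proof.
move=> h; apply/cvgrPdist_lt => e e0; exists N => // m /= Nm.
by rewrite h // subrr hnorm0 subr0 normr0.
Qed.

(** Second quantisation of the scalar c. It commutes with creation operators up to a factor c, and
    therefore relates evaluations at right creation tuples of different radii. *)
Definition dilation (R : realType) n (F2 : fock_space R n) (c : R) : bop F2 F2 :=
  xget 0 [set T : bop F2 F2 |
    forall a, T (fock_e F2 a) = (c ^+ size a)%:C *: fock_e F2 a].

Section Fock.
Context {R : realType} {n : nat} (F2 : fock_space R n).
Local Notation e := (fock_e F2).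
Local Notation S_ := (left_creation F2).
Local Notation R_ := (right_creation F2).

Lemma total_fock : total e.
Proof.
move=> u hu; apply: (dense_orth (@fock_e_total _ _ F2)) => _ [s [c ->]].
by rewrite hdot_suml big1 // => a _; rewrite hdotZl hu mulr0.
Qed.

Lemma left_creationE i a : S_ i (e a) = e (i :: a).
Proof.
have [|T _ TE] := @extend_isometry _ _ _ _ e (fun a => e (i :: a)).
  by move=> a' b; rewrite !fock_e_orthonormal eqseq_cons eqxx.
by rewrite /left_creation; case: xgetP => [T' _ ->//|/(_ T)].
Qed.

Lemma right_creationE i a : R_ i (e a) = e (rcons a i).
Proof.
have [|T _ TE] := @extend_isometry _ _ _ _ e (fun a => e (rcons a i)).
  by move=> a' b; rewrite !fock_e_orthonormal eqseq_rcons eqxx andbT.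
by rewrite /right_creation; case: xgetP => [T' _ ->//|/(_ T)].
Qed.

Lemma dilation_exists c : 0 <= c <= 1 ->
  exists2 T : bop F2 F2, bnd T 1 & forall a, T (e a) = (c ^+ size a)%:C *: e a.
Proof.
move=> /andP[c0 c1].
(* These weights complete the squares c^(2 |a|) to 1, so the two diagonal Gram matrices add up to
   the identity. *)
apply: (@extend_gram _ F2 _ _ _ _ _ (fun a => (Num.sqrt (1 - (c ^+ size a) ^+ 2))%:C *: e a)) => a b.
rewrite !hdotZl !hdotZr !conjc_realE !fock_e_orthonormal.
case: eqP => [->|_]; last by rewrite !mulr0 addr0.
rewrite !mulr1 -!rmorphM -rmorphD /= -!expr2 sqr_sqrtr.
  by rewrite addrC subrK.
by rewrite subr_ge0 expr_le1 ?exprn_ge0 // exprn_ile1.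
Qed.

Lemma dilationE c a : 0 <= c <= 1 -> dilation F2 c (e a) = (c ^+ size a)%:C *: e a.
Proof.
move=> /dilation_exists[T _ TE].
by rewrite /dilation; case: xgetP => [T' _ ->//|/(_ T)].
Qed.

Lemma bnd_dilation c : 0 <= c <= 1 -> bnd (dilation F2 c) 1.
Proof.
move=> c01; have [T T1 TE] := dilation_exists c01.
rewrite (_ : dilation F2 c = T) //.
by apply: (total_ext total_fock) => a; rewrite TE dilationE.
Qed.

Lemma hadj_dilation c : 0 <= c <= 1 -> hadj (dilation F2 c) = dilation F2 c.
Proof.
move=> c01; apply: (total_ext total_fock) => a; apply: (total_dot total_fock) => b.
rewrite -hadjP !dilationE // hdotZl hdotZr conjc_realE fock_e_orthonormal.
by case: eqP => [->//|_]; rewrite !mulr0.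
Qed.

Lemma left_creation_adj i a :
  hadj (S_ i) (e a) = if a is j :: b then (i == j)%:R *: e b else 0.
Proof.
apply: (total_dot total_fock) => b; rewrite -hadjP left_creationE fock_e_orthonormal.
case: a => [|j a]; first by rewrite hdot0r.
rewrite eqseq_cons hdotZr fock_e_orthonormal rmorph_nat.
by case: (i == j); rewrite ?mul1r ?mul0r.
Qed.

Lemma left_creation_isom i j : hadj (S_ i) \bo S_ j = (i == j)%:R *: bid F2.
Proof.
apply: (total_ext total_fock) => a.
by rewrite bcompE left_creationE left_creation_adj.
Qed.

Lemma right_creation_isom i j : hadj (R_ i) \bo R_ j = (i == j)%:R *: bid F2.
Proof.
apply: (total_ext total_fock) => a; apply: (total_dot total_fock) => b.
rewrite bcompE -hadjP !right_creationE fock_e_orthonormal eqseq_rcons hdotZr.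
rewrite fock_e_orthonormal rmorph_nat andbC.
by case: (i == j); rewrite ?mul1r ?mul0r.
Qed.

Lemma creation_commute i j : S_ i \bo R_ j = R_ j \bo S_ i.
Proof.
apply: (total_ext total_fock) => a.
by rewrite !bcompE left_creationE !right_creationE left_creationE.
Qed.

Lemma dilation_right c i : 0 <= c <= 1 ->
  dilation F2 c \bo R_ i = c%:C *: (R_ i \bo dilation F2 c).
Proof.
move=> c01; apply: (total_ext total_fock) => a.
rewrite bopZ !bcompE right_creationE !dilationE // bopZr right_creationE.
by rewrite size_rcons exprS rmorphM -scalerA.
Qed.

Lemma dilation_left c i : 0 <= c <= 1 ->
  dilation F2 c \bo S_ i = c%:C *: (S_ i \bo dilation F2 c).
Proof.
move=> c01; apply: (total_ext total_fock) => a.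
rewrite bopZ !bcompE left_creationE !dilationE // bopZr left_creationE.
by rewrite exprS rmorphM -scalerA.
Qed.

End Fock.

(** Bessel's inequality for the mutually orthogonal ranges of the X_i, with p the projection of z
    onto their sum. *)
Lemma isometry_row (R : realType) (V W : hilbertType R) (I : finType) (X : I -> bop V W) :
  (forall i j, hadj (X i) \bo X j = (i == j)%:R *: bid V) -> colbnd (fun i => hadj (X i)) 1.
Proof.
move=> Xo z; pose p := \sum_i X i (hadj (X i) z).
have e1 : redot z p = \sum_i hnorm (hadj (X i) z) ^+ 2.
  by rewrite redot_sumr; apply: eq_bigr => i _; rewrite redotPr redotxx.
have e2 : hnorm p ^+ 2 = \sum_i hnorm (hadj (X i) z) ^+ 2.
  rewrite -redotxx redot_sumr; apply: eq_bigr => i _.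
  rewrite redotPr bop_sumr (bigD1 i) //= big1 ?addr0 => [|j ji].
    by rewrite -bcompE Xo eqxx scale1r bidE redotxx.
  by rewrite -bcompE Xo eq_sym (negbTE ji) scale0r.
have := sqr_ge0 (hnorm (z - p)); rewrite hnormB2 e1 e2; lra.
Qed.

Lemma half01 (R : realType) : 0 < (2^-1 : R) < 1.
Proof. by apply/andP; split; lra. Qed.

Section Words.
Context {R : realType} {n : nat}.

Lemma sum_tuple0 (V : nmodType) (G : seq 'I_n -> V) :
  \sum_(a : 0.-tuple 'I_n) G a = G [::].
Proof.
rewrite (bigD1 [tuple]) //= big1 ?addr0 // => a /eqP[].
exact: tuple0.
Qed.

Lemma sum_tupleS (V : nmodType) k (G : seq 'I_n -> V) :
  \sum_(a : k.+1.-tuple 'I_n) G a = \sum_i \sum_(a : k.-tuple 'I_n) G (i :: a).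
Proof.
rewrite pair_bigA /=.
rewrite (reindex (fun p : 'I_n * k.-tuple 'I_n => [tuple of p.1 :: p.2])) //=.
exists (fun a : k.+1.-tuple 'I_n => (thead a, [tuple of behead a])) => [[i a] _|a _] /=.
  by congr (_, _); apply: val_inj.
by apply: val_inj; rewrite /= [in RHS](tuple_eta a).
Qed.

Lemma sum_tuple_delta (V : nmodType) k (G : seq 'I_n -> V) b :
  \sum_(a : k.-tuple 'I_n) (if tval a == b then G a else 0) = if size b == k then G b else 0.
Proof.
have [/eqP sb|sb] := boolP (size b == k).
  rewrite (bigD1 (Tuple (introT eqP sb))) //= eqxx big1 ?addr0 // => a.
  by rewrite -val_eqE /= => /negbTE ->.
rewrite big1 // => a _; case: eqP => // ab.
by rewrite -ab size_tuple eqxx in sb.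
Qed.

Lemma opwordS (L : hilbertType R) (X : 'I_n -> bop L L) i a :
  opword X (i :: a) = X i \bo opword X a.
Proof. by []. Qed.

Lemma colbnd_words (L : hilbertType R) (X : 'I_n -> bop L L) M k : 0 <= M ->
  colbnd (fun i => hadj (X i)) M ->
  colbnd (fun a : k.-tuple 'I_n => hadj (opword X a)) (M ^+ k).
Proof.
move=> M0 XM; elim: k => [|k IH] z.
  by rewrite (sum_tuple0 (fun a => hnorm (hadj (opword X a) z) ^+ 2)) /= hadj_id mul1r.
rewrite (sum_tupleS k (fun a => hnorm (hadj (opword X a) z) ^+ 2)).
apply: (@le_trans _ _ (\sum_i M ^+ k * hnorm (hadj (X i) z) ^+ 2)).
  apply: ler_sum => i _; apply: le_trans (IH (hadj (X i) z)).
  by apply: ler_sum => a _; rewrite opwordS hadj_comp.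
by rewrite -mulr_sumr exprSr -mulrA ler_wpM2l ?exprn_ge0.
Qed.

Lemma opword_comm (L L' : hilbertType R) (X : 'I_n -> bop L L) (X' : 'I_n -> bop L' L')
    (B : bop L L') a : (forall i, B \bo X i = X' i \bo B) ->
  B \bo opword X a = opword X' a \bo B.
Proof.
move=> h; elim: a => [|i a IH]; first by apply: bop_ext.
apply: bop_ext => x; rewrite !opwordS !bcompE.
have /(congr1 (fun T : bop L L' => T (opword X a x))) := h i.
rewrite !bcompE => ->.
by have /(congr1 (fun T : bop L L' => T x)) := IH; rewrite !bcompE => ->.
Qed.

Lemma opword_right (F2 : fock_space R n) (r : R) a g :
  opword (scaled_right_creation F2 r) a (fock_e F2 g) =
  (r ^+ size a)%:C *: fock_e F2 (g ++ rev a).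
Proof.
elim: a => [|i a IH]; first by rewrite /= scale1r cats0.
rewrite opwordS bcompE IH bopZr bopZ right_creationE scalerA -rmorphM /=.
by rewrite rev_cons rcons_cat exprSr.
Qed.

Lemma colbnd_right (F2 : fock_space R n) (r : R) :
  colbnd (fun i => hadj (scaled_right_creation F2 r i)) (r ^+ 2).
Proof.
move=> z; have := isometry_row (right_creation_isom F2) z; rewrite mul1r => h.
rewrite (eq_bigr (fun i => r ^+ 2 * hnorm (hadj (right_creation F2 i) z) ^+ 2)).
  by rewrite -mulr_sumr ler_wpM2l ?sqr_ge0.
by move=> i _; rewrite /scaled_right_creation hadjZ bopZ hnormZr exprMn real_normK ?num_real.
Qed.

Lemma row_ball_colbnd (L : hilbertType R) (X : 'I_n -> bop L L) : row_ball X ->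
  exists2 r, 0 < r < 1 & colbnd (fun i => hadj (X i)) (r ^+ 2).
Proof.
rewrite /row_ball; set s := opnorm _ => s1.
(* The maximum with 1/2 keeps the radius positive even when X = 0, as the row estimates demand. *)
exists (Num.max (Num.sqrt s) 2^-1).
  by rewrite lt_max gt_max s1 invr_gt0 ltr0n orbT /= invf_lt1 // ltr1n.
move=> z; have := colbnd_opnorm (fun i => hadj (X i)) z.
under [X in opnorm X]eq_bigr do rewrite hadjK.
move=> /le_trans; apply; rewrite ler_wpM2r ?sqr_ge0 //.
rewrite -/s -[leLHS]sqr_sqrtr ?opnorm_ge0 // ler_pXn2r ?nnegrE ?sqrtr_ge0 ?le_max ?lexx //.
by rewrite sqrtr_ge0.
Qed.

Lemma colbnd_row_ball (L : hilbertType R) (X : 'I_n -> bop L L) r : 0 <= r < 1 ->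
  colbnd (fun i => hadj (X i)) (r ^+ 2) -> row_ball X.
Proof.
move=> /andP[r0 r1] Xr; rewrite /row_ball.
have : opnorm (\sum_i hadj (hadj (X i)) \bo hadj (X i)) <= r ^+ 2.
  by apply: opnorm_le; rewrite ?sqr_ge0 //; apply: colbnd_bnd; rewrite ?sqr_ge0.
under eq_bigr do rewrite hadjK.
move=> h; rewrite (le_lt_trans _ r1) // -(@ler_pXn2r _ 2) ?nnegrE ?sqrtr_ge0 //.
by rewrite sqr_sqrtr ?opnorm_ge0.
Qed.

End Words.

(** * Growth and evaluation of free power series *)

Section FreeHolomorphic.
Context {R : realType} {n : nat} (tens : tensor_product R).

Section Growth.
Context {E Y : hilbertType R}.

(** Cauchy-Hadamard: past some N the Gram norms are at most q^(2k), and the finitely many earlier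
    ones are absorbed into C, which is at least 1. *)
Lemma fh_growth (F : free_holo n E Y) (q : R) : 1 < q -> exists2 C, 0 <= C &
  forall k, colbnd (fun a : k.-tuple 'I_n => F a) ((C * q ^+ k) ^+ 2).
Proof.
move=> q1; pose u k := opnorm (\sum_(a : k.-tuple 'I_n) hadj (F a) \bo F a).
have u0 k : 0 <= u k by exact: opnorm_ge0.
have [N hN] : exists N, forall k, (N <= k)%N -> u k `^ (2 * k)%:R^-1 < q.
  have : (limn_esup (fun k => (u k `^ (2 * k)%:R^-1)%:E) < q%:E)%E.
    by apply: le_lt_trans (fh_radius F) _; rewrite lte_fin.
  rewrite /limn_esup limf_esupE => /ereal_inf_lt[_ [A [N _ NA] <-]] supq.
  exists N => k Nk; rewrite -lte_fin; apply: le_lt_trans supq.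
  by apply: ereal_sup_ubound; exists k => //; exact: NA.
pose C := 1 + \sum_(k < N.+1) u k.
have S0 : 0 <= \sum_(k < N.+1) u k by rewrite sumr_ge0.
have C1 : 1 <= C by rewrite lerDl.
exists C; first by rewrite (le_trans _ C1).
have qk k : 1 <= q ^+ k by rewrite exprn_ege1 // ltW.
have key k : u k <= (C * q ^+ k) ^+ 2.
  have [kN|Nk] := ltnP k N.+1.
    apply: (@le_trans _ _ C).
      by rewrite /C (bigD1 (Ordinal kN)) //= addrCA lerDl addr_ge0 // sumr_ge0.
    apply: (@le_trans _ _ (C * q ^+ k)); first by rewrite ler_peMr // (le_trans _ C1).
    by rewrite expr2 ler_peMl ?mulr_ge0 ?(le_trans _ C1) ?(le_trans _ (qk k)) // -[1]mulr1 ler_pM.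
  (* Starting strictly beyond N excludes k = 0, where the exponent 1 / (2k) cannot be undone. *)
  have k0 : (0 < k)%N by apply: leq_ltn_trans Nk.
  have -> : u k = (u k `^ (2 * k)%:R^-1) ^+ (2 * k).
    rewrite -powR_mulrn ?powR_ge0 // -powRrM mulVf ?powRr1 //.
    by rewrite pnatr_eq0 muln_eq0 /= -lt0n.
  have := hN k (ltnW Nk); rewrite mulnC => hk.
  rewrite exprM ler_pXn2r ?nnegrE ?exprn_ge0 ?powR_ge0 //; last first.
    by rewrite mulr_ge0 ?(le_trans _ C1) ?(le_trans _ (qk k)).
  apply: (@le_trans _ _ (q ^+ k)).
    by apply: lerXn2r; rewrite ?nnegrE ?powR_ge0 ?(ltW hk) //; lra.
  by rewrite ler_peMl // (le_trans _ (qk k)).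
move=> k x; apply: le_trans (colbnd_opnorm _ x) _.
by rewrite ler_wpM2r ?sqr_ge0 //; exact: key.
Qed.

Lemma radius_le1 (A : seq 'I_n -> bop E Y) :
  (forall k, colbnd (fun a : k.-tuple 'I_n => A a) 1) ->
  (limn_esup (fun k => ((opnorm (\sum_(a : k.-tuple 'I_n)
      hadj (A a) \bo A a)) `^ ((2 * k)%:R^-1))%:E) <= 1)%E.
Proof.
move=> A1; rewrite /limn_esup limf_esupE; apply: ereal_inf_le.
eexists; first by exists setT => //; exact: filterT.
apply: ub_ereal_sup => _ [k _ <-]; rewrite lee_fin.
have h : opnorm (\sum_(a : k.-tuple 'I_n) hadj (A a) \bo A a) <= 1.
  by apply: opnorm_le => //; apply: colbnd_bnd.
apply: (@le_trans _ _ (1 `^ (2 * k)%:R^-1)); last by rewrite powR1.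
by apply: ge0_ler_powR; rewrite ?nnegrE ?opnorm_ge0 ?invr_ge0.
Qed.

Lemma free_holo_eq (F G : free_holo n E Y) : (forall a, F a = G a) -> F = G.
Proof.
case: F G => [f fr] [g gr] /= fg; have efg : f = g by apply: funext.
by case: _ / efg gr => gr; congr FreeHolo; exact: Prop_irrelevance.
Qed.

End Growth.

(** The homogeneous part of degree k. F is a bare coefficient family, so that the term also makes
    sense for families that carry no radius condition. *)
Definition fh_term (E Y L : hilbertType R) (F : seq 'I_n -> bop E Y) (X : 'I_n -> bop L L) k :
    bop (tens E L) (tens Y L) :=
  \sum_(a : k.-tuple 'I_n) tensop tens (F a) (opword X a).

Lemma bnd_fh_term (E Y L : hilbertType R) (F : seq 'I_n -> bop E Y) (X : 'I_n -> bop L L) k r b :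
  0 < r -> 0 <= b -> colbnd (fun i => hadj (X i)) (r ^+ 2) ->
  colbnd (fun a : k.-tuple 'I_n => F a) (b ^+ 2) -> bnd (fh_term F X k) (r ^+ k * b).
Proof.
move=> r0 b0 Xr Fb; apply: bnd_sum_tensop; rewrite ?exprn_gt0 //.
by rewrite -exprM mulnC exprM; apply: colbnd_words; rewrite ?sqr_ge0.
Qed.

(** The bound M depends on the radius alone, not on the space L or the tuple X; limits in which the
    tuple varies depend on this uniformity. *)
Lemma fh_eval_lim (E Y : hilbertType R) (F : free_holo n E Y) r : 0 < r < 1 ->
  exists2 M, 0 <= M & forall (L : hilbertType R) (X : 'I_n -> bop L L),
    colbnd (fun i => hadj (X i)) (r ^+ 2) ->
    opcvg (fun N => \sum_(k < N) fh_term F X k) (fh_eval tens F X) /\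
    bnd (fh_eval tens F X) M.
Proof.
(* Any q strictly between 1 and 1 / r would do; here r q = 2 r / (1 + r) < 1. *)
move=> /andP[r0 r1]; pose q := 2 / (1 + r).
have q1 : 1 < q by rewrite ltr_pdivlMr ?mul1r; lra.
have [C C0 FC] := fh_growth F q1.
have rq : 0 <= r * q < 1.
  rewrite mulr_ge0 ?divr_ge0 //=; try lra.
  by rewrite /q mulrA ltr_pdivrMr; lra.
have /andP[_ rq1] := rq.
exists (C / (1 - r * q)); first by rewrite divr_ge0 //; lra.
move=> L X Xr; have [|T TM Tc] := @opseries _ _ _ (fh_term F X) C (r * q) C0 rq.
  move=> k; have Cq : 0 <= C * q ^+ k by rewrite mulr_ge0 // exprn_ge0 //; lra.
  by rewrite exprMn mulrCA; exact: bnd_fh_term r0 Cq Xr (FC k).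
by have -> : fh_eval tens F X = T by exact: op_limE.
Qed.

Lemma fh_eval_hcvg (E Y L : hilbertType R) (F : free_holo n E Y) (X : 'I_n -> bop L L) r z :
  0 < r < 1 -> colbnd (fun i => hadj (X i)) (r ^+ 2) ->
  hcvg (fun N => \sum_(k < N) fh_term F X k z) (fh_eval tens F X z).
Proof.
move=> r01 Xr; have [M _ /(_ L X Xr)[h _]] := fh_eval_lim F r01.
have := opcvg_hcvg z h; congr hcvg; apply: funext => N; exact: bop_sum.
Qed.

Lemma fh_term0 (E Y L : hilbertType R) (F : seq 'I_n -> bop E Y) (X : 'I_n -> bop L L) :
  fh_term F X 0 = tensop tens (F [::]) (bid L).
Proof. exact: (sum_tuple0 (fun a => tensop tens (F a) (opword X a))). Qed.

Lemma fh_termS (E Y L : hilbertType R) (F : seq 'I_n -> bop E Y) (X : 'I_n -> bop L L) k :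
  fh_term F X k.+1 =
  \sum_i \sum_(a : k.-tuple 'I_n) tensop tens (F (i :: a)) (X i \bo opword X a).
Proof. exact: (sum_tupleS k (fun a => tensop tens (F a) (opword X a))). Qed.

Lemma fh_eval0 (E Y L : hilbertType R) (F : free_holo n E Y) :
  fh_eval tens F (fun=> 0 : bop L L) = tensop tens (F [::]) (bid L).
Proof.
apply: bop_ext => z.
have h2 := half01 R.
have X0 : colbnd (fun i : 'I_n => hadj (0 : bop L L)) (2^-1 ^+ 2).
  move=> x; rewrite big1 => [|i _]; first by rewrite mulr_ge0 // sqr_ge0.
  by rewrite (_ : hadj 0 = 0) ?hnorm0 ?expr0n //; apply: hadj_eq => ? ?; rewrite hdot0l hdot0r.
apply: (hcvg_unique (fh_eval_hcvg F z h2 X0)).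
apply: (@hcvg_near_cst _ _ _ _ 1%N) => -[//|m] _.
rewrite big_ord_recl fh_term0 big1 ?addr0 // => k _.
rewrite lift0 fh_termS !bop_sum big1 // => i _; rewrite bop_sum big1 // => a _.
by rewrite (_ : 0 \bo _ = 0) ?tensop0r //; apply: bop_ext.
Qed.

(** Words are intertwined letter by letter and the relation survives the limit. Taking for B a left
    creation word, a dilation or an embedding yields every change of evaluation point below. *)
Lemma fh_eval_intertwine (E Y L L' : hilbertType R) (F : free_holo n E Y)
    (X : 'I_n -> bop L L) (X' : 'I_n -> bop L' L') (B : bop L L') r :
  0 < r < 1 -> colbnd (fun i => hadj (X i)) (r ^+ 2) -> colbnd (fun i => hadj (X' i)) (r ^+ 2) ->
  (forall i, B \bo X i = X' i \bo B) ->
  tensop tens (bid Y) B \bo fh_eval tens F X = fh_eval tens F X' \bo tensop tens (bid E) B.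
Proof.
move=> r01 Xr X'r BX; apply: bop_ext => z; rewrite !bcompE.
apply: hcvg_unique (fh_eval_hcvg F _ r01 X'r).
have := bop_hcvg (tensop tens (bid Y) B) (fh_eval_hcvg F z r01 Xr).
congr hcvg; apply: funext => N; rewrite bop_sumr; apply: eq_bigr => k _.
rewrite !bop_sum bop_sumr; apply: eq_bigr => a _.
by rewrite -!bcompE !tensop_comp (opword_comm _ BX).
Qed.

(* With C 2^k bounding the coefficients of length k >= 1 and X of norm t^2,
   the k-th term is at most C t (2 t)^k; t = 1 / (C + 3) makes the sum < 1. *)
Lemma fh_small (E Y : hilbertType R) (F : free_holo n E Y) : F [::] = 0 ->
  exists2 r, 0 < r < 1 & exists2 s, 0 <= s < 1 &
    forall (L : hilbertType R) (X : 'I_n -> bop L L),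
    colbnd (fun i => hadj (X i)) (r ^+ 2) -> bnd (fh_eval tens F X) s.
Proof.
move=> F0; have [C C0 FC] := fh_growth F (ltr1n R 2).
pose t := (C + 3)^-1; have t0 : 0 < t by rewrite invr_gt0 ltr_wpDl.
have tC : t * (C + 3) = 1 by rewrite mulVf // gt_eqF // ltr_wpDl.
have t1 : 3 * t <= 1 by nra.
exists (t * t); first by apply/andP; split; nra.
have s01 : 0 <= 2 * t < 1 by apply/andP; split; lra.
have Ct : 0 <= C * t by rewrite mulr_ge0 // ltW.
exists (C * t / (1 - 2 * t)).
  rewrite divr_ge0 //=; last by lra.
  by rewrite ltr_pdivrMr; nra.
move=> L X Xr; have [|T TM Tc] := @opseries _ _ _ (fh_term F X) (C * t) (2 * t) Ct s01.
  case=> [|k].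
    by rewrite fh_term0 F0 tensop0l expr0 mulr1; apply: bnd_le bnd0.
  have Cq : 0 <= C * 2 ^+ k.+1 by rewrite mulr_ge0 // exprn_ge0.
  have := bnd_fh_term (mulr_gt0 t0 t0) Cq Xr (FC k.+1); apply: bnd_le.
  rewrite !exprMn (exprS t) -!mulrA (mulrC t) -!mulrA.
  have p0 : 0 <= t ^+ k by rewrite exprn_ge0 // ltW.
  have p1 : t ^+ k <= 1 by rewrite exprn_ile1 //; lra.
  have c2 : 0 <= C * 2 ^+ k.+1 * t * t ^+ k * t.
    by rewrite !mulr_ge0 // ltW.
  have -> : t ^+ k * (t * (t ^+ k * (C * (2 ^+ k.+1 * t)))) = (C * 2 ^+ k.+1 * t * t ^+ k * t) * t ^+ k by ring.
  have -> : C * (t * (2 ^+ k.+1 * (t * t ^+ k))) = C * 2 ^+ k.+1 * t * t ^+ k * t by ring.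
  by rewrite ler_piMr.
by have -> : fh_eval tens F X = T by exact: op_limE.
Qed.

End FreeHolomorphic.

(** * Evaluation at the right creation operators and the symbol *)

Lemma hcvg_hdot_cst (R : realType) (V : hilbertType R) (u : nat -> V) l w (c : R[i]) N :
  hcvg u l -> (forall m, (N <= m)%N -> hdot (u m) w = c) -> hdot l w = c.
Proof.
move=> ul uc.
have key (v : nat -> V) l' (d : R) : hcvg v l' ->
    (forall m, (N <= m)%N -> redot (v m) w = d) -> redot l' w = d.
  move=> vl vd; rewrite -(cvg_lim (@Rhausdorff R) (@hcvg_redot _ _ _ _ w vl)).
  apply: cvg_lim => //; apply: cvg_near_cst; exists N => // m /= Nm; exact: vd.
apply/eqP; rewrite eq_complex; apply/andP; split; apply/eqP.
  by apply: (key _ _ _ ul) => m Nm; rewrite /redot uc.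
rewrite Im_hdot; apply: (key _ _ _ (hcvgZ (- 'i) ul)) => m Nm.
by rewrite -Im_hdot uc.
Qed.

Lemma hcvg_scale (R : realType) (V : hilbertType R) (c : nat -> R) (d : R) (v : V) :
  c @ \oo --> d -> hcvg (fun m => (c m)%:C *: v) (d%:C *: v).
Proof.
move=> cd; apply: (@hcvg_squeeze _ _ _ _ (fun m => `|c m - d| * hnorm v)).
  by move=> m; rewrite -scalerBl -rmorphB hnormZr.
rewrite -[0](mul0r (hnorm v)); apply: cvgM; last exact: cvg_cst.
rewrite -[0](normr0 R) -(subrr d); apply: cvg_norm; apply: cvgB => //; exact: cvg_cst.
Qed.

(** Both sides are self-adjoint and the form of Re B at f is Re <B f, f>, so the operator inequality
    becomes one between real quadratic forms. *)
Lemma op_le_opRe (R : realType) (V W : hilbertType R) (A : bop V W) (B : bop V V) :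
  op_le (hadj A \bo A) (opRe B) <-> forall f, hnorm (A f) ^+ 2 <= redot (B f) f.
Proof.
have half : (2^-1 : R[i]) = (2^-1 : R)%:C by rewrite fmorphV rmorph_nat.
have e f : redot ((opRe B - hadj A \bo A) f) f = redot (B f) f - hnorm (A f) ^+ 2.
  rewrite bopB redotBl bcompE -redotPr redotxx /opRe half bopZ redotZl bopD redotDl.
  by rewrite -redotPr (redotC f); lra.
have es : hadj (opRe B - hadj A \bo A) = opRe B - hadj A \bo A.
  by rewrite hadjB /opRe half hadjZ hadjD hadjK (addrC (hadj B)) hadj_comp hadjK.
have -> : op_le (hadj A \bo A) (opRe B) <-> op_le 0 (opRe B - hadj A \bo A).
  by split=> h x; have := h x; rewrite subr0.
split=> [h f|h]; first by rewrite -subr_ge0 -e psd_ge0.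
by apply/psdP; split=> // f; rewrite e subr_ge0.
Qed.

Section Dilation.
Context {R : realType}.

(** Radial limits r -> 1 are taken along this sequence, which stays in [0, 1). *)
Definition near1 m : R := 1 - m.+1%:R^-1.

Lemma near1_bound m : 0 <= near1 m < 1.
Proof.
rewrite /near1 subr_ge0 invf_le1 ?ltr0n // ler1n ltnS leq0n /=.
by rewrite ltrBlDr ltrDl invr_gt0.
Qed.

Lemma near1_le1 m : 0 <= near1 m <= 1.
Proof. by have /andP[-> /ltW ->] := near1_bound m. Qed.

Lemma near1_cvg : near1 @ \oo --> (1 : R).
Proof.
rewrite -[X in _ --> X]subr0; apply: cvgB; first exact: cvg_cst.
exact: cvg_harmonic.
Qed.

Context {n : nat} (tens : tensor_product R) (F2 : fock_space R n).
Local Notation e := (fock_e F2).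
Local Notation S_ := (left_creation F2).
Local Notation "A \ot B" := (tensop tens A B) (at level 39, left associativity).
Local Notation "x \tp y" := (tpure (tens _ F2) x y) (at level 39, left associativity).
Implicit Types K : hilbertType R.

Definition pure_fock K (p : K * seq 'I_n) : tens K F2 := p.1 \tp e p.2.

Lemma total_pure_fock K : total (@pure_fock K).
Proof.
apply: (@total_tens _ tens K F2 K _ id e); last exact: total_fock.
by move=> u hu; apply: hnorm_eq0; apply/eqP; rewrite -sqrf_eq0 -redotxx /redot hu.
Qed.

Lemma pure_fock_ext K (V : hilbertType R) (A B : bop (tens K F2) V) :
  (forall x a, A (x \tp e a) = B (x \tp e a)) -> A = B.
Proof. by move=> h; apply: (total_ext (@total_pure_fock K)) => -[x a]; exact: h. Qed.

Lemma hdot_pure_fock K (x y : K) a b : hdot (x \tp e a) (y \tp e b) = if a == b then hdot x y else 0.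
Proof. by rewrite tpure_dot fock_e_orthonormal; case: eqP; rewrite ?mulr1 ?mulr0. Qed.

Lemma dilation_near1 K (v : tens K F2) :
  hcvg (fun m => (bid K \ot dilation F2 (near1 m)) v) v.
Proof.
suff : hcvg (fun m => (bid K \ot dilation F2 (near1 m)) v) (bid _ v) by [].
apply: (@strong_total _ _ _ (@pure_fock K) _ (fun m => bid K \ot dilation F2 (near1 m)) (bid _) 1).
- move=> m; rewrite -[1]mulr1; apply: bnd_tensop => //; first exact: bnd_id.
  by apply: bnd_dilation; exact: near1_le1.
- exact: total_pure_fock.
- move=> [x a]; rewrite bidE -[X in hcvg _ X]scale1r.
  rewrite (_ : (fun _ => _) = (fun m => (near1 m ^+ size a)%:C *: pure_fock (x, a))).
    apply: hcvg_scale; rewrite -(expr1n _ (size a)).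
    by apply: (@cvg_comp _ _ _ near1 (fun t => t ^+ size a)); [exact: near1_cvg|exact: exprn_continuous].
  by apply: funext => m; rewrite tensopE bidE dilationE ?near1_le1 // tpureZr.
Qed.

Lemma colbnd_rightW (r s : R) : 0 <= r <= s ->
  colbnd (fun i => hadj (scaled_right_creation F2 r i)) (s ^+ 2).
Proof.
move=> /andP[r0 rs] z; have h := @colbnd_right _ _ F2 r z.
apply: (le_trans h).
by rewrite ler_wpM2r ?sqr_ge0 // ler_pXn2r ?nnegrE // (le_trans r0).
Qed.

Lemma radius_mid (r : R) : 0 <= r < 1 -> exists2 s, 0 < s < 1 & 0 <= r <= s.
Proof.
move=> /andP[r0 r1]; exists ((1 + r) / 2); first by apply/andP; split; lra.
by rewrite r0; lra.
Qed.

Section Right.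
Context {E Y : hilbertType R}.
Implicit Type F : free_holo n E Y.

Lemma fh_term_right F r k x g :
  fh_term tens F (scaled_right_creation F2 r) k (x \tp e g) =
  \sum_(a : k.-tuple 'I_n) (r ^+ k)%:C *: (F a x \tp e (g ++ rev a)).
Proof.
rewrite bop_sum; apply: eq_bigr => a _.
by rewrite tensopE opword_right tpureZr size_tuple.
Qed.

(** Right creation appends letters, so the word a in r R sends the vacuum to r^|a| times the basis
    vector of the reversed word, and one entry of the vacuum column isolates one coefficient. *)
Lemma fh_right_coef F r x y b : 0 <= r < 1 ->
  hdot (fh_eval tens F (scaled_right_creation F2 r) (x \tp e [::])) (y \tp e (rev b)) =
  (r ^+ size b)%:C * hdot (F b x) y.
Proof.
move=> /radius_mid[s s01 rs].
apply: (hcvg_hdot_cst (N := (size b).+1) (fh_eval_hcvg F _ s01 (colbnd_rightW rs))) => m bm.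
rewrite hdot_suml (bigD1 (Ordinal bm)) //= big1 ?addr0 => [|k kb]; rewrite fh_term_right hdot_suml.
  rewrite (eq_bigr (fun a : (size b).-tuple 'I_n => if tval a == b then (r ^+ size b)%:C * hdot (F a x) y else 0)).
    by rewrite (sum_tuple_delta _ (fun a => (r ^+ size b)%:C * hdot (F a x) y)) eqxx.
  move=> a _; rewrite hdotZl hdot_pure_fock (can_eq revK).
  by case: eqP => // _; rewrite mulr0.
rewrite big1 // => a _; rewrite hdotZl hdot_pure_fock (can_eq revK); case: eqP => [ab|_]; last by rewrite mulr0.
by case/eqP: kb; apply: val_inj; rewrite /= -ab size_tuple.
Qed.

(** Left creation operators commute with right ones, so F(r R) commutes with them; this is the
    source of the Toeplitz structure. *)
Lemma fh_right_left F r (B : bop F2 F2) : 0 <= r < 1 ->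
  (forall i, B \bo right_creation F2 i = right_creation F2 i \bo B) ->
  bid Y \ot B \bo fh_eval tens F (scaled_right_creation F2 r) =
  fh_eval tens F (scaled_right_creation F2 r) \bo bid E \ot B.
Proof.
move=> /radius_mid[s s01 rs] BR.
apply: (fh_eval_intertwine _ _ s01 (colbnd_rightW rs) (colbnd_rightW rs)) => i.
apply: bop_ext => x; rewrite !bcompE !bopZ bopZr; congr (_ *: _).
by have := congr1 (fun T : bop F2 F2 => T x) (BR i).
Qed.

Lemma fh_right_dilation F r c : 0 <= r < 1 -> 0 <= c <= 1 ->
  bid Y \ot dilation F2 c \bo fh_eval tens F (scaled_right_creation F2 r) =
  fh_eval tens F (scaled_right_creation F2 (r * c)) \bo bid E \ot dilation F2 c.
Proof.
move=> r01 c01; have [s s01 rs] := radius_mid r01.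
have /andP[c0 c1] := c01; have /andP[r0 r1] := r01.
have rcs : 0 <= r * c <= s.
  rewrite mulr_ge0 //=; have /andP[_] := rs; apply: le_trans; exact: ler_piMr.
apply: (fh_eval_intertwine _ _ s01 (colbnd_rightW rs) (colbnd_rightW rcs)) => i.
apply: bop_ext => x; rewrite !bcompE !bopZ bopZr rmorphM -scalerA; congr (_ *: _).
by have /(congr1 (fun T : bop F2 F2 => T x)) := dilation_right F2 i c01.
Qed.

(* dilation (near1 m) intertwines F(c R) and F(near1 m c R), and tends strongly
   to the identity. *)
Lemma fh_right_near1 F c g : 0 <= c < 1 ->
  hcvg (fun m => fh_eval tens F (scaled_right_creation F2 (near1 m * c)) g)
       (fh_eval tens F (scaled_right_creation F2 c) g).
Proof.
move=> c01; have [s s01 cs] := radius_mid c01.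
have [M M0 FM] := fh_eval_lim tens F s01.
have /andP[c0 c1] := c01.
have ncs m : 0 <= near1 m * c <= s.
  have /andP[h1 h2] := near1_le1 m.
  rewrite mulr_ge0 //=; have /andP[_] := cs; apply: le_trans; exact: ler_piMl.
pose Fc := fh_eval tens F (scaled_right_creation F2 c).
pose LE m := (bid E \ot dilation F2 (near1 m)) g; pose LY m := (bid Y \ot dilation F2 (near1 m)) (Fc g).
apply: (@hcvg_squeeze _ _ _ _ (fun m => M * hnorm (LE m - g) + hnorm (LY m - Fc g))).
  move=> m; have := fh_right_dilation F c01 (near1_le1 m).
  move=> /(congr1 (fun T : bop (tens E F2) (tens Y F2) => T g)); rewrite !bcompE => h.
  rewrite (le_trans (hnorm_triangle (LY m) _ _)) // lerD2r /LY h (mulrC c) -bopBr hnormBC -hnormN -bopNr opprB.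
  by rewrite hnormBC; have [_] := FM _ _ (colbnd_rightW (ncs m)); apply.
rewrite -[0]addr0 -[X in X + _](mulr0 M); apply: cvgD; last exact: dilation_near1.
apply: cvgM; [exact: cvg_cst|exact: dilation_near1].
Qed.

End Right.

Definition tens_with K (L : hilbertType R) (y : L) : bop K (tens K L) :=
  xget 0 [set T : bop K (tens K L) | forall x, T x = tpure (tens K L) x y].

Lemma tens_withE K (L : hilbertType R) (y : L) x : tens_with K y x = tpure (tens K L) x y.
Proof.
have [T _ TE] := tensor_mapl tens K y.
by rewrite /tens_with; case: xgetP => [T' _ ->//|/(_ T)].
Qed.

Lemma tens_with_adj K (x : K) a b :
  hadj (tens_with K (e a)) (x \tp e b) = if a == b then x else 0.
Proof.
apply: hdotI => y; rewrite -hadjP tens_withE hdot_pure_fock.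
by case: eqP => // _; rewrite hdot0r.
Qed.

Lemma opword_left a b : opword S_ a (e b) = e (a ++ b).
Proof. by elim: a => [//|i a IH]; rewrite opwordS bcompE IH left_creationE. Qed.

Lemma opword_rcons (V : hilbertType R) (A : 'I_n -> bop V V) a i :
  opword A (rcons a i) = opword A a \bo A i.
Proof.
elim: a => [|j a IH]; first by apply: bop_ext.
by rewrite rcons_cons !opwordS IH; apply: bop_ext.
Qed.

Lemma opword_adj (V : hilbertType R) (A : 'I_n -> bop V V) a :
  opword (fun i => hadj (A i)) a = hadj (opword A (rev a)).
Proof.
elim: a => [|i a IH]; first by rewrite /= hadj_id.
by rewrite opwordS IH rev_cons opword_rcons hadj_comp.
Qed.

Lemma opword_tensr K (V : hilbertType R) (A : 'I_n -> bop V V) a :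
  opword (fun i => bid K \ot A i) a = bid K \ot opword A a.
Proof.
elim: a => [|i a IH]; first by rewrite /= tensop_id.
by rewrite !opwordS IH tensop_comp; congr (_ \ot _); apply: bop_ext.
Qed.

(** * The symbol as a boundary value on the vacuum *)

Section Symbol.
Context {E Y : hilbertType R} (Th : free_holo n E Y) (Th_ball : H2_unit_ball Th).

Definition symbol_term k : bop E (tens Y F2) :=
  \sum_(a : k.-tuple 'I_n) tens_with Y (e (rev a)) \bo Th a.

Lemma symbol_termE k x :
  symbol_term k x = \sum_(a : k.-tuple 'I_n) (Th a x \tp e (rev a)).
Proof. by rewrite bop_sum; apply: eq_bigr => a _; rewrite bcompE tens_withE. Qed.

Lemma symbol_term_pure k x y b :
  hdot (symbol_term k x) (y \tp e (rev b)) = if size b == k then hdot (Th b x) y else 0.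
Proof.
rewrite symbol_termE hdot_suml -(sum_tuple_delta _ (fun a => hdot (Th a x) y)).
by apply: eq_bigr => a _; rewrite hdot_pure_fock (can_eq revK).
Qed.

Lemma symbol_term_dot j k x : redot (symbol_term j x) (symbol_term k x) =
  if j == k then \sum_(a : k.-tuple 'I_n) hnorm (Th a x) ^+ 2 else 0.
Proof.
rewrite (symbol_termE k) redot_sumr.
under eq_bigr do rewrite /redot symbol_term_pure size_tuple.
rewrite eq_sym; case: eqP => _; last by rewrite big1.
by apply: eq_bigr => a _; rewrite -redotxx.
Qed.

(** Parts of different degree are orthogonal, so the squared norms of the partial sums are the
    increasing sums of |A_a x|^2. These converge to <S x, x> <= |x|^2, which gives both the Cauchy
    property and the bound 1. *)
Lemma symbol_exists : exists2 T : bop E (tens Y F2), bnd T 1 &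
  forall x, hcvg (fun N => \sum_(k < N) symbol_term k x) (T x).
Proof.
have [S HS S1] := Th_ball.
have Sb : bnd S 1.
  apply: bnd_le (opnorm_bnd S); rewrite -[X in X <= _]sqr_sqrtr ?opnorm_ge0 //.
  by rewrite expr_le1 // sqrtr_ge0.
pose s x N := \sum_(k < N) \sum_(a : k.-tuple 'I_n) hnorm (Th a x) ^+ 2.
have sc x : s x @ \oo --> redot (S x) x.
  have /hcvgP/(@hcvg_redot _ _ _ _ x) := HS x.
  suff -> : s x = (fun N => redot (\sum_(k < N) \sum_(a : k.-tuple 'I_n) (hadj (Th a) \bo Th a) x) x) by [].
  apply: funext => N; rewrite redot_suml; apply: eq_bigr => k _; rewrite redot_suml; apply: eq_bigr => a _.
  by rewrite bcompE -redotPr redotxx.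
have smon x : nondecreasing_seq (s x).
  apply/nondecreasing_seqP => N; rewrite /s big_ord_recr /= lerDl.
  by rewrite sumr_ge0 // => a _; rewrite sqr_ge0.
have sle x N : s x N <= hnorm x ^+ 2.
  apply: (@le_trans _ _ (redot (S x) x)).
    rewrite -(cvg_lim (@Rhausdorff R) (sc x)); apply: nondecreasing_cvgn_le (smon x) _ N.
    by apply/cvg_ex; eexists; exact: sc.
  rewrite (le_trans (cauchy_schwarz _ _)) // expr2 ler_wpM2r ?hnorm_ge0 //.
  by have := Sb x; rewrite mul1r.
have pyth x i d : hnorm (\sum_(i <= k < i + d) symbol_term k x) ^+ 2 = s x (i + d)%N - s x i.
  elim: d => [|d IH]; first by rewrite addn0 big_geq // hnorm0 expr0n subrr.
  rewrite addnS big_nat_recr ?leq_addr //= hnormD2 IH redot_suml big_nat_cond big1.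
    rewrite -redotxx symbol_term_dot eqxx mulr0 addr0 /s big_ord_recr /=; ring.
  move=> k /andP[/andP[_ kd] _]; rewrite symbol_term_dot ifF //.
  by apply/negbTE; rewrite neq_ltn kd.
have [||T T1 Tc] := @bop_lim _ _ _ (fun N => \sum_(k < N) symbol_term k) 1.
- move=> N x; rewrite mul1r -(@ler_pXn2r _ 2) ?nnegrE ?hnorm_ge0 //.
  have := pyth x 0%N N; rewrite add0n big_mkord bop_sum => ->.
  by rewrite {2}/s big_ord0 subr0 sle.
- move=> x; apply: hcauchy_cvg => ee e0.
  have e2 : 0 < ee ^+ 2 / 2 by rewrite divr_gt0 // exprn_gt0.
  have /cvgrPdist_lt/(_ _ e2)[N _ hN] := sc x.
  have key i j : (N <= i)%N -> (i <= j)%N ->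
      hnorm ((\sum_(k < j) symbol_term k) x - (\sum_(k < i) symbol_term k) x) < ee.
    move=> Ni ij; rewrite !bop_sum -!(big_mkord xpredT (fun k => symbol_term k x)) (big_cat_nat (n := i)) //= addrAC subrr add0r.
    rewrite -(@ltr_pXn2r _ 2) ?nnegrE ?hnorm_ge0 ?(ltW e0) // -{1}(subnKC ij) pyth subnKC //.
    have /= := hN i Ni; have /= := hN j (leq_trans Ni ij).
    by rewrite !ltr_norml => /andP[h1 h2] /andP[h3 h4]; lra.
  exists N => i j Ni Nj; have [ij|/ltnW ji] := leqP i j; last exact: key.
  by rewrite hnormBC key.
exists T => // x; have := Tc x; congr hcvg; apply: funext => N; exact: bop_sum.
Qed.

Local Notation Gam := (symbol tens F2 Th).

Lemma symbolP : bnd Gam 1 /\ forall x, hcvg (fun N => \sum_(k < N) symbol_term k x) (Gam x).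
Proof.
have [T T1 Tc] := symbol_exists.
suff -> : Gam = T by [].
have TT x : (\sum_(k < N) \sum_(a : k.-tuple 'I_n)
      tpure (tens Y F2) (Th a x) (fock_e F2 (rev a))) @[N --> \oo] --> T x.
  apply/hcvgP; have := Tc x; congr hcvg; apply: funext => N.
  by apply: eq_bigr => k _; rewrite symbol_termE.
rewrite /symbol; case: xgetP => [T' _ T'c|/(_ T)//].
apply: bop_ext => x; have /hcvgP h := T'c x; have /hcvgP h' := TT x.
exact: hcvg_unique h h'.
Qed.

Lemma symbol_coef x y b : hdot (Gam x) (y \tp e b) = hdot (Th (rev b) x) y.
Proof.
suff key c : hdot (Gam x) (y \tp e (rev c)) = hdot (Th c x) y by rewrite -key revK.
have [_ /(_ x) h] := symbolP.
apply: (hcvg_hdot_cst (N := (size c).+1) h) => m bm.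
rewrite hdot_suml (bigD1 (Ordinal bm)) //= big1 ?addr0 => [|k kb]; rewrite symbol_term_pure.
  by rewrite eqxx.
by rewrite ifF //; apply: contraNF kb => /eqP bk; apply/eqP/val_inj.
Qed.

(** Gamma plays the part of the vacuum column of Theta(R) at r = 1; for r < 1 the powers of r leave
    the series as a dilation. *)
Lemma fh_right_symbol r x : 0 <= r < 1 ->
  fh_eval tens Th (scaled_right_creation F2 r) (x \tp e [::]) = (bid Y \ot dilation F2 r) (Gam x).
Proof.
move=> r01; have [s s01 rs] := radius_mid r01.
have /andP[r0 /ltW r1] := r01.
have h1 := fh_eval_hcvg Th (x \tp e [::]) s01 (colbnd_rightW rs).
have h2 := bop_hcvg (bid Y \ot dilation F2 r) (proj2 symbolP x).
apply: hcvg_unique h1 _; move: h2; congr hcvg; apply: funext => N.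
rewrite bop_sumr; apply: eq_bigr => k _.
rewrite fh_term_right symbol_termE bop_sumr; apply: eq_bigr => a _.
by rewrite tensopE dilationE ?r0 // tpureZr size_rev size_tuple.
Qed.

End Symbol.

End Dilation.

(** * Dilation of the positive Toeplitz kernel *)

Lemma hcvg_lincomb (R : realType) (V : hilbertType R) (I : Type) (u : I -> nat -> V) (v : I -> V) s :
  (forall i, hcvg (u i) (v i)) -> hcvg (fun m => lincomb (fun i => u i m) s) (lincomb v s).
Proof.
move=> uv; elim: s => [|p s IH].
  by rewrite /lincomb; under eq_fun do rewrite big_nil; rewrite big_nil; exact: hcvg_cst.
rewrite /lincomb big_cons; under eq_fun do rewrite big_cons.
by apply: hcvgD => //; apply: hcvgZ.
Qed.

Lemma op_le_sub (R : realType) (V : hilbertType R) (A B : bop V V) : op_le A B -> op_le 0 (B - A).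
Proof. by move=> h x; have := h x; rewrite subr0. Qed.

Section ToeplitzDilation.
Context {R : realType} {n : nat} (tens : tensor_product R) (F2 : fock_space R n).
Context {E Y : hilbertType R} (Th : free_holo n E Y) (F : free_holo n E E).
Local Notation e := (fock_e F2).
Local Notation S_ := (left_creation F2).
Local Notation "A \ot B" := (tensop tens A B) (at level 39, left associativity).
Local Notation "x \tp y" := (tpure (tens _ F2) x y) (at level 39, left associativity).
Local Notation Gam := (symbol tens F2 Th).
Local Notation rR := (scaled_right_creation F2).
Hypothesis Th_ball : H2_unit_ball Th.
Hypothesis F0 : F [::] = bid E.
Hypothesis pos : forall r, 0 <= r < 1 -> forall f,
  hnorm (fh_eval tens Th (rR r) f) ^+ 2 <= redot (fh_eval tens F (rR r) f) f.

(** The damping factor: c < 1 keeps F(r c R) bounded uniformly as r -> 1, and c <> 0 lets the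
    weights be divided out at the end. *)
Let c : R := 2^-1.
Let c01 : 0 <= c < 1. Proof. by rewrite /c; apply/andP; split; lra. Qed.
Let c01' : 0 <= c <= 1. Proof. by rewrite /c; apply/andP; split; lra. Qed.
Let Lam K : bop (tens K F2) (tens K F2) := bid K \ot dilation F2 c.

Let Lam_adj K : hadj (Lam K) = Lam K.
Proof. by rewrite /Lam hadj_tensop hadj_id hadj_dilation. Qed.

Let Lam_pure (K : hilbertType R) (x : K) a : Lam K (x \tp e a) = (c ^+ size a)%:C *: (x \tp e a).
Proof. by rewrite tensopE dilationE // tpureZr. Qed.

Let pure_word (K : hilbertType R) (x : K) a : x \tp e a = (bid K \ot opword S_ a) (x \tp e [::]).
Proof. by rewrite tensopE opword_left cats0. Qed.

Let fh_word (E' Y' : hilbertType R) (G : free_holo n E' Y') r a f : 0 <= r < 1 ->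
  fh_eval tens G (rR r) ((bid E' \ot opword S_ a) f) =
  (bid Y' \ot opword S_ a) (fh_eval tens G (rR r) f).
Proof.
move=> r01; have h : forall i, opword S_ a \bo right_creation F2 i = right_creation F2 i \bo opword S_ a.
  by move=> i; rewrite (@opword_comm _ _ _ _ S_ S_ (right_creation F2 i)) // => j; rewrite creation_commute.
by have /(congr1 (fun T : bop (tens E' F2) (tens Y' F2) => T f)) := fh_right_left tens G r01 h; rewrite !bcompE.
Qed.

(* Z0 stands for Theta(R) Lam: Lam weights words of length k by c^k, which makes
   the unbounded kernel K bounded without losing its Toeplitz structure. *)
Let Z0 (p : E * seq 'I_n) : tens Y F2 :=
  (c ^+ size p.2)%:C *: (bid Y \ot opword S_ p.2) (Gam p.1).

Let ThL m : bop (tens E F2) (tens Y F2) := fh_eval tens Th (rR (near1 m)) \bo Lam E.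

Let ThL_cvg p : hcvg (fun m => ThL m (pure_fock tens F2 p)) (Z0 p).
Proof.
case: p => x a; rewrite /Z0 /pure_fock.
rewrite (_ : (fun _ => _) = fun m => (c ^+ size a)%:C *:
    (bid Y \ot opword S_ a) ((bid Y \ot dilation F2 (near1 m)) (Gam x))).
  by apply: hcvgZ; apply: bop_hcvg; exact: dilation_near1.
apply: funext => m; rewrite bcompE Lam_pure bopZr pure_word fh_word ?near1_bound //.
by rewrite fh_right_symbol ?near1_bound.
Qed.

Let FL_dot m f : redot (fh_eval tens F (rR (near1 m)) (Lam E f)) (Lam E f) =
  redot (fh_eval tens F (rR (near1 m * c)) (Lam E (Lam E f))) f.
Proof.
rewrite redotPr Lam_adj.
have /(congr1 (fun T : bop (tens E F2) (tens E F2) => T (Lam E f))) :=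
  fh_right_dilation tens F2 F (near1_bound m) c01'.
by rewrite !bcompE => ->.
Qed.

(* The hypothesis pos bounds Theta(r R) Lam uniformly in r, since
   Lam F(r R) Lam = F(r c R) Lam^2 and c < 1. *)
Let ThL_bnd : exists2 M, 0 <= M & forall m, bnd (ThL m) M.
Proof.
have [M M0 FM] := fh_eval_lim tens F (half01 R).
exists (Num.sqrt M); first exact: sqrtr_ge0.
move=> m f; rewrite -(@ler_pXn2r _ 2) ?nnegrE ?mulr_ge0 ?sqrtr_ge0 ?hnorm_ge0 //.
rewrite exprMn sqr_sqrtr // (le_trans (pos (near1_bound m) _)) // FL_dot.
have /andP[n0 n1] := @near1_le1 R m; have /andP[c0 _] := c01.
have nc : 0 <= near1 m * c <= 2^-1 by rewrite mulr_ge0 // ler_piMl.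
have [_ h] := FM F2 (rR (near1 m * c)) (colbnd_rightW nc).
rewrite (le_trans (cauchy_schwarz _ _)) // expr2 mulrA ler_wpM2r ?hnorm_ge0 //.
rewrite (le_trans (h _)) // ler_wpM2l //.
have L1 : bnd (Lam E) 1.
  by rewrite -[1]mulr1; apply: bnd_tensop => //; [exact: bnd_id|exact: bnd_dilation].
have := L1 (Lam E f); have := L1 f; rewrite !mul1r => h1 h2; exact: le_trans h2 h1.
Qed.

Let Z_exists : exists Z : bop (tens E F2) (tens Y F2),
  (forall p, Z (pure_fock tens F2 p) = Z0 p) /\ forall f, hcvg (fun m => ThL m f) (Z f).
Proof.
have [M M0 ThM] := ThL_bnd.
have [|Z _ ZE] := @extend_span _ _ _ (@pure_fock _ _ tens F2 E) _ Z0 M M0.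
  move=> s; have h := hcvg_lincomb s ThL_cvg.
  apply: (hcvg_bnd h) => m.
  by rewrite -bop_lincomb; exact: ThM.
exists Z; split => //; apply: (strong_total ThM (@total_pure_fock _ _ tens F2 E)) => p.
by rewrite ZE.
Qed.

Let SE i : bop (tens E F2) (tens E F2) := bid E \ot S_ i.
Let SY i : bop (tens Y F2) (tens Y F2) := bid Y \ot S_ i.
(** Stands for Lam F(R) Lam: moving one factor through F by the dilation rule gives F(c R) Lam^2,
    which is defined although F(R) is not. *)
Let B : bop (tens E F2) (tens E F2) := fh_eval tens F (rR c) \bo (Lam E \bo Lam E).

Let creation_dot K i j f g :
  hdot ((bid K \ot S_ i) f) ((bid K \ot S_ j) g) = (i == j)%:R * hdot f g.
Proof.
rewrite hadjPr hadj_tensop hadj_id -bcompE tensop_comp.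
rewrite left_creation_isom tensopZr bopZ.
rewrite (_ : bid K \bo bid K = bid K) ?tensop_id ?bidE; last by apply: bop_ext.
by rewrite hdotZl eq_sym.
Qed.

Let B_creation i f : B (SE i f) = (c ^+ 2)%:C *: SE i (B f).
Proof.
have LS g : Lam E (SE i g) = c%:C *: SE i (Lam E g).
  rewrite /Lam /SE -!bcompE !tensop_comp dilation_left // tensopZr bopZ.
  by rewrite -!tensop_comp.
rewrite !bcompE LS !bopZr LS !bopZr scalerA -rmorphM -expr2; congr (_ *: _).
have Si : S_ i = opword S_ [:: i] by apply: bop_ext.
by rewrite /SE Si fh_word.
Qed.

(** P is Re [B] - Z^* Z, the weighted kernel. Positivity is the limit of [pos] at vectors Lam f; the
    factor c^2 comes from one letter on each side; the last two clauses are the vacuum column, from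
    which the Toeplitz relation determines the rest. *)
Let toeplitz_psd : exists P : bop (tens E F2) (tens E F2),
  [/\ op_le 0 P,
   forall i j f g, hdot (P (SE i f)) (SE j g) = (c ^+ 2)%:C * ((i == j)%:R * hdot (P f) g),
   forall x y, hdot (P (x \tp e [::])) (y \tp e [::]) = hdot x y - hdot (Gam x) (Gam y) &
   forall x y a, a != [::] -> hdot (P (x \tp e [::])) (y \tp e (rev a)) =
     (c ^+ size a)%:C * (2^-1 * hdot (F a x) y - hdot (Gam x) ((bid Y \ot opword S_ (rev a)) (Gam y)))].
Proof.
have [Z [ZE Zc]] := Z_exists.
have ZS i f : Z (SE i f) = c%:C *: SY i (Z f).
  suff /(congr1 (fun T : bop (tens E F2) (tens Y F2) => T f)) : Z \bo SE i = c%:C *: (SY i \bo Z) by [].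
  apply: pure_fock_ext => x a; rewrite bopZ !bcompE /SE tensopE bidE left_creationE.
  rewrite (ZE (x, i :: a)) (ZE (x, a)) /Z0 bopZr scalerA -rmorphM -exprS; congr (_ *: _).
  have -> : SY i ((bid Y \ot opword S_ a) (Gam x)) = (SY i \bo (bid Y \ot opword S_ a)) (Gam x) by [].
  by rewrite /SY tensop_comp; congr ((_ \ot _) _); apply: bop_ext.
have Zvac x a : Z (x \tp e a) = (c ^+ size a)%:C *: (bid Y \ot opword S_ a) (Gam x).
  exact: (ZE (x, a)).
have Bdot x y a : hdot (B (x \tp e [::])) (y \tp e (rev a)) = (c ^+ size a)%:C * hdot (F a x) y.
  have Lv z : Lam E (z \tp e [::]) = z \tp e [::] by rewrite Lam_pure scale1r.
  by rewrite !bcompE !Lv (fh_right_coef tens F2 F x y a c01).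
(* For a nonempty word the image under [B] lies in the range of some I (x) S_i, orthogonal to the
   vacuum; hence only one half of the real part contributes, with factor 1/2. *)
have Badj x y a : a != [::] -> hdot (x \tp e [::]) (B (y \tp e (rev a))) = 0.
  move=> a0; rewrite !bcompE !(Lam_pure, bopZr, hdotZr) (pure_word y) fh_word //.
  case/lastP: a a0 => [//|a i] _; rewrite rev_rcons opwordS.
  rewrite (_ : bid E \ot (S_ i \bo opword S_ (rev a)) = SE i \bo (bid E \ot opword S_ (rev a))); last first.
    by rewrite tensop_comp; congr (_ \ot _); apply: bop_ext.
  by rewrite bcompE hadjPr hadj_tensop tensopE left_creation_adj tpure0r hdot0l !mulr0.
have half : (2^-1 : R[i]) = (2^-1 : R)%:C by rewrite fmorphV rmorph_nat.
have PE f g : hdot ((opRe B - hadj Z \bo Z) f) g =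
    2^-1 * (hdot (B f) g + hdot f (B g)) - hdot (Z f) (Z g).
  by rewrite bopB hdotBl bcompE -hadjPr /opRe bopZ hdotZl bopD hdotDl -(hadjPr B).
exists (opRe B - hadj Z \bo Z); split.
- apply/op_le_sub/op_le_opRe => f.
  have h1 : hnorm (ThL m f) ^+ 2 @[m --> \oo] --> hnorm (Z f) ^+ 2.
    by rewrite expr2; under eq_fun do rewrite expr2; apply: cvgM; exact: hcvg_norm.
  have h2 := @hcvg_redot _ _ _ _ f (fh_right_near1 F (Lam E (Lam E f)) c01).
  apply: (ler_cvg_to h1 h2); apply: nearW => m.
  by rewrite -FL_dot; apply: pos; exact: near1_bound.
- move=> i j f g; rewrite !PE !B_creation !ZS !hdotZl !hdotZr !creation_dot !conjc_realE.
  by rewrite expr2 rmorphM; ring.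
- move=> x y; rewrite PE.
  have B0 x' y' : hdot (B (x' \tp e [::])) (y' \tp e [::]) = hdot x' y'.
    by have := Bdot x' y' [::]; rewrite F0 mul1r.
  rewrite B0 (hdotC (B _)) B0 -hdotC !Zvac !expr0 !scale1r tensop_id !bidE.
  by field.
- move=> x y a a0; rewrite PE Bdot Badj // addr0 !Zvac hdotZr conjc_realE.
  rewrite size_rev expr0 scale1r tensop_id bidE; ring.
Qed.

(* For p the square root of Lam K Lam, W_i p f = c^-1 p S_i f defines a row
   contraction W, because p S_i f and p S_j g are orthogonal for i <> j; L_i is
   the adjoint of W_i. *)
Lemma toeplitz_dilation : exists (C : bop E (tens E F2)) (L : 'I_n -> bop (tens E F2) (tens E F2)),
  [/\ colbnd L 1,
   forall x y, hdot (C x) (C y) = hdot x y - hdot (Gam x) (Gam y) &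
   forall a x y, a != [::] -> hdot (opword L a (C x)) (C y) =
     2^-1 * hdot (F a x) y - hdot (opword (fun i => bid Y \ot hadj (S_ i)) a (Gam x)) (Gam y)].
Proof.
have [P [P0 PS Pvac Pword]] := toeplitz_psd.
have [p0 pp] := opsqrtP P0; set p := opsqrt P in p0 pp.
have pdot f g : hdot (p f) (p g) = hdot (P f) g.
  by rewrite (hadjPr p) (psd_adj p0) -bcompE pp.
have cn0 : c != 0 by rewrite invr_eq0.
(* The ranges of the I (x) S_i are mutually orthogonal copies of E (x) F^2 and serve as a direct
   sum: the vector p f in the i-th copy is sent to c^-1 p S_i f, isometrically by the Toeplitz
   relation. *)
have [|V V1 VE] := @extend_isometry _ _ _ _
    (fun q : 'I_n * tens E F2 => SE q.1 (p q.2)) (fun q => (c^-1)%:C *: p (SE q.1 q.2)).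
  move=> [i f] [j g] /=; rewrite creation_dot hdotZl hdotZr conjc_realE !pdot PS !mulrA.
  by rewrite -!rmorphM -mulrA -expr2 -exprMn mulVf // expr1n mul1r.
pose W i := V \bo SE i.
have WE i f : W i (p f) = (c^-1)%:C *: p (SE i f) by exact: (VE (i, f)).
have Ww a f : opword W a (p f) = (c^-1 ^+ size a)%:C *: p ((bid E \ot opword S_ a) f).
  elim: a => [|i a IH]; first by rewrite tensop_id !bidE scale1r.
  rewrite opwordS bcompE IH bopZr WE scalerA -rmorphM -exprSr; congr (_ *: p _).
  have -> : SE i ((bid E \ot opword S_ a) f) = (SE i \bo (bid E \ot opword S_ a)) f by [].
  by rewrite /SE tensop_comp; congr ((_ \ot _) _); apply: bop_ext.
pose C := p \bo tens_with tens E (e [::]).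
have CE x : C x = p (x \tp e [::]) by rewrite bcompE tens_withE.
exists C, (fun i => hadj (W i)); split.
- move=> z; have h := bnd_hadj ler01 V1 z.
  rewrite mul1r in h.
  apply: (@le_trans _ _ (hnorm (hadj V z) ^+ 2)); last first.
    by rewrite mul1r ler_pXn2r ?nnegrE ?hnorm_ge0.
  have SO i j : hadj (SE i) \bo SE j = (i == j)%:R *: bid (tens E F2).
    apply: bop_ext => f; apply: hdotI => g.
    rewrite bcompE -hadjP creation_dot bopZ hdotZr rmorph_nat.
    by case: (i == j); rewrite ?mul1r ?mul0r.
  have := isometry_row SO (hadj V z); rewrite mul1r.
  by under eq_bigr do rewrite -bcompE -hadj_comp.
- by move=> x y; rewrite !CE pdot Pvac.
(* A word in the adjoints is the adjoint of the reversed word in W, whose factor c^-|a| cancels the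
   weight c^|a| in P. *)
move=> a x y a0; rewrite (@opword_adj _ _ _ W) -hadjPr !CE Ww hdotZr conjc_realE pdot.
rewrite -pure_word Pword // mulrA -rmorphM size_rev -exprMn mulVf // expr1n mul1r.
congr (_ - _); rewrite opword_tensr opword_adj -[in LHS](hadjK (bid Y \ot _)) hadj_tensop hadj_id.
by rewrite -hadjP.
Qed.

End ToeplitzDilation.

(** * Transfer functions *)

Section Schur.
Context {R : realType} {K D : hilbertType R} (U : bop D K) (T : bop K K) (rho : R).
Hypothesis U_isom : hadj U \bo U = bid D.
Hypothesis rho01 : 0 <= rho < 1.
Hypothesis T_bnd : bnd T rho.

Let Q := bid K - U \bo hadj U.
(** First-return operator of T to the range of U: in the expansion of the resolvent of Q T, all
    intermediate steps are projected off that range. *)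
Definition schur := hadj U \bo T \bo opinv (bid K - Q \bo T) \bo U.

Let UU x : hadj U (U x) = x.
Proof. by rewrite -bcompE U_isom. Qed.

Let QE z : Q z = z - U (hadj U z). Proof. by []. Qed.

Let UQ z : hadj U (Q z) = 0.
Proof. by rewrite QE bopBr UU subrr. Qed.

Let decomp z : hnorm z ^+ 2 = hnorm (hadj U z) ^+ 2 + hnorm (Q z) ^+ 2.
Proof.
rewrite -{1}(subrK (U (hadj U z)) z) -QE hnormD2 redotPr UQ redot0l mulr0 addr0 addrC.
by rewrite -[hnorm (U _) ^+ 2]redotxx redotPr UU redotxx.
Qed.

Lemma bnd_complement : bnd Q 1.
Proof.
move=> z; rewrite mul1r -(@ler_pXn2r _ 2) ?nnegrE ?hnorm_ge0 // [X in _ <= X]decomp lerDr.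
by rewrite sqr_ge0.
Qed.

Lemma bnd_compression : bnd (Q \bo T) rho.
Proof.
by move=> z; apply: le_trans (T_bnd z); have := bnd_complement (T z); rewrite mul1r.
Qed.

(* y = (I - Q T)^-1 U x splits orthogonally as U x + Q T y, so that
   |schur x|^2 = |T y|^2 - |Q T y|^2 <= rho^2 (|x|^2 + |Q T y|^2) - |Q T y|^2. *)
Lemma bnd_schur : bnd schur rho.
Proof.
move=> x; have [h1 _ _] := opinv_neumann rho01 bnd_compression.
have /andP[r0 r1] := rho01.
set y := opinv (bid K - Q \bo T) (U x).
have -> : schur x = hadj U (T y) by [].
have yE : y = U x + Q (T y).
  have /(congr1 (fun S : bop K K => S (U x))) := h1.
  rewrite bcompE bopB bcompE !bidE -/y => /esym ->.
  by rewrite subrK.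
have e1 : hnorm y ^+ 2 = hnorm x ^+ 2 + hnorm (Q (T y)) ^+ 2.
  rewrite {1}yE hnormD2 redotP UQ redot0r mulr0 addr0.
  by rewrite -[hnorm (U _) ^+ 2]redotxx redotPr UU redotxx.
have e2 := decomp (T y).
have e3 : hnorm (T y) ^+ 2 <= rho ^+ 2 * hnorm y ^+ 2.
  by rewrite -exprMn ler_pXn2r ?nnegrE ?mulr_ge0 ?hnorm_ge0.
rewrite -(@ler_pXn2r _ 2) ?nnegrE ?mulr_ge0 ?hnorm_ge0 // exprMn.
have r2 : rho ^+ 2 <= 1 by rewrite expr_le1 // ltW.
have := sqr_ge0 (hnorm (Q (T y))); nra.
Qed.

(** A renewal identity. With y the resolvent of Q T at U x, one has (I - T) y = U (x - schur x) and
    U^* y = x. Conversely v = (I - T)^-1 U x satisfies (I - Q T) v = U U^* v, so schur maps U^* v to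
    U^* T v. *)
Lemma schur_inv : opinv (bid D - schur) = hadj U \bo opinv (bid K - T) \bo U.
Proof.
have [A1 A2 _] := opinv_neumann rho01 bnd_compression.
have [N1 N2 _] := opinv_neumann rho01 T_bnd.
apply: opinvE; apply: bop_ext => x; rewrite bidE.
  set y := opinv (bid K - Q \bo T) (U x).
  have yE : y - Q (T y) = U x by have /(congr1 (fun S : bop K K => S (U x))) := A1.
  have -> : (hadj U \bo opinv (bid K - T) \bo U \bo (bid D - schur)) x =
      hadj U (opinv (bid K - T) (U (x - hadj U (T y)))) by [].
  have -> : U (x - hadj U (T y)) = (bid K - T) y.
    by rewrite bopBr -yE QE opprB addrA addrAC addrK.
  have -> : opinv (bid K - T) ((bid K - T) y) = y.
    by have /(congr1 (fun S : bop K K => S y)) := N2.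
  by rewrite -(subrK (Q (T y)) y) bopDr UQ addr0 yE UU.
set v := opinv (bid K - T) (U x).
have vE : v - T v = U x by have /(congr1 (fun S : bop K K => S (U x))) := N1.
have -> : ((bid D - schur) \bo (hadj U \bo opinv (bid K - T) \bo U)) x =
    hadj U v - hadj U (T (opinv (bid K - Q \bo T) (U (hadj U v)))) by [].
have -> : U (hadj U v) = (bid K - Q \bo T) v.
  have -> : (bid K - Q \bo T) v = v - (T v - U (hadj U (T v))) by [].
  have Uv : hadj U v = x + hadj U (T v) by rewrite -{1}(subrK (T v) v) vE bopDr UU.
  by rewrite Uv bopDr -vE opprB -addrA (addrC (- T v)).
have -> : opinv (bid K - Q \bo T) ((bid K - Q \bo T) v) = v.
  by have /(congr1 (fun S : bop K K => S v)) := A2.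
by rewrite -bopBr vE UU.
Qed.

End Schur.

Section Realization.
Context {R : realType} {n : nat} (tens : tensor_product R).
Local Notation "A \ot B" := (tensop tens A B) (at level 39, left associativity).

Lemma oppow_tensop (K L : hilbertType R) (A : 'I_n -> bop K K) (X : 'I_n -> bop L L) k :
  oppow (\sum_i A i \ot X i) k = \sum_(a : k.-tuple 'I_n) (opword A a \ot opword X a).
Proof.
elim: k => [|k IH].
  by rewrite (sum_tuple0 (fun a => opword A a \ot opword X a)) /= tensop_id.
rewrite (sum_tupleS k (fun a => opword A a \ot opword X a)).
apply: bop_ext => z; rewrite oppowS IH !bop_sum; apply: eq_bigr => i _.
rewrite bop_sumr bop_sum; apply: eq_bigr => a _.
by rewrite -bcompE tensop_comp.
Qed.

(** Coefficients B A_a C turn the sum over words of length k into the k-th power of one operator, so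
    a power series becomes a Neumann series. *)
Lemma realize_term (K E Y L : hilbertType R) (A : 'I_n -> bop K K) (B : bop K Y) (C : bop E K)
    (F : seq 'I_n -> bop E Y) (X : 'I_n -> bop L L) k :
  (forall a, size a = k -> F a = B \bo opword A a \bo C) ->
  fh_term tens F X k = B \ot bid L \bo oppow (\sum_i A i \ot X i) k \bo C \ot bid L.
Proof.
move=> FE; rewrite oppow_tensop; apply: bop_ext => z.
rewrite !bcompE !bop_sum bop_sumr; apply: eq_bigr => a _.
by rewrite -!bcompE !tensop_comp FE ?size_tuple.
Qed.

End Realization.

(** * The defect operator and the kernel W *)

Section Defect.
Context {R : realType} {E K : hilbertType R} (Gam : bop E K).
Hypothesis Gam1 : bnd Gam 1.

Let defectP : op_le 0 (defect Gam) /\ defect Gam \bo defect Gam = bid E - hadj Gam \bo Gam.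
Proof.
apply: opsqrtP; apply/psdP; split; first by rewrite hadjB hadj_id hadj_comp hadjK.
move=> x; rewrite bopB bidE redotBl redotxx bcompE -redotPr redotxx subr_ge0.
by rewrite ler_pXn2r ?nnegrE ?hnorm_ge0 //; have := Gam1 x; rewrite mul1r.
Qed.

Lemma defect_adj : hadj (defect_to Gam) = defect_from Gam.
Proof.
apply: hadj_eq => x u; have [D0 _] := defectP.
have -> : hdot (defect_to Gam x) u = hdot (defect Gam x) (val u) by [].
by rewrite hadjP psd_adj.
Qed.

Lemma defect_dot x y :
  hdot (defect_to Gam x) (defect_to Gam y) = hdot x y - hdot (Gam x) (Gam y).
Proof.
have [D0 DD] := defectP.
have -> : hdot (defect_to Gam x) (defect_to Gam y) = hdot (defect Gam x) (defect Gam y) by [].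
by rewrite (hadjPr (defect Gam)) psd_adj // -bcompE DD bopB hdotBl bcompE -hadjPr.
Qed.

Lemma total_defect : total (defect_to Gam).
Proof.
move=> u hu; apply: val_inj.
have clu : closure (range (defect Gam)) (val u) by have /asboolP := cs_valP u.
apply: (closure_orth clu) => _ [x _ <-].
exact: hu.
Qed.

End Defect.

Section Kernel.
Context {R : realType} {n : nat} (tens : tensor_product R) (F2 : fock_space R n).
Context {E Y : hilbertType R}.
Local Notation e := (fock_e F2).
Local Notation S_ := (left_creation F2).
Local Notation "A \ot B" := (tensop tens A B) (at level 39, left associativity).
Local Notation "x \tp y" := (tpure (tens _ F2) x y) (at level 39, left associativity).

(** Here the backward shifts, which delete a first letter; in the Toeplitz dilation the same name
    denotes the creation operators. *)
Let SY i : bop (tens Y F2) (tens Y F2) := bid Y \ot hadj (S_ i).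

Lemma transferE (L : hilbertType R) (X : 'I_n -> bop L L) :
  transfer tens F2 Y X = \sum_i SY i \ot X i.
Proof. by []. Qed.

Lemma colbnd_left_adj : colbnd SY 1.
Proof. exact: colbnd_tensr (isometry_row (left_creation_isom F2)). Qed.

Lemma bnd_transfer (L : hilbertType R) (X : 'I_n -> bop L L) r : 0 < r ->
  colbnd (fun i => hadj (X i)) (r ^+ 2) -> bnd (transfer tens F2 Y X) r.
Proof.
move=> r0 Xr; rewrite -[r]mulr1; apply: bnd_sum_tensop => //.
by rewrite expr1n; exact: colbnd_left_adj.
Qed.

Lemma symbol_kernelE (L : hilbertType R) (Gam : bop E (tens Y F2)) (X : 'I_n -> bop L L) r z :
  0 < r < 1 -> colbnd (fun i => hadj (X i)) (r ^+ 2) ->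
  let v := opinv (bid _ - transfer tens F2 Y X) ((Gam \ot bid L) z) in
  v - transfer tens F2 Y X v = (Gam \ot bid L) z /\
  symbol_kernel Gam X z = (hadj Gam \ot bid L) (v + transfer tens F2 Y X v).
Proof.
move=> /andP[r0 r1] Xr v; have r01 : 0 <= r < 1 by rewrite ltW.
have [N1 _ _] := opinv_neumann r01 (bnd_transfer r0 Xr).
split; last by [].
by have /(congr1 (fun S : bop (tens (tens Y F2) L) (tens (tens Y F2) L) => S ((Gam \ot bid L) z))) := N1.
Qed.

(** The decomposition of the identity of the Fock space into the ranges of the S_i and the vacuum
    line, tensored with Y. *)
Lemma fock_split (v : tens Y F2) :
  \sum_i hadj (SY i) (SY i v) + tens_with tens Y (e [::]) (hadj (tens_with tens Y (e [::])) v) = v.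
Proof.
suff /(congr1 (fun T : bop (tens Y F2) (tens Y F2) => T v)) :
   \sum_i hadj (SY i) \bo SY i +
   tens_with tens Y (e [::]) \bo hadj (tens_with tens Y (e [::])) = bid (tens Y F2).
  by rewrite bopD bop_sum.
apply: pure_fock_ext => y a; rewrite bopD bop_sum bcompE tens_with_adj tens_withE bidE.
have SE i : (hadj (SY i) \bo SY i) (y \tp e a) =
    if a is j :: b then (i == j)%:R *: (y \tp e a) else 0.
  rewrite bcompE /SY hadj_tensop hadj_id hadjK tensopE left_creation_adj.
  case: a => [|j a]; first by rewrite tensopE bop0r tpure0r.
  rewrite tensopE bopZr left_creationE tpureZr bidE.
  by case: eqP => [->//|_]; rewrite !scale0r.
rewrite (eq_bigr _ (fun i _ => SE i)); case: a {SE} => [|j a].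
  by rewrite eqxx big1 ?add0r.
rewrite tpure0l addr0 (bigD1 j) //= eqxx scale1r big1 ?addr0 // => i /negbTE ->.
by rewrite scale0r.
Qed.

Section Realize.
Context (Th : free_holo n E Y) (Th_ball : H2_unit_ball Th).
Local Notation Gam := (symbol tens F2 Th).
Local Notation E0 := (hadj (tens_with tens Y (e [::]))).

(** Backward shifts along a form the adjoint of creation by the reversed word, which is exactly
    where the symbol stores the coefficient of a. *)
Lemma symbol_realize a : Th a = E0 \bo opword SY a \bo Gam.
Proof.
apply: bop_ext => x; apply: hdotI => y.
rewrite !bcompE [in RHS]hdotC -hadjPr tens_withE opword_tensr opword_adj.
have -> : bid Y \ot hadj (opword S_ (rev a)) = hadj (bid Y \ot opword S_ (rev a)).
  by rewrite hadj_tensop hadj_id.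
rewrite -hadjPr tensopE opword_left cats0.
by rewrite symbol_coef // revK -hdotC.
Qed.

Lemma fh_eval_symbol (L : hilbertType R) (X : 'I_n -> bop L L) r z :
  0 < r < 1 -> colbnd (fun i => hadj (X i)) (r ^+ 2) ->
  fh_eval tens Th X z =
  (E0 \ot bid L) (opinv (bid _ - transfer tens F2 Y X) ((Gam \ot bid L) z)).
Proof.
move=> r01 Xr; have /andP[r0 r1] := r01; have r01' : 0 <= r < 1 by rewrite ltW.
have [_ _ Nc] := opinv_neumann r01' (bnd_transfer r0 Xr).
apply: (hcvg_unique (fh_eval_hcvg Th z r01 Xr)).
have := bop_hcvg (E0 \ot bid L) (opcvg_hcvg ((Gam \ot bid L) z) Nc).
congr hcvg; apply: funext => N; rewrite bop_sum bop_sumr; apply: eq_bigr => k _.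
by rewrite (realize_term tens X (k := k) (fun a _ => symbol_realize a)).
Qed.

(** For v = (I - T)^-1 (Gamma (x) I) z the form of W at z collapses to |v|^2 - |T v|^2. The vacuum
    component of v is Theta(X) z, and T v is controlled by the remaining components. *)
Lemma kernel_ge (L : hilbertType R) (X : 'I_n -> bop L L) r z :
  0 < r < 1 -> colbnd (fun i => hadj (X i)) (r ^+ 2) ->
  hnorm (fh_eval tens Th X z) ^+ 2 <= redot (symbol_kernel Gam X z) z.
Proof.
move=> r01 Xr; have [vE ->] := symbol_kernelE Gam z r01 Xr.
rewrite (fh_eval_symbol z r01 Xr).
set v := opinv _ _ in vE *; set T := transfer tens F2 Y X in vE *.
have -> : hadj Gam \ot bid L = hadj (Gam \ot bid L) by rewrite hadj_tensop hadj_id.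
rewrite -redotPr -vE redotDl !redotBr !redotxx (redotC (T v)).
have -> : hnorm v ^+ 2 - redot v (T v) + (redot v (T v) - hnorm (T v) ^+ 2) =
  hnorm v ^+ 2 - hnorm (T v) ^+ 2 by ring.
have split_v : hnorm v ^+ 2 = \sum_i hnorm ((SY i \ot bid L) v) ^+ 2 + hnorm ((E0 \ot bid L) v) ^+ 2.
  have id_v : \sum_i hadj (SY i \ot bid L) \bo (SY i \ot bid L) +
      hadj (E0 \ot bid L) \bo (E0 \ot bid L) = bid _.
    rewrite -tensop_id hadj_tensop hadj_id tensop_comp.
    under eq_bigr do rewrite hadj_tensop hadj_id tensop_comp.
    rewrite -tensop_suml.
    rewrite (_ : bid L \bo bid L = bid L); last by apply: bop_ext.
    rewrite -tensopDl; congr (_ \ot _); apply: bop_ext => w.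
    by rewrite bopD bop_sum bcompE hadjK -[RHS](fock_split w).
  have /(congr1 (fun S : bop (tens (tens Y F2) L) (tens (tens Y F2) L) => redot (S v) v)) := id_v.
  rewrite bidE redotxx => <-; rewrite bopD redotDl -colbnd_sum; congr (_ + _).
  by rewrite bcompE -redotPr redotxx.
have Tv : hnorm (T v) ^+ 2 <= \sum_i hnorm ((SY i \ot bid L) v) ^+ 2.
  have /andP[r0 r1] := r01.
  have -> : T v = \sum_i (bid (tens Y F2) \ot X i) ((SY i \ot bid L) v).
    by rewrite /T transferE bop_sum; apply: eq_bigr => i _; rewrite -bcompE tensop_comp.
  have XC : colbnd (fun i => hadj (bid (tens Y F2) \ot X i)) (r ^+ 2).
    move=> w; under eq_bigr do rewrite hadj_tensop hadj_id.
    by apply: colbnd_tensr => //; rewrite sqr_ge0.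
  apply: (le_trans (row_sum _ r0 XC)).
  apply: ler_piMl; first by rewrite sumr_ge0 // => i _; rewrite sqr_ge0.
  by rewrite expr_le1 ?ltW.
by rewrite split_v; lra.
Qed.

End Realize.

End Kernel.

Lemma colbnd_opword (R : realType) (n : nat) (V : hilbertType R) (A : 'I_n -> bop V V) k :
  colbnd A 1 -> colbnd (fun a : k.-tuple 'I_n => opword A a) 1.
Proof.
move=> A1; elim: k => [|k IH] x.
  by rewrite (sum_tuple0 (fun a => hnorm (opword A a x) ^+ 2)) /= mul1r.
rewrite (sum_tupleS k (fun a => hnorm (opword A a x) ^+ 2)) exchange_big /=.
apply: le_trans (IH x); apply: ler_sum => a _.
have := A1 (opword A a x); rewrite mul1r; apply: le_trans.
by apply: ler_sum => i _.
Qed.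

(** * Construction of G from the positivity condition *)

Section Forward.
Context {R : realType} {n : nat} (tens : tensor_product R) (F2 : fock_space R n).
Context {E Y : hilbertType R} (Th : free_holo n E Y) (F : free_holo n E E).
Local Notation e := (fock_e F2).
Local Notation S_ := (left_creation F2).
Local Notation "A \ot B" := (tensop tens A B) (at level 39, left associativity).
Local Notation Gam := (symbol tens F2 Th).
Local Notation rR := (scaled_right_creation F2).
Local Notation Dt := (defect_to Gam).
Local Notation Df := (defect_from Gam).
Hypothesis Th_ball : H2_unit_ball Th.
Hypothesis F0 : F [::] = bid E.
Hypothesis pos : forall r, 0 <= r < 1 -> forall f,
  hnorm (fh_eval tens Th (rR r) f) ^+ 2 <= redot (fh_eval tens F (rR r) f) f.

Let SY i : bop (tens Y F2) (tens Y F2) := bid Y \ot hadj (S_ i).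

(** A single coefficient family serves all spaces L and tuples X: evaluated at X it becomes the
    first-return operator of T = sum A_i (x) X_i to the range of U (x) I. *)
Lemma herglotz_schur : exists2 G : free_holo n (defect_space Gam) (defect_space Gam),
  G [::] = 0 & forall (L : hilbertType R) (X : 'I_n -> bop L L) r,
    0 < r < 1 -> colbnd (fun i => hadj (X i)) (r ^+ 2) ->
    bnd (fh_eval tens G X) r /\
    fh_eval tens F X = symbol_kernel Gam X
      + Df \ot bid L \bo (bid _ + fh_eval tens G X)
          \bo opinv (bid _ - fh_eval tens G X) \bo Dt \ot bid L.
Proof.
have [C [A [A1 Cdot Cword]]] := toeplitz_dilation Th_ball F0 pos.
have [Gam1 _] := symbolP tens F2 Th_ball.
have tD : total Dt by exact: total_defect.
have [|U U1 UE] := @extend_isometry _ _ _ _ Dt C.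
  by move=> x y; rewrite defect_dot // Cdot.
have CE : C = U \bo Dt by apply: bop_ext => x; rewrite bcompE UE.
have U_isom : hadj U \bo U = bid _.
  apply: (total_ext tD) => x; apply: (total_dot tD) => y.
  by rewrite bcompE -hadjP !UE Cdot defect_dot.
pose Q := bid (tens E F2) - U \bo hadj U.
pose QA i := Q \bo A i.
(* The coefficients of U^* T (I - Q T)^-1 U: one letter for the outer T, the remaining ones for
   powers of Q T. *)
pose Gc (a : seq 'I_n) := if a is i :: b then hadj U \bo A i \bo opword QA b \bo U else 0.
have Q1 : bnd Q 1.
  exact: (bnd_complement U_isom).
have QA1 : colbnd QA 1.
  move=> x; apply: le_trans (A1 x); apply: ler_sum => i _.
  rewrite ler_pXn2r ?nnegrE ?hnorm_ge0 //.
  by have := Q1 (A i x); rewrite mul1r.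
have Gc1 k : colbnd (fun a : k.-tuple 'I_n => Gc a) 1.
  case: k => [|k] x; rewrite mul1r.
    by rewrite (sum_tuple0 (fun a => hnorm (Gc a x) ^+ 2)) /= hnorm0 expr0n sqr_ge0.
  rewrite (sum_tupleS k (fun a => hnorm (Gc a x) ^+ 2)) exchange_big /=.
  have Ux : hnorm (U x) ^+ 2 <= hnorm x ^+ 2.
    by rewrite ler_pXn2r ?nnegrE ?hnorm_ge0 //; have := U1 x; rewrite mul1r.
  apply: le_trans Ux; have := colbnd_opword k QA1 (U x); rewrite mul1r.
  apply: le_trans; apply: ler_sum => a _.
  have := A1 (opword QA a (U x)); rewrite mul1r; apply: le_trans.
  apply: ler_sum => i _; rewrite ler_pXn2r ?nnegrE ?hnorm_ge0 //.
  by have := bnd_hadj ler01 U1 (A i (opword QA a (U x))); rewrite mul1r.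
pose G := FreeHolo (radius_le1 Gc1).
exists G => // L X r r01 Xr; have /andP[r0 r1] := r01.
have r01' : 0 <= r < 1 by rewrite ltW.
pose T := \sum_i A i \ot X i.
have Tr : bnd T r.
  by rewrite -[r]mulr1; apply: bnd_sum_tensop; rewrite ?expr1n.
pose U' := U \ot bid L.
have LL : bid L \bo bid L = bid L by apply: bop_ext.
have U'_isom : hadj U' \bo U' = bid _.
  by rewrite hadj_tensop hadj_id tensop_comp U_isom LL tensop_id.
pose Q' := bid (tens (tens E F2) L) - U' \bo hadj U'.
have QE : Q \ot bid L = Q'.
  by rewrite /Q tensopBl tensop_id /Q' hadj_tensop hadj_id tensop_comp LL.
have QT : Q' \bo T = \sum_i QA i \ot X i.
  apply: bop_ext => z; rewrite bcompE -QE !bop_sum bop_sumr; apply: eq_bigr => i _.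
  by rewrite -bcompE tensop_comp.
have GX : fh_eval tens G X = schur U' T.
  have [_ _ Ac] := opinv_neumann r01' (bnd_compression U'_isom Tr).
  (* The shift drops the zero term of degree 0: degree k + 1 of G matches the k-th power of Q T. *)
  apply: bop_ext => z; apply: (hcvg_unique (hcvg_shift (fh_eval_hcvg G z r01 Xr))).
  have := bop_hcvg (hadj U' \bo T) (opcvg_hcvg (U' z) Ac).
  congr hcvg; apply: funext => N.
  rewrite big_ord_recl fh_term0 tensop0l add0r bop_sum bop_sumr; apply: eq_bigr => k _.
  rewrite lift0 fh_termS QT oppow_tensop !bcompE !bop_sum bop_sumr; apply: eq_bigr => i _.
  rewrite !bop_sum !bop_sumr; apply: eq_bigr => a _.
  by rewrite /U' hadj_tensop hadj_id -!bcompE !tensop_comp.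
have Gb := bnd_schur U'_isom r01' Tr.
rewrite GX; split => //.
pose FA (a : seq 'I_n) := Df \bo hadj U \bo opword A a \bo C.
pose FS (a : seq 'I_n) := hadj Gam \bo opword SY a \bo Gam.
have Fa a : a != [::] -> F a = 2 *: (FA a + FS a).
  move=> a0; apply: bop_ext => x; apply: hdotI => y.
  rewrite hdotC [RHS]hdotC bopZ hdotZl bopD hdotDl; congr (Num.conj _).
  have -> : hdot (FA a x) y = hdot (opword A a (C x)) (C y).
    by rewrite /FA -defect_adj // !bcompE -!hadjPr CE.
  rewrite Cword // /FS !bcompE -hadjPr subrK mulrA mulfV ?mul1r //.
have FA2 : FA [::] + FS [::] = bid E.
  apply: bop_ext => x; apply: hdotI => y; rewrite bopD hdotDr.
  have -> : FA [::] x = hadj Dt (hadj U (C x)) by rewrite defect_adj.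
  have -> : FS [::] x = hadj Gam (Gam x) by [].
  by rewrite -!hadjP UE Cdot subrK.
(* In degree 0 the two families add up to I, so twice their sum exceeds F(0) = I by one identity,
   subtracted here. *)
have tF k : fh_term tens F X k =
    2 *: (fh_term tens FA X k + fh_term tens FS X k) - (k == 0%N)%:R *: bid _.
  case: k => [|k].
    rewrite !fh_term0 -tensopDl FA2 F0 !tensop_id scale1r scaler_nat mulr2n addrK //.
  rewrite scale0r subr0 /fh_term -big_split /= scaler_sumr; apply: eq_bigr => a _.
  rewrite Fa; last by case: a => -[].
  by rewrite tensopZl tensopDl.
have [_ _ Tc] := opinv_neumann r01' Tr.
have Sr : bnd (transfer tens F2 Y X) r by exact: bnd_transfer.
have [_ _ Sc] := opinv_neumann r01' Sr.
apply: bop_ext => z.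
pose NT := opinv (bid _ - T) ((C \ot bid L) z).
pose NS := opinv (bid _ - transfer tens F2 Y X) ((Gam \ot bid L) z).
have FX : fh_eval tens F X z = 2 *: (((Df \bo hadj U) \ot bid L) NT + (hadj Gam \ot bid L) NS) - z.
  (* Shifted because the correction -z arrives with the term of degree 0 and is missing from the
     empty sum. *)
  apply: (hcvg_unique (hcvg_shift (fh_eval_hcvg F z r01 Xr))).
  have h1 := bop_hcvg ((Df \bo hadj U) \ot bid L) (opcvg_hcvg ((C \ot bid L) z) Tc).
  have h2 := bop_hcvg (hadj Gam \ot bid L) (opcvg_hcvg ((Gam \ot bid L) z) Sc).
  have := hcvg_shift (hcvgD (hcvgZ 2 (hcvgD h1 h2)) (hcvg_cst (- z))).
  congr hcvg; apply: funext => N; apply/esym.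
  under eq_bigr do rewrite tF bopB !bopZ bopD.
  rewrite sumrB; congr (_ - _); last first.
    by rewrite big_ord_recl scale1r big1 ?addr0 // => k _; rewrite scale0r.
  rewrite -scaler_sumr big_split !bop_sum !bop_sumr; congr (_ *: (_ + _)); apply: eq_bigr => k _.
    by rewrite (realize_term tens X (k := k) (F := FA) (fun a _ => erefl)).
  by rewrite (realize_term tens X (k := k) (F := FS) (fun a _ => erefl)).
rewrite FX bopD.
have [vE ->] := symbol_kernelE Gam z r01 Xr.
rewrite -/NS in vE *.
have -> : NS + transfer tens F2 Y X NS = 2 *: NS - (Gam \ot bid L) z.
  by rewrite -vE scaler_nat mulr2n opprB addrA addrAC addrK.
have [I1 _ _] := opinv_neumann r01' Gb.
pose w := opinv (bid _ - schur U' T) ((Dt \ot bid L) z).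
have wE : w - schur U' T w = (Dt \ot bid L) z.
  by have /(congr1 (fun S : bop _ _ => S ((Dt \ot bid L) z))) := I1.
have wN : w = hadj U' NT.
  rewrite /w (schur_inv U'_isom r01' Tr) /NT.
  have -> : (C \ot bid L) z = U' ((Dt \ot bid L) z) by rewrite -bcompE tensop_comp LL -CE.
  by [].
rewrite [in RHS]bcompE [in RHS]bcompE [in RHS]bcompE -/w.
have -> : (bid _ + schur U' T) w = 2 *: w - (Dt \ot bid L) z.
  have -> : (bid _ + schur U' T) w = w + schur U' T w by [].
  by rewrite -wE scaler_nat mulr2n opprB addrA addrAC addrK.
rewrite !bopBr !bopZr.
(* Gamma^* Gamma + D^2 = I distributes the single -z between W and the Cayley transform of G, each
   of the form 2 (I - A)^-1 - I. *)
have zE : (hadj Gam \ot bid L) ((Gam \ot bid L) z) + (Df \ot bid L) ((Dt \ot bid L) z) = z.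
  rewrite -!bcompE !tensop_comp LL -bopD -tensopDl.
  suff -> : hadj Gam \bo Gam + Df \bo Dt = bid E by rewrite tensop_id.
  apply: bop_ext => x; apply: hdotI => y; rewrite bopD hdotDr !bcompE -defect_adj // -!hadjP defect_dot //.
  by rewrite addrC subrK.
set g0 := (hadj Gam \ot bid L) _ in zE *; set d0 := (Df \ot bid L) ((Dt \ot bid L) z) in zE *.
rewrite -zE scalerDr (addrC (2 *: _)) opprD addrACA; congr (_ + (_ - _)).
rewrite wN /U' hadj_tensop hadj_id; congr (_ *: _).
by rewrite -bcompE tensop_comp LL.
Qed.

End Forward.

Lemma inverse_unique (R : realType) (K : hilbertType R) (S B B' : bop K K) :
  S \bo B = bid K -> B' \bo S = bid K -> B = B'.
Proof.
move=> SB B'S; apply: bop_ext => x.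
have /(congr1 (fun T : bop K K => T (B x))) := B'S; rewrite bcompE bidE => <-.
by have /(congr1 (fun T : bop K K => T x)) := SB; rewrite bcompE bidE => ->.
Qed.

(** * Embedding of the Fock space *)

Section Embedding.
Context {R : realType} {H : hilbertType R}.
Hypothesis H_infinite : infinite_dimensional H.

Let orthonormal (s : seq H) := forall i j, (i < size s)%N -> (j < size s)%N ->
  hdot s`_i s`_j = (i == j)%:R.

Let gram_schmidt s : orthonormal s -> exists v, orthonormal (rcons s v).
Proof.
move=> so; have [x xs] := H_infinite s.
pose y := x - \sum_(i < size s) hdot x s`_i *: s`_i.
have y0 : hnorm y != 0.
  apply/eqP => /hnorm_eq0/eqP; rewrite subr_eq0 => /eqP.
  exact: (xs (fun i => hdot x s`_i)).
have sy j : (j < size s)%N -> hdot s`_j y = 0.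
  move=> js; rewrite hdotBr hdot_sumr (bigD1 (Ordinal js)) //= big1 => [|i ij].
    by rewrite addr0 hdotZr so // eqxx mulr1 -hdotC subrr.
  rewrite hdotZr so //; case: eqP => [ji|_]; last by rewrite mulr0.
  by case/eqP: ij; apply: val_inj.
pose v := (hnorm y)^-1%:C *: y.
have sv j : (j < size s)%N -> hdot s`_j v = 0 by move=> js; rewrite hdotZr sy // mulr0.
have vv : hdot v v = 1.
  rewrite hdotZl hdotZr conjc_realE hdotxx -!rmorphM.
  by rewrite (_ : _ * _ = 1) //; field.
exists v => i j; rewrite size_rcons !ltnS !nth_rcons => iS jS.
case: ltngtP iS => // [il|ie] _; case: ltngtP jS => // [jl|je] _.
- exact: so.
- by rewrite sv // ltn_eqF // je.
- by rewrite hdotC sv // rmorph0 gtn_eqF // ie.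
- by rewrite vv ie je eqxx.
Qed.

Lemma orthonormal_sequence : exists u : nat -> H, forall i j, hdot (u i) (u j) = (i == j)%:R.
Proof.
(* Choice needs an extension for every list; lists that are not orthonormal receive 0. *)
have /choice[f fP] : forall s, exists v, orthonormal s -> orthonormal (rcons s v).
  move=> s; have [/gram_schmidt[v vP]|ns] := pselect (orthonormal s); first by exists v.
  by exists 0.
pose b k := iter k (fun s => rcons s (f s)) [::].
have bS k : b k.+1 = rcons (b k) (f (b k)) by [].
have bo k : orthonormal (b k).
  by elim: k => [|k IH]; [move=> i j|exact: fP].
have bsz k : size (b k) = k by elim: k => // k IH; rewrite bS size_rcons IH.
have bn m i : (i < m)%N -> (b m)`_i = (b i.+1)`_i.
  elim: m => // m IH; rewrite ltnS leq_eqVlt => /orP[/eqP -> //|im].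
  by rewrite bS nth_rcons bsz im IH.
exists (fun i => (b i.+1)`_i) => i j.
rewrite -(bn (maxn i j).+1 i) ?ltnS ?leq_maxl // -(bn (maxn i j).+1 j) ?ltnS ?leq_maxr //.
by rewrite bo // bsz ltnS ?leq_maxl ?leq_maxr.
Qed.

(** Words form a countable type, so [pickle] places the Fock basis along an orthonormal sequence of
    H. *)
Lemma fock_embedding n (F2 : fock_space R n) :
  exists2 V : bop F2 H, bnd V 1 & hadj V \bo V = bid F2.
Proof.
have [u uo] := orthonormal_sequence.
have [|V V1 VE] := @extend_isometry _ _ _ _ (fock_e F2) (fun a => u (pickle a)).
  by move=> a b; rewrite fock_e_orthonormal uo (inj_eq (pcan_inj pickleK)).
have tf : total (fock_e F2) by exact: total_fock.
exists V => //; apply: (total_ext tf) => a; apply: (total_dot tf) => b.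
by rewrite bcompE -hadjP !VE uo fock_e_orthonormal (inj_eq (pcan_inj pickleK)).
Qed.

End Embedding.

(** * Evaluation at copies of the right creation operators in H *)

Section Compare.
Context {R : realType} {n : nat} (tens : tensor_product R) (F2 : fock_space R n).
Context {H : hilbertType R} (V : bop F2 H).
Local Notation e := (fock_e F2).
Local Notation "A \ot B" := (tensop tens A B) (at level 39, left associativity).
Local Notation rR := (scaled_right_creation F2).
Hypothesis V1 : bnd V 1.
Hypothesis V_isom : hadj V \bo V = bid F2.

(** A copy of r R inside H, zero on the complement of the range of V. It is a point of the row ball
    of H, and V carries evaluation at r R to evaluation there. *)
Definition push (r : R) i : bop H H := V \bo rR r i \bo hadj V.

Lemma push_comm r i : V \bo rR r i = push r i \bo V.
Proof.
apply: bop_ext => x; rewrite !bcompE.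
by have /(congr1 (fun T : bop F2 F2 => T x)) := V_isom; rewrite bcompE => ->.
Qed.

Lemma colbnd_push (r s : R) : 0 <= r <= s ->
  colbnd (fun i => hadj (push r i)) (s ^+ 2).
Proof.
move=> rs z; apply: (@le_trans _ _ (s ^+ 2 * hnorm (hadj V z) ^+ 2)).
  apply: le_trans (colbnd_rightW rs (hadj V z)).
  apply: ler_sum => i _; rewrite /push !hadj_comp hadjK !bcompE.
  by rewrite ler_pXn2r ?nnegrE ?hnorm_ge0 //; have := V1 (hadj (rR r i) (hadj V z)); rewrite mul1r.
rewrite ler_wpM2l ?sqr_ge0 // ler_pXn2r ?nnegrE ?hnorm_ge0 //.
by have := bnd_hadj ler01 V1 z; rewrite mul1r.
Qed.

Lemma row_ball_push r : 0 <= r < 1 -> row_ball (push r).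
Proof.
move=> r01; have /andP[r0 r1] := r01.
by apply: (colbnd_row_ball r01); apply: colbnd_push; rewrite r0 lexx.
Qed.

Lemma tens_isometry E f : hadj (bid E \ot V) ((bid E \ot V) f) = f.
Proof.
rewrite hadj_tensop hadj_id -bcompE tensop_comp V_isom.
by rewrite (_ : bid E \bo bid E = bid E) ?tensop_id //; apply: bop_ext.
Qed.

Lemma fh_eval_push (E Y : hilbertType R) (F : free_holo n E Y) r f : 0 <= r < 1 ->
  fh_eval tens F (push r) ((bid E \ot V) f) = (bid Y \ot V) (fh_eval tens F (rR r) f).
Proof.
move=> /radius_mid[s s01 rs].
have := fh_eval_intertwine tens F s01 (colbnd_rightW rs) (colbnd_push rs) (push_comm r).
by move=> /(congr1 (fun T : bop (tens E F2) (tens Y H) => T f)); rewrite !bcompE.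
Qed.

(** One positive radius suffices: the vacuum column at r R contains each coefficient multiplied by
    r^|a|, which is nonzero. *)
Lemma free_holo_inj (E Y : hilbertType R) (F G : free_holo n E Y) r : 0 < r < 1 ->
  fh_eval tens F (push r) = fh_eval tens G (push r) -> F = G.
Proof.
move=> /andP[r0 r1] FG; have r01 : 0 <= r < 1 by rewrite ltW.
apply: free_holo_eq => a; apply: bop_ext => x; apply: hdotI => y.
rewrite hdotC [RHS]hdotC; congr (Num.conj _).
have ra : (r ^+ size a)%:C != 0 :> R[i].
  have rn : r != 0 by rewrite gt_eqF.
  by apply/eqP => -[/eqP]; rewrite expf_eq0 (negbTE rn) andbF.
have eFG f : fh_eval tens F (rR r) f = fh_eval tens G (rR r) f.
  rewrite -[LHS]tens_isometry -(fh_eval_push F f r01) FG (fh_eval_push G f r01).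
  exact: tens_isometry.
apply: (mulfI ra).
apply: (etrans (esym (fh_right_coef tens F2 F x y a r01))).
apply: (etrans _ (fh_right_coef tens F2 G x y a r01)).
exact: (congr1 (fun w => hdot w _) (eFG _)).
Qed.

Section Backward.
Context {E Y : hilbertType R} (Th : free_holo n E Y) (Th_ball : H2_unit_ball Th).
Local Notation Gam := (symbol tens F2 Th).
Local Notation Dt := (defect_to Gam).
Local Notation Df := (defect_from Gam).
Context (F : free_holo n E E) (G : free_holo n (defect_space Gam) (defect_space Gam)).

(* Also true when bid K - A is not invertible, as opinv is then 0. *)
Lemma cayley_ge0 (K : hilbertType R) (A : bop K K) d : bnd A 1 ->
  0 <= redot ((bid K + A) (opinv (bid K - A) d)) d.
Proof.
move=> A1; rewrite /opinv; case: xgetP => [S _ [_ AS]|_]; last by rewrite bop0 bop0r redot0l.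
set w := S d; have <- : (bid K - A) w = d by have /(congr1 (fun T : bop K K => T d)) := AS.
rewrite bopD bopB !bidE redotDl !redotBr !redotxx (redotC (A w)).
have : hnorm (A w) ^+ 2 <= hnorm w ^+ 2.
  by rewrite ler_pXn2r ?nnegrE ?hnorm_ge0 //; have := A1 w; rewrite mul1r.
lra.
Qed.

Lemma represents_ge :
  (forall X : 'I_n -> bop H H, row_ball X -> bnd (fh_eval tens G X) 1) ->
  represents H F G -> forall r, 0 <= r < 1 -> forall f,
  hnorm (fh_eval tens Th (rR r) f) ^+ 2 <= redot (fh_eval tens F (rR r) f) f.
Proof.
move=> G1 FG r r01 f; have [s s01 rs] := radius_mid r01.
pose z := (bid E \ot V) f.
have -> : redot (fh_eval tens F (rR r) f) f = redot (fh_eval tens F (push r) z) z.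
  by rewrite fh_eval_push // redotPr tens_isometry.
have -> : hnorm (fh_eval tens Th (rR r) f) ^+ 2 = hnorm (fh_eval tens Th (push r) z) ^+ 2.
  by rewrite fh_eval_push // -[RHS]redotxx (redotPr (bid Y \ot V)) tens_isometry redotxx.
have rb := row_ball_push r01.
rewrite FG // bopD redotDl.
have h1 := kernel_ge F2 Th_ball z s01 (colbnd_push rs).
rewrite -[leLHS]addr0; apply: lerD; first exact: h1.
have [Gam1 _] := symbolP tens F2 Th_ball.
rewrite [X in redot X _]bcompE; set d := (Dt \ot bid H) z.
have -> : Df \ot bid H = hadj (Dt \ot bid H) by rewrite hadj_tensop hadj_id defect_adj.
by rewrite [X in redot X _]bcompE [X in redot X _]bcompE -redotPr; exact: cayley_ge0 (G1 _ rb).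
Qed.

(** Recovering G from F means inverting a Cayley transform. The radius [t] makes G(X) and G'(X)
    strict contractions at one common point, so that [opinv] is a true inverse there rather than its
    default. *)
Lemma represents_inj (F' : free_holo n E E)
    (G' : free_holo n (defect_space Gam) (defect_space Gam)) :
  G [::] = 0 -> G' [::] = 0 -> represents H F G -> represents H F' G' ->
  F = F' <-> G = G'.
Proof.
move=> G0 G'0 FG FG'; split=> [FF'|GG']; last first.
  apply: (free_holo_inj (half01 R)); rewrite FG ?FG' ?GG' //; apply: row_ball_push;
  by have /andP[/ltW -> ->] := half01 R.
have [r /andP[r0 r1] [s s01 Gs]] := fh_small tens G0.
have [r' /andP[r'0 r'1] [s' s'01 Gs']] := fh_small tens G'0.
pose t := Num.min r r'.
have t0 : 0 < t by rewrite lt_min r0.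
have t1 : t < 1 by rewrite gt_min r1.
have tr : 0 <= t <= r by rewrite ltW //= ge_min lexx.
have tr' : 0 <= t <= r' by rewrite ltW //= ge_min lexx orbT.
have rb : row_ball (push t) by apply: row_ball_push; rewrite ltW.
have A1 := Gs _ _ (colbnd_push tr); have A'1 := Gs' _ _ (colbnd_push tr').
have t01 : 0 < t < 1 by rewrite t0.
apply: (free_holo_inj t01); set A := fh_eval tens G (push t) in A1 *.
set A' := fh_eval tens G' (push t) in A'1 *.
have [I1 I2 _] := opinv_neumann s01 A1; have [I'1 I'2 _] := opinv_neumann s'01 A'1.
have [Gam1 _] := symbolP tens F2 Th_ball.
have tD : total (Dt \ot bid H).
  move=> u hu; apply: (@total_tens _ tens _ _ _ _ Dt id); first exact: total_defect.
    by move=> w hw; apply: hnorm_eq0; apply/eqP; rewrite -sqrf_eq0 -redotxx /redot hw.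
  by move=> [x h]; have := hu (tpure _ x h); rewrite tensopE.
pose M B := (bid (tens (defect_space Gam) H) + B) \bo opinv (bid _ - B).
(* The outer factors D (x) I cancel because the range of [defect_to], tensored with H, is total in
   the defect space tensored with H. *)
have MM : M A = M A'.
  apply: (total_ext tD) => z; apply: (total_dot tD) => w.
  have adj : Df \ot bid H = hadj (Dt \ot bid H) by rewrite hadj_tensop hadj_id defect_adj.
  have eB B : hdot ((Dt \ot bid H) w) (M B ((Dt \ot bid H) z)) = hdot w ((Df \ot bid H
      \bo (bid _ + B) \bo opinv (bid _ - B) \bo Dt \ot bid H) z) by rewrite adj; exact: hadjP.
  have FA := FG _ rb; have FA' := FG' _ rb.
  rewrite -FF' FA -/A -/A' in FA'; move/addrI: FA' => FA'.
  by apply: (etrans (eB A)); rewrite FA'; exact/esym/(eB A').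
have ME B s0 : 0 <= s0 < 1 -> bnd B s0 -> M B = 2 *: opinv (bid _ - B) - bid _.
  move=> s001 /(opinv_neumann s001)[J _ _]; apply: bop_ext => z.
  rewrite bopB bopZ bidE /M bcompE; set w := opinv _ z.
  have <- : (bid _ - B) w = z by have /(congr1 (fun T : bop _ _ => T z)) := J.
  by rewrite bopD bopB !bidE scaler_nat mulr2n opprB addrA addrAC addrK.
have NN : opinv (bid _ - A) = opinv (bid _ - A').
  have /addIr := etrans (esym (ME A s s01 A1)) (etrans MM (ME A' s' s'01 A'1)).
  by apply: scalerI; rewrite pnatr_eq0.
have AA : bid _ - A = bid _ - A'.
  by rewrite -NN in I'1; exact: inverse_unique I2 I'1.
by move/addrI: AA => /oppr_inj.
Qed.

End Backward.

End Compare.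

Theorem theorem3p1 (R : realType) (n : nat) (n_gt0 : (0 < n)%N)
    (E Y H : hilbertType R) (E_separable : separable E)
    (H_infinite : infinite_dimensional H)
    (tens : tensor_product R) (F2 : fock_space R n)
    (Theta : free_holo n E Y) (Theta_ball : H2_unit_ball Theta) :
  let Gamma := symbol tens F2 Theta in
  (forall F : free_holo n E E,
    fh_eval tens F (fun=> 0 : bop H H) = bid (tens E H) ->
    (forall r : R, 0 <= r < 1 ->
       op_le (hadj (fh_eval tens Theta (scaled_right_creation F2 r))
                \bo fh_eval tens Theta (scaled_right_creation F2 r))
             (opRe (fh_eval tens F (scaled_right_creation F2 r))))
    <->
    (exists G : free_holo n (defect_space Gamma) (defect_space Gamma),
       H0inf_unit_ball tens H G /\ represents H F G))
  /\
  (forall (Fa Fb : free_holo n E E)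
          (Ga Gb : free_holo n (defect_space Gamma) (defect_space Gamma)),
    fh_eval tens Fa (fun=> 0 : bop H H) = bid (tens E H) ->
    fh_eval tens Fb (fun=> 0 : bop H H) = bid (tens E H) ->
    H0inf_unit_ball tens H Ga -> H0inf_unit_ball tens H Gb ->
    represents H Fa Ga -> represents H Fb Gb ->
    (Fa = Fb <-> Ga = Gb)).
Proof.
move=> Gamma; have [V V1 V_isom] := fock_embedding H_infinite F2.
(* A nonzero vector of H makes A |-> A (x) I injective, which converts conditions on the values at 0
   into conditions on the coefficient of the empty word. *)
have [h h0] : exists h : H, hnorm h != 0.
  have [h hP] := H_infinite [::]; exists h; apply/eqP => /hnorm_eq0 h0.
  by apply: (hP (fun=> 0)); rewrite big_ord0.
have tens_inj K K' (A B : bop K K') :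
    tensop tens A (bid H) = tensop tens B (bid H) -> A = B.
  move=> AB; apply/eqP; rewrite -subr_eq0; apply/eqP/bop_ext => x; apply: hnorm_eq0.
  have : hnorm (tensop tens (A - B) (bid H) (tpure _ x h)) = 0.
    by rewrite tensopBl AB subrr hnorm0.
  rewrite tensopE hnorm_tpure bidE => /eqP; rewrite mulf_eq0 (negbTE h0) orbF => /eqP.
  by [].
have G_ball (G : free_holo n (defect_space Gamma) (defect_space Gamma)) :
    H0inf_unit_ball tens H G -> G [::] = 0 /\
    forall X : 'I_n -> bop H H, row_ball X -> bnd (fh_eval tens G X) 1.
  move=> [[_ G0] G1]; split.
    by apply: tens_inj; rewrite -fh_eval0 G0 tensop0l.
  move=> X Xb; apply: bnd_le (opnorm_bnd _); rewrite -lee_fin.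
  by apply: le_trans G1; apply: ereal_sup_ubound; exists X.
split=> [F F0|Fa Fb Ga Gb _ _ /G_ball[Ga0 _] /G_ball[Gb0 _] FGa FGb]; last first.
  exact: (represents_inj V1 V_isom Theta_ball Ga0 Gb0 FGa FGb).
have {}F0 : F [::] = bid E.
  by apply: tens_inj; rewrite -fh_eval0 F0 tensop_id.
split=> [pos|[G [/G_ball[_ G1] FG]] r r01]; last first.
  apply/op_le_opRe => f.
  exact: (represents_ge V1 V_isom Theta_ball G1 FG).
have pos' r : 0 <= r < 1 -> forall f,
    hnorm (fh_eval tens Theta (scaled_right_creation F2 r) f) ^+ 2 <=
    redot (fh_eval tens F (scaled_right_creation F2 r) f) f.
  by move=> r01; apply/op_le_opRe; exact: pos.
have [G G0 GP] := herglotz_schur Theta_ball F0 pos'.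
have Gle1 : (Hinf_norm tens H G <= 1)%E.
  apply: ub_ereal_sup => _ [X /row_ball_colbnd[r r01 Xr] <-]; rewrite lee_fin.
  have [Gr _] := GP H X r r01 Xr; have /andP[r0 r1] := r01.
  by apply: opnorm_le => //; apply: bnd_le Gr; exact: ltW.
exists G; split.
  split=> //; split; first by apply: le_lt_trans Gle1 _; exact: ltry.
  by rewrite fh_eval0 G0 tensop0l.
move=> X /row_ball_colbnd[r r01 Xr].
by have [_] := GP H X r r01 Xr.
Qed.
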